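(* Let $n\ge 2$. The simplicial complex associated to the ordered set of all positive (partial) periodic flags in $H^n$ is an affine city; likewise, the simplicial complex associated to the ordered set of all negative (partial) periodic flags in $H^n$ is an affine city.
   Context: Setting. $H=H^n=L^2(S^1,\mathbb{C}^n)$, and $z=e^{i\theta}$ acts on $H$ by multiplication. $H^0$ is the space of constant functions; $H^{++}$ (resp. $H^{--}$) is the closed subspace of functions all of whose nonzero Fourier coefficients have positive (resp. negative) index; $H^+=H^{++}\oplus H^0$ and $H^-=H^0\oplus H^{--}$. Grassmannians. $Gr^+(H)$ is the set of closed subspaces $W\subset H$ such that the orthogonal projection $W\to H^+$ is Fredholm and the orthogonal projection $W\to H^{--}$ is compact. $Gr^-(H)$ is the set of closed subspaces $W\subset H$ such that the orthogonal projection $W\to H^-$ is Fredholm and the orthogonal projection $W\to H^{++}$ is compact. $Gr^{n,+}=\{W\in Gr^+(H): zW\subset W\}$ and $Gr^{n,-}=\{W\in Gr^-(H): z^{-1}W\subset W\}$. Flags. A full positive periodic flag is a sequence $\{W_k\}_{k\in\mathbb{Z}}$ in $Gr^{n,+}$ with $W_{k+1}\subset W_k$, $\dim(W_k/W_{k+1})=1$ and $zW_k=W_{k+n}$ for all $k$. A (partial) positive periodic flag is a sequence with $W_{k+1}\subseteq W_k$ and $zW_k=W_{k+n}$, the condition on the dimension of quotients being dropped; it is identified with its set of members. Negative periodic flags are defined in the same way with $Gr^{n,-}$ in place of $Gr^{n,+}$ and $z^{-1}W_k=W_{k+n}$. Flags are partially ordered by inclusion of their sets of members. The associated simplicial complex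 has as simplices the partial periodic flags; its vertices are the elementary flags $\{z^kW\}_{k\in\mathbb{Z}}$, and two elementary flags $\{z^kW\}$, $\{z^kW'\}$ are incident iff there are integers $l_1,l_2$ with $W\subset z^{l_1}W'\subset z^{l_1+l_2}W$ or the same with reversed inclusions, i.e. iff all their members together form a chain. Maximal simplices (chambers) are full flags. Affine city. An affine city is a simplicial complex each of whose connected components is a (thick) affine building. *)

(* Defs.v *)
From HB Require Import structures.
From mathcomp Require Import all_boot all_order all_algebra ring_quotient.
From mathcomp Require Import complex.
From mathcomp Require Import all_classical all_reals all_analysis measurable_realfun.
From mathcomp Require Import ring lra.

Set Implicit Arguments.
Unset Strict Implicit.
Unset Printing Implicit Defensive.

Import Order.TTheory GRing.Theory Num.Theory.
Import numFieldNormedType.Exports.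

Local Open Scope classical_set_scope.
Local Open Scope ring_scope.
Local Open Scope complex_scope.
Local Open Scope quotient_scope.

Local Notation Re := complex.Re.
Local Notation Im := complex.Im.

Section CircleFunctions.
Context {R : realType}.
Local Notation C := R[i].

Lemma two_pi_gt0 : 0 < 2 * pi :> R.
Proof. by rewrite mulr_gt0 ?pi_gt0. Qed.

(* A function on the circle is a function of the angle, the circle carrying
   d theta / 2 pi on [0, 2 pi]; values outside [0, 2 pi] are irrelevant. *)
Definition circle : probability (measurableTypeR R) R := uniform_prob two_pi_gt0.

Definition zeta (t : R) : C := cos t +i* sin t.

Lemma zetaX (k : int) t : zeta t ^ k = cos (k%:~R * t) +i* sin (k%:~R * t).
Proof.
have nat (m : nat) : zeta t ^+ m = cos (m%:R * t) +i* sin (m%:R * t).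
  elim: m => [|m IH]; first by rewrite expr0 mul0r cos0 sin0.
  rewrite exprS IH -natr1 mulrDl mul1r addrC cosD sinD.
  by apply/eqP; rewrite eq_complex /=; apply/andP; split; apply/eqP; ring.
case: k => m; first exact: nat.
rewrite -[LHS]/((zeta t ^+ m.+1)^-1) nat NegzE mulrNz mulNr cosN sinN.
apply: mulr1_eq; apply/eqP; rewrite eq_complex /=; set x := _ * t.
by rewrite mulrN opprK -!expr2 cos2Dsin2 mulrN (mulrC (sin x)) addNr !eqxx.
Qed.

Definition circle_int (h : R -> C) : C :=
  (\int[circle]_t Re (h t)) +i* (\int[circle]_t Im (h t)).

End CircleFunctions.

Section RealL2.
Context {R : realType}.
Local Notation L2R := (Lfun (@circle R) 2%:E).
Implicit Types f g : R -> R.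

Lemma L2RD f g : f \in L2R -> g \in L2R -> (fun t => f t + g t) \in L2R.
Proof.
by have [_] := @Lfun_addr_closed _ _ R (@circle R) 2%:E ltac:(by rewrite lee1n); apply.
Qed.

Lemma L2RN f : f \in L2R -> (fun t => - f t) \in L2R.
Proof. exact: Lfun_oppr_closed. Qed.

Lemma L2RZ (a : R) f : f \in L2R -> (fun t => a * f t) \in L2R.
Proof.
move=> Lf; have -> : (fun t => a * f t) = a \o* f.
  by apply/funext => t; rewrite /= mulrC.
by apply: Lfun_scale; rewrite // ler1n.
Qed.

Lemma L2R_cst (a : R) : (fun=> a) \in L2R.
Proof. exact: Lfun_cst. Qed.

Lemma L2RM f g : measurable_fun [set: measurableTypeR R] g ->
  (forall t, `|g t| <= 1) -> f \in L2R -> (fun t => g t * f t) \in L2R.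
Proof.
move=> mg g1 Lf; have := Lfun_integrable (ler1n R 2) Lf.
have /andP[/[!inE]/= mf _] := Lf.
move=> /integrableP[_ If]; apply/andP; split; rewrite inE/=.
  exact: measurable_funM.
rewrite /finite_norm unlock poweR_lty//.
apply: le_lt_trans If; apply: ge0_le_integral => //.
- by move=> t _; rewrite lee_fin powR_ge0.
- apply/measurable_EFinP; apply: (measurableT_comp (measurable_powR _)) => //.
  by apply: measurableT_comp => //; exact: measurable_funM.
- apply: measurableT_comp => //; apply/measurable_EFinP.
  apply: (measurableT_comp (measurable_powR _)) => //.
  exact: measurableT_comp.
- move=> t _ /=; rewrite lee_fin [leRHS]ger0_norm ?powR_ge0//.
  by apply: ge0_ler_powR; rewrite ?nnegrE// normrM ler_piMl.
Qed.

Lemma L2R_prod f g : f \in L2R -> g \in L2R ->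
  (@circle R).-integrable [set: measurableTypeR R] (EFin \o (fun t => f t * g t)).
Proof. by move=> Lf Lg; apply/Lfun1_integrable; exact: Lfun2_mul_Lfun1. Qed.

End RealL2.

Section L2functions.
Context (R : realType) (n : nat).
Local Notation C := R[i].
Local Notation L2R := (Lfun (@circle R) 2%:E).

Definition square_integrable : {pred R -> 'cV[C]_n} :=
  fun f => [forall i, ((fun t => Re (f t i 0)) \in L2R) &&
                      ((fun t => Im (f t i 0)) \in L2R)].

Lemma square_integrable_submod_closed : submod_closed square_integrable.
Proof.
split=> [|a f g /forallP Lf /forallP Lg]; apply/forallP => i.
  have -> : (fun t => Re ((0 : R -> 'cV[C]_n) t i 0)) = (fun=> 0).
    by apply/funext => t; rewrite (_ : (0 : R -> 'cV[C]_n) t = 0) // mxE.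
  have -> : (fun t => Im ((0 : R -> 'cV[C]_n) t i 0)) = (fun=> 0).
    by apply/funext => t; rewrite (_ : (0 : R -> 'cV[C]_n) t = 0) // mxE.
  by rewrite L2R_cst.
have /andP[rf jf] := Lf i; have /andP[rg jg] := Lg i.
have -> : (fun t => Re ((a *: f + g) t i 0)) =
  (fun t => (Re a * Re (f t i 0) + (- (Im a * Im (f t i 0)))) + Re (g t i 0)).
  apply/funext => t; rewrite !fctE !mxE.
  by case: (f t i 0) (g t i 0) a => [? ?] [? ?] [? ?].
have -> : (fun t => Im ((a *: f + g) t i 0)) =
  (fun t => (Re a * Im (f t i 0) + Im a * Re (f t i 0)) + Im (g t i 0)).
  apply/funext => t; rewrite !fctE !mxE.
  by case: (f t i 0) (g t i 0) a => [? ?] [? ?] [? ?].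
by apply/andP; split; apply: L2RD => //; apply: L2RD; rewrite ?L2RN ?L2RZ.
Qed.

HB.instance Definition _ := GRing.isSubmodClosed.Build C (R -> 'cV[C]_n)
  square_integrable square_integrable_submod_closed.

Record L2fun := MkL2fun {
  L2fun_val :> R -> 'cV[C]_n ;
  _ : L2fun_val \in square_integrable }.

HB.instance Definition _ := [isSub for L2fun_val].
HB.instance Definition _ := [Choice of L2fun by <:].
HB.instance Definition _ := [SubChoice_isSubLmodule of L2fun by <:].

Definition ae_null : {pred L2fun} :=
  fun f => `[< {ae @circle R, forall t, f t = 0} >].

Lemma ae_null_zmod_closed : zmod_closed ae_null.
Proof.
split=> [|f g /asboolP f0 /asboolP g0]; apply/asboolP.
  by apply: aeW => t.
by move: f0 g0; apply: (@filterS2 (measurableTypeR R)) => t /= f0 g0; rewrite -[LHS]/(f t - g t) f0 g0 subr0.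
Qed.

HB.instance Definition _ := GRing.isZmodClosed.Build L2fun ae_null
  ae_null_zmod_closed.

(* L^2(S^1, C^n): square-integrable functions modulo a.e. equality. *)
Definition L2 : Type := Quotient.quot ae_null.

HB.instance Definition _ := Choice.on L2.
HB.instance Definition _ := GRing.Zmodule.on L2.
HB.instance Definition _ := EqQuotient.on L2.
HB.instance Definition _ := ZmodQuotient.on L2.

Lemma L2_eqP (f g : L2fun) :
  reflect ({ae @circle R, forall t, f t = g t}) (f == g %[mod L2]).
Proof.
rewrite -Quotient.idealrBE; apply: (iffP (asboolP _)).
  by apply: (@filterS (measurableTypeR R)) => t /eqP; rewrite subr_eq0 => /eqP.
by apply: (@filterS (measurableTypeR R)) => t fg; rewrite -[LHS]/(f t - g t) fg subrr.
Qed.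

Definition L2scale (a : C) : L2 -> L2 := lift_op1 L2 (fun f => a *: f).

Lemma pi_L2scale a : {morph \pi_L2 : f / a *: f >-> L2scale a f}.
Proof.
move=> f; unlock L2scale; apply/eqP/L2_eqP.
have /eqP/L2_eqP : \pi_L2 f = \pi_L2 (repr (\pi_L2 f)) by rewrite reprK.
apply: (@filterS (measurableTypeR R)) => t E.
by rewrite -[LHS]/(a *: f t) E.
Qed.

Lemma L2scalerA a b v : L2scale a (L2scale b v) = L2scale (a * b) v.
Proof. by rewrite -[v]reprK -!pi_L2scale scalerA. Qed.

Lemma L2scale1r : left_id 1 L2scale.
Proof. by move=> v; rewrite -[v]reprK -pi_L2scale scale1r. Qed.

Lemma L2scalerDr : right_distributive L2scale +%R.
Proof.
move=> a u v; rewrite -[u]reprK -[v]reprK -pi_addr -!pi_L2scale.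
by rewrite -pi_addr scalerDr.
Qed.

Lemma L2scalerDl v : {morph L2scale^~ v : a b / a + b}.
Proof.
by move=> a b; rewrite -[v]reprK -!pi_L2scale -pi_addr scalerDl.
Qed.

HB.instance Definition _ := GRing.Zmodule_isLmodule.Build C L2
  L2scalerA L2scale1r L2scalerDr L2scalerDl.

(* The class of f, for square-integrable f (and 0 otherwise). *)
Definition L2class (f : R -> 'cV[C]_n) : L2 := \pi_L2 (insubd 0 f).

Definition L2rep (h : L2) : R -> 'cV[C]_n := L2fun_val (repr h).

Lemma L2funDE (f g : L2fun) : L2fun_val (f + g) = fun t => f t + g t.
Proof. by []. Qed.

Lemma L2funZE (a : C) (f : L2fun) : L2fun_val (a *: f) = fun t => a *: f t.
Proof. by []. Qed.

(* The hermitian product, linear in the first argument. *)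
Definition Cn_dot (u v : 'cV[C]_n) : C := \sum_i u i 0 * (v i 0)^*%C.

Definition L2dot (h k : L2) : C :=
  circle_int (fun t => Cn_dot (L2rep h t) (L2rep k t)).

Definition L2norm (h : L2) : R := Num.sqrt (Re (L2dot h h)).

Let ReD : {morph (@complex.Re R) : x y / x + y}.
Proof. by case=> ? ? []. Qed.

Lemma Re_Cn_dot u v : Re (Cn_dot u v) =
  \sum_i (Re (u i 0) * Re (v i 0) + Im (u i 0) * Im (v i 0)).
Proof.
rewrite /Cn_dot (big_morph _ ReD erefl); apply: eq_bigr => i _.
by case: (u i 0) (v i 0) => [a b] [c d] /=; rewrite mulrN opprK.
Qed.

Lemma Re_Cn_dot_ge0 u : 0 <= Re (Cn_dot u u).
Proof.
by rewrite Re_Cn_dot sumr_ge0// => i _; rewrite addr_ge0// -expr2 sqr_ge0.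
Qed.

Lemma Re_Cn_dot_eq0 u : Re (Cn_dot u u) = 0 -> u = 0.
Proof.
rewrite Re_Cn_dot => /eqP; rewrite psumr_eq0; last first.
  by move=> i _; rewrite addr_ge0// -expr2 sqr_ge0.
move=> /allP u0; apply/matrixP => i j; rewrite (ord1 j) mxE.
have := u0 i (mem_index_enum i); rewrite /= paddr_eq0 -?expr2 ?sqr_ge0//.
by case: (u i 0) => a b /=; rewrite !sqrf_eq0 => /andP[/eqP -> /eqP ->].
Qed.

Let rdot (f g : L2fun) : R := \int[circle]_t Re (Cn_dot (f t) (g t)).

Let rdot_integrable (f g : L2fun) :
  (@circle R).-integrable [set: measurableTypeR R]
    (EFin \o (fun t => Re (Cn_dot (f t) (g t)))).
Proof.
rewrite (_ : _ \o _ = fun t => (\sum_(i < n) ((Re (f t i 0) * Re (g t i 0))%:E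
   + (Im (f t i 0) * Im (g t i 0))%:E))%E); last first.
  by apply/funext => t; rewrite /= Re_Cn_dot -sumEFin.
apply: integrable_sum => // i _.
have /forallP/(_ i)/andP[rf jf] := valP f.
have /forallP/(_ i)/andP[rg jg] := valP g.
by apply: integrableD => //; exact: L2R_prod.
Qed.

Let rdotC (f g : L2fun) : rdot f g = rdot g f.
Proof.
apply: eq_Rintegral => t _; rewrite !Re_Cn_dot; apply: eq_bigr => i _.
by rewrite mulrC [X in _ + X]mulrC.
Qed.

Let rdotDl (f g h : L2fun) : rdot (f + g) h = rdot f h + rdot g h.
Proof.
rewrite -RintegralD//; apply: eq_Rintegral => t _.
rewrite !Re_Cn_dot -big_split; apply: eq_bigr => i _ /=.
rewrite addrfctE mxE.
by case: (f t i 0) (g t i 0) => [? ?] [? ?] /=; ring.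
Qed.

Let rdotZl (a : R) (f g : L2fun) : rdot (a%:C *: f) g = a * rdot f g.
Proof.
rewrite -RintegralZl//; apply: eq_Rintegral => t _.
rewrite !Re_Cn_dot mulr_sumr; apply: eq_bigr => i _ /=.
rewrite scalrfctE mxE.
by case: (f t i 0) => ? ? /=; ring.
Qed.

Let rdotZZ (a : C) (f : L2fun) :
  rdot (a *: f) (a *: f) = (Re a ^+ 2 + Im a ^+ 2) * rdot f f.
Proof.
rewrite -RintegralZl//; apply: eq_Rintegral => t _.
rewrite !Re_Cn_dot mulr_sumr; apply: eq_bigr => i _ /=.
rewrite scalrfctE mxE.
by case: (f t i 0) a => [? ?] [? ?] /=; ring.
Qed.

Let rdot_ge0 (f : L2fun) : 0 <= rdot f f.
Proof. by apply: Rintegral_ge0 => t _; exact: Re_Cn_dot_ge0. Qed.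

Let rdot_ext (f g : L2fun) : f == g %[mod L2] -> rdot f f = rdot g g.
Proof.
move=> /L2_eqP fg; congr fine; apply: ae_eq_integral => //.
- exact: (measurable_int _ (rdot_integrable f f)).
- exact: (measurable_int _ (rdot_integrable g g)).
by apply: (@filterS (measurableTypeR R)) fg => t -> _.
Qed.

Let rdot_eq0 (f : L2fun) : rdot f f = 0 -> f == 0 %[mod L2].
Proof.
move=> f0; apply/L2_eqP; have If := rdot_integrable f f.
have : ae_eq circle setT (EFin \o (fun t => Re (Cn_dot (f t) (f t)))) (cst 0%E).
  apply/ae_eq_integral_abs => //; first exact: (measurable_int _ If).
  have -> : 0%E = (rdot f f)%:E by rewrite f0.
  rewrite /rdot /Rintegral fineK; last exact: integrable_fin_num.
  by apply: eq_integral => t _; rewrite gee0_abs// lee_fin Re_Cn_dot_ge0.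
apply: (@filterS (measurableTypeR R)) => t /(_ I) [] /Re_Cn_dot_eq0 ->.
by [].
Qed.

Let L2normE (f : L2fun) : L2norm (\pi_L2 f) = Num.sqrt (rdot f f).
Proof.
rewrite /L2norm /L2dot /=; congr Num.sqrt.
by apply: rdot_ext; rewrite reprK.
Qed.

Let sqrt_rdot_triangle (f g : L2fun) :
  Num.sqrt (rdot (f + g) (f + g)) <= Num.sqrt (rdot f f) + Num.sqrt (rdot g g).
Proof.
set a := Num.sqrt (rdot f f); set b := Num.sqrt (rdot g g).
have a0 : 0 <= a := sqrtr_ge0 _; have b0 : 0 <= b := sqrtr_ge0 _.
have aa : a ^+ 2 = rdot f f by rewrite sqr_sqrtr.
have bb : b ^+ 2 = rdot g g by rewrite sqr_sqrtr.
have rdotDr h k l : rdot h (k + l) = rdot h k + rdot h l.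
  by rewrite rdotC rdotDl ![rdot _ h]rdotC.
have rdotZr (x : R) h k : rdot h (x%:C *: k) = x * rdot h k.
  by rewrite rdotC rdotZl rdotC.
have null h k : rdot h h = 0 -> rdot h k = 0.
  move=> h0; apply/eqP/negPn/negP => hk0.
  pose x := - (rdot k k + 1) / (2 * rdot h k).
  have := rdot_ge0 (x%:C *: h + k).
  rewrite rdotDl !rdotDr !rdotZl !rdotZr h0 (rdotC k h).
  have -> : x * (x * 0) + x * rdot h k + (x * rdot h k + rdot k k) = - 1.
    by rewrite /x; field.
  by rewrite oppr_ge0 ler10.
have CS : rdot f g <= a * b.
  have [a00|an0] := eqVneq a 0; first by rewrite null -?aa a00 ?expr0n//= mul0r.
  have [b00|bn0] := eqVneq b 0.
    by rewrite rdotC null -?bb b00 ?expr0n//= mulr0.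
  have ab0 : 0 < a * b by rewrite mulr_gt0// lt0r ?an0 ?bn0.
  have := rdot_ge0 (b%:C *: f + (- a)%:C *: g).
  rewrite rdotDl !rdotDr !rdotZl !rdotZr (rdotC g f) -aa -bb.
  have -> : b * (b * a ^+ 2) + b * (- a * rdot f g) +
    (- a * (b * rdot f g) + - a * (- a * b ^+ 2)) =
    2 * (a * b) * (a * b - rdot f g) by ring.
  have ab2 : 0 < 2 * (a * b) by rewrite mulr_gt0.
  by rewrite (pmulr_rge0 _ ab2) subr_ge0.
rewrite -(@ler_pXn2r _ 2)// ?nnegrE ?sqrtr_ge0 ?addr_ge0//.
rewrite sqr_sqrtr// rdotDl !rdotDr (rdotC g f) sqrrD aa bb.
by rewrite -mulr_natl; lra.
Qed.

Let L2norm_triangle (h k : L2) :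
  (L2norm (h + k))%:C <= (L2norm h)%:C + (L2norm k)%:C.
Proof.
rewrite -[h]reprK -[k]reprK -pi_addr !L2normE -rmorphD /= lecR.
exact: sqrt_rdot_triangle.
Qed.

Let L2normZ (a : C) (h : L2) : (L2norm (a *: h))%:C = `|a| * (L2norm h)%:C.
Proof.
rewrite -[h]reprK -[a *: _]pi_L2scale !L2normE rdotZZ normc_def -rmorphM.
by rewrite sqrtrM// addr_ge0 ?sqr_ge0.
Qed.

Let L2norm0_eq0 (h : L2) : (L2norm h)%:C = 0 -> h = 0.
Proof.
rewrite -[h]reprK L2normE => -[] /eqP; rewrite sqrtr_eq0 => h0.
rewrite -[RHS]pi_zeror; apply/eqP/rdot_eq0/le_anti.
by rewrite h0 rdot_ge0.
Qed.

HB.instance Definition _ := @Lmodule_isNormed.Build C L2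
  (fun h => (L2norm h)%:C) L2norm_triangle L2normZ L2norm0_eq0.

Lemma L2rep_class (f : R -> 'cV[C]_n) : f \in square_integrable ->
  {ae @circle R, forall t, L2rep (L2class f) t = f t}.
Proof.
move=> Lf; have : \pi_L2 (repr (L2class f)) == \pi_L2 (insubd 0 f) by rewrite reprK.
move=> /L2_eqP; apply: (@filterS (measurableTypeR R)) => t.
by have -> : L2fun_val (insubd 0 f) = f by exact: (@insubdK _ _ L2fun).
Qed.

Lemma square_integrable_cst (c : 'cV[C]_n) : (fun=> c) \in square_integrable.
Proof. by apply/forallP => i; rewrite !L2R_cst. Qed.

Lemma square_integrable_zeta (k : int) (f : R -> 'cV[C]_n) :
  f \in square_integrable -> (fun t => zeta t ^ k *: f t) \in square_integrable.
Proof.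
have mul (g : R -> C) : measurable_fun [set: measurableTypeR R] (fun t => Re (g t)) ->
    measurable_fun [set: measurableTypeR R] (fun t => Im (g t)) ->
    (forall t, Re (g t) ^+ 2 + Im (g t) ^+ 2 = 1) ->
    f \in square_integrable -> (fun t => g t *: f t) \in square_integrable.
  move=> mr mi g1 /forallP Lf; apply/forallP => i.
  have /andP[rf jf] := Lf i.
  have le1 (x y : R) : x ^+ 2 + y ^+ 2 = 1 -> (`|x| <= 1)%R.
    by move=> xy; rewrite ler_norml; apply/andP; split; nra.
  have r1 t : (`|Re (g t)| <= 1)%R by apply: le1 (g1 t).
  have i1 t : (`|Im (g t)| <= 1)%R by apply: (le1 _ (Re (g t))); rewrite addrC.
  have -> : (fun t => Re ((g t *: f t) i 0)) =
      (fun t => Re (g t) * Re (f t i 0) + - (Im (g t) * Im (f t i 0))).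
    by apply/funext => t; rewrite mxE; case: (g t) (f t i 0) => [? ?] [].
  have -> : (fun t => Im ((g t *: f t) i 0)) =
      (fun t => Re (g t) * Im (f t i 0) + Im (g t) * Re (f t i 0)).
    by apply/funext => t; rewrite mxE; case: (g t) (f t i 0) => [? ?] [].
  by apply/andP; split; apply: L2RD; rewrite ?L2RN ?L2RM.
have km : measurable_fun [set: measurableTypeR R] (fun t : R => k%:~R * t).
  exact: measurable_funM.
apply: mul => [||t].
- rewrite (_ : (fun t => _) = cos \o ( *%R k%:~R)); last first.
    by apply/funext => t; rewrite zetaX.
  by apply: measurableT_comp km; apply: continuous_measurable_fun => x; exact: continuous_cos.
- rewrite (_ : (fun t => _) = sin \o ( *%R k%:~R)); last first.
    by apply/funext => t; rewrite zetaX.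
  by apply: measurableT_comp km; apply: continuous_measurable_fun => x; exact: continuous_sin.
by rewrite zetaX cos2Dsin2.
Qed.

(* Multiplication by z ^ k, where z = exp (i theta). *)
Definition zmul (k : int) (h : L2) : L2 := L2class (fun t => zeta t ^ k *: L2rep h t).

Lemma zmulE k h : {ae @circle R, forall t, L2rep (zmul k h) t = zeta t ^ k *: L2rep h t}.
Proof. by apply: L2rep_class; apply: square_integrable_zeta; exact: valP. Qed.

Definition fourier (h : L2) (k : int) : 'cV[C]_n :=
  \col_i circle_int (fun t => L2rep h t i 0 * zeta t ^ (- k)).

End L2functions.

Section LinearAlgebra.
Context {K : pzRingType} {E : lmodType K}.

Definition is_subspace (W : set E) : Prop :=
  W 0 /\ forall (a : K) u v, W u -> W v -> W (a *: u + v).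

Definition finite_dim (V : set E) : Prop :=
  exists m (b : 'I_m -> E),
    V = [set v | exists c : 'I_m -> K, v = \sum_i c i *: b i].

Definition finite_codim (A V : set E) : Prop :=
  exists m (b : 'I_m -> E), (forall i, V (b i)) /\
    forall v, V v -> exists c : 'I_m -> K, A (v - \sum_i c i *: b i).

(* P, restricted to W and taking values in V, has finite-dimensional kernel and
   cokernel; for bounded operators between Hilbert spaces the range is then
   automatically closed. *)
Definition fredholm_on (P : E -> E) (W V : set E) : Prop :=
  finite_dim [set w | W w /\ P w = 0] /\ finite_codim (P @` W) V.

End LinearAlgebra.

Definition compact_on {K : numFieldType} {E : normedModType K} (P : E -> E)
    (W : set E) : Prop :=
  compact (closure (P @` [set w | W w /\ `|w| <= 1])).

Section Grassmannian.
Context (R : realType) (n : nat).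
Local Notation C := R[i].
Local Notation H := (L2 R n).

(* For a closed subspace V there is exactly one such p. *)
Definition orth_proj (V : set H) (h : H) : H :=
  xget 0 [set p | V p /\ forall v, V v -> L2dot (h - p) v = 0].

(* Hpp, Hmm, Hp and Hm are H^{++}, H^{--}, H^+ and H^-. *)
Definition H0 : set H := [set L2class (fun=> c) | c in [set: 'cV[C]_n]].

Definition Hpp : set H := [set h | forall k : int, k <= 0 -> fourier h k = 0].

Definition Hmm : set H := [set h | forall k : int, 0 <= k -> fourier h k = 0].

Definition Hp : set H := [set u + v | u in Hpp & v in H0].

Definition Hm : set H := [set u + v | u in H0 & v in Hmm].

Definition Gr_pos : set (set H) := [set W | [/\ is_subspace W, closed W,
  fredholm_on (orth_proj Hp) W Hp & compact_on (orth_proj Hmm) W]].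

Definition Gr_neg : set (set H) := [set W | [/\ is_subspace W, closed W,
  fredholm_on (orth_proj Hm) W Hm & compact_on (orth_proj Hpp) W]].

Definition zshift (k : int) (W : set H) : set H := zmul k @` W.

Definition Grn_pos : set (set H) := [set W | Gr_pos W /\ zshift 1 W `<=` W].

Definition Grn_neg : set (set H) := [set W | Gr_neg W /\ zshift (-1) W `<=` W].

Section Flags.
(* (G, e) is (Grn_pos, 1) for positive and (Grn_neg, -1) for negative flags. *)
Variables (G : set (set H)) (e : int).

Definition periodic_flag_seq (W : int -> set H) : Prop :=
  [/\ forall k, G (W k),
      forall k, W (k + 1) `<=` W k &
      forall k, zshift e (W k) = W (k + n%:Z)].

Definition periodic_flags : set (set (set H)) :=
  [set range W | W in periodic_flag_seq].

Definition elementary_flags : set (set (set H)) :=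
  [set range (fun k => zshift k W) | W in G].

(* The simplex of a partial flag F consists of the elementary flags below F.
   As F is the union of these, inclusion of simplices is inclusion of flags. *)
Definition flag_complex : set (set (set (set H))) :=
  [set elementary_flags `&` [set E | E `<=` F] | F in periodic_flags].

End Flags.

Definition positive_flag_complex := flag_complex Grn_pos 1.

Definition negative_flag_complex := flag_complex Grn_neg (-1).

End Grassmannian.

(* An abstract simplicial complex is the set of its nonempty simplices. *)
Section SimplicialComplex.
Context {T : Type}.
Implicit Types (K S : set (set T)) (A B : set T).

Definition is_complex K : Prop := forall A, K A ->
  [/\ finite_set A, A !=set0 & forall B, B !=set0 -> B `<=` A -> K B].

Definition vertices K : set T := [set v | K [set v]].

Definition subcomplex S K : Prop := is_complex S /\ S `<=` K.

Definition chamber K A : Prop := K A /\ forall B, K B -> A `<=` B -> B = A.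

Definition codim1_face K A B : Prop :=
  K A /\ exists2 v, ~ A v & B = A `|` [set v].

Definition thick K : Prop := forall A B, chamber K B -> codim1_face K A B ->
  exists B1 B2 B3, [/\ B1 <> B2, B2 <> B3 & B1 <> B3] /\
    [/\ chamber K B1 /\ A `<=` B1, chamber K B2 /\ A `<=` B2 &
        chamber K B3 /\ A `<=` B3].

Inductive connected_to K (v : T) : T -> Prop :=
| connected_refl : connected_to K v v
| connected_step u w :
    connected_to K v u -> K [set u; w] -> connected_to K v w.

Definition component K v : set (set T) :=
  [set A | K A /\ A `<=` connected_to K v].

End SimplicialComplex.

Definition complex_iso {T T' : Type} (K : set (set T)) (L : set (set T'))
    (phi : T -> T') : Prop :=
  set_inj (vertices K) phi /\ L = [set phi @` A | A in K].

(* A Coxeter matrix on I; the entry 0 stands for infinity. *)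
Section Coxeter.
Context {I : finType} (m : I -> I -> nat).

Definition coxeter_matrix : Prop :=
  [/\ forall i, m i i = 1%N, forall i j, m i j = m j i &
      forall i j, i != j -> m i j != 1%N].

(* Equality in the group with presentation < I | (i j) ^ m i j = 1 >, whose
   elements are represented by words. *)
Inductive coxeter_eq : seq I -> seq I -> Prop :=
| coxeter_refl w : coxeter_eq w w
| coxeter_sym w w' : coxeter_eq w w' -> coxeter_eq w' w
| coxeter_trans w w' w'' :
    coxeter_eq w w' -> coxeter_eq w' w'' -> coxeter_eq w w''
| coxeter_rel u v i j :
    coxeter_eq (u ++ flatten (nseq (m i j) [:: i; j]) ++ v) (u ++ v).

(* The coset of w modulo the standard parabolic subgroup generated by J. *)
Definition parabolic_coset (w : seq I) (J : {set I}) : set (seq I) :=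
  [set x | exists2 v, {subset v <= J} & coxeter_eq x (w ++ v)].

(* The vertices are the cosets of the maximal standard parabolic subgroups, and
   the coset of w modulo W_J has the vertices w W_(I \ i), for i not in J. *)
Definition coxeter_complex : set (set (set (seq I))) :=
  [set A | exists w (J : {set I}), J != [set: I]%SET /\
    A = [set parabolic_coset w [set~ i]%SET | i in [set i | i \notin J]]].

Definition irreducible_diagram : Prop := forall J : {set I},
  J != finset.set0 -> J != [set: I]%SET ->
  exists i j, [/\ i \in J, j \notin J & m i j != 2%N].

Definition coxeter_form (R : realType) (x y : I -> R) : R :=
  \sum_i \sum_j x i * y j *
    (if m i j == 0%N then - 1 else - cos (pi / (m i j)%:R)).

(* The affine Coxeter systems are the irreducible ones whose canonical bilinear
   form is positive semidefinite and degenerate. *)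
Definition affine_type (R : realType) : Prop :=
  [/\ irreducible_diagram,
      forall x : I -> R, 0 <= coxeter_form x x &
      exists x : I -> R, (exists i, x i != 0) /\ coxeter_form x x = 0].

End Coxeter.

Section Building.
Context {T : Type}.
Implicit Types (K S : set (set T)) (A B : set T).

Definition apartment_system {I : finType} (m : I -> I -> nat) K
    (apartments : set (set (set T))) : Prop :=
  [/\ forall S, apartments S -> subcomplex S K /\
        exists phi, complex_iso S (coxeter_complex m) phi,
      K = \bigcup_(S in apartments) S,
      forall A B, K A -> K B -> exists S, [/\ apartments S, S A & S B] &
      forall S S' A B, apartments S -> apartments S' ->
        S A -> S B -> S' A -> S' B ->
        exists2 phi, complex_iso S S' phi & forall v, (A `|` B) v -> phi v = v].

Definition thick_affine_building (R : realType) K : Prop :=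
  [/\ is_complex K, thick K &
      exists (I : finType) (m : I -> I -> nat) apartments,
        [/\ coxeter_matrix m, affine_type m R & apartment_system m K apartments]].

Definition affine_city (R : realType) K : Prop :=
  is_complex K /\
  forall v, vertices K v -> thick_affine_building R (component K v).

End Building.

Arguments positive_flag_complex : clear implicits.
Arguments negative_flag_complex : clear implicits.

(* Main.v *)
From HB Require Import structures.
From mathcomp Require Import all_boot all_order all_algebra ring_quotient.
From mathcomp Require Import complex.
From mathcomp Require Import all_classical all_reals all_analysis measurable_realfun.
Require Import Defs.
From mathcomp Require Import ring lra zify.

Set Implicit Arguments.
Unset Strict Implicit.
Unset Printing Implicit Defensive.

Import Order.TTheory GRing.Theory Num.Theory.
Import numFieldNormedType.Exports.

Local Open Scope classical_set_scope.
Local Open Scope ring_scope.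

(** Let e be 1 or -1, and let z stand for multiplication by exp (i e theta). Analysis enters only
through three facts about the members W of the Grassmannian: W is a subspace, W / z W has
dimension n, and every z-stable subspace between two translates of W is a member again.
Everything else is the theory of lattices, with members in the place of lattices.

The dimension is an index. Let N be the orthogonal complement of the Hardy space (H^+ or H^-)
and D their sum. The projection of W is Fredholm exactly when W is contained in D, W meets N in
finite dimension, and W + N has finite codimension in D ([fredholm_pairP]). The index of z W
relative to z N is that of W relative to N; and z N is N plus the n-dimensional space of
constants, so passing from z N to N costs n. The modular law turns this into dim W / z W = n
([fredholm_pair_rdim]). The third fact holds because closedness, the Fredholm property and
compactness all survive finite-dimensional extensions ([rdim_closed_compact],
[fredholm_pair_sup]). A projection is 0 where it does not exist, which is why D is carried along
instead of the whole space.

A partial flag refines to a full flag U with dim U k / U (k + 1) = 1 ([chain_flag]). So the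
simplices are the nonempty sets of vertices of full flags, and the components are the classes of
commensurable members ([full_complex_component]). In one class, a frame of a full flag L is a
family f k in L k outside L (k + 1) with f (k + n) = z (f k). Its apartment consists of the full
flags U for which f (p k) lies in U k outside U (k + 1), for some permutation p of the integers
commuting with the translation by n. Two full flags have a common frame by the butterfly lemma
([common_frame]). For a member X of an apartment of L, the set of k with f k in X is also the set
of places where the intersections of X with the L k jump ([adapted_jumps]). It does not depend on
f, and therefore yields one map, the retraction centred at L, which identifies every apartment
containing L with the Coxeter complex ([apartment_coxeter]). Two apartments containing L are thus
isomorphic by a map that fixes their intersection, and the general case goes through a third
apartment ([full_complex_building]). The complex is thick since a plane contains three lines.

The model is the Coxeter complex of the cycle with n vertices, given by generators and relations.
It is made concrete by the action of words on the integers, where the generator i exchanges i - 1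
and i modulo n. The action is faithful by Matsumoto's argument: sort a permutation by removing
descents, and compare two ways of sorting with a braid relation ([coxeter_eq_actP]). The maximal
parabolic subgroups are the stabilisers of the rays k >= i ([parabolic_cosetP]). *)

(** * Subspaces and relative dimension *)

Section Subspaces.
Context {K : fieldType} {E : lmodType K}.
Implicit Types (A B C M N V X Y : set E) (u v w : E) (d : nat).

Lemma subspaceD A u v : is_subspace A -> A u -> A v -> A (u + v).
Proof. by move=> [_ As] Au Av; rewrite -[u]scale1r; exact: As. Qed.

Lemma subspaceZ A (a : K) u : is_subspace A -> A u -> A (a *: u).
Proof. by move=> [A0 As] Au; rewrite -[_ *: _]addr0; exact: As. Qed.

Lemma subspaceN A u : is_subspace A -> A u -> A (- u).
Proof. by move=> As Au; rewrite -scaleN1r; exact: subspaceZ. Qed.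

Lemma subspaceB A u v : is_subspace A -> A u -> A v -> A (u - v).
Proof. by move=> As Au Av; apply: subspaceD => //; exact: subspaceN. Qed.

Lemma subspaceZr A (a : K) u : is_subspace A -> a != 0 -> A (a *: u) -> A u.
Proof. by move=> As a0 /(subspaceZ a^-1 As); rewrite scalerA mulVf// scale1r. Qed.

Lemma subspaceI A B : is_subspace A -> is_subspace B -> is_subspace (A `&` B).
Proof.
move=> [A0 As] [B0 Bs]; split=> // a u v [Au Bu] [Av Bv].
by split; [exact: As | exact: Bs].
Qed.

Lemma subspace0 : is_subspace [set 0 : E].
Proof. by split=> // a u v /= -> ->; rewrite scaler0 addr0. Qed.

Definition sumset A B : set E := [set u + v | u in A & v in B].

Lemma subspace_sum A B : is_subspace A -> is_subspace B -> is_subspace (sumset A B).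
Proof.
move=> [A0 As] [B0 Bs]; split; first by exists 0 => //; exists 0; rewrite ?addr0.
move=> a _ _ [u Au [v Bv <-]] [u' Au' [v' Bv' <-]].
exists (a *: u + u'); first exact: As.
exists (a *: v + v'); first exact: Bs.
by rewrite scalerDr addrACA.
Qed.

Lemma sumset_subl A B : is_subspace B -> A `<=` sumset A B.
Proof. by move=> [B0 _] u Au; exists u => //; exists 0; rewrite ?addr0. Qed.

Lemma sumset_subr A B : is_subspace A -> B `<=` sumset A B.
Proof. by move=> [A0 _] u Bu; exists 0 => //; exists u; rewrite ?add0r. Qed.

Lemma sumset_min A B C : is_subspace C -> A `<=` C -> B `<=` C -> sumset A B `<=` C.
Proof.
by move=> Cs hAC hBC _ [u Au [v Bv <-]]; apply: subspaceD => //; [exact: hAC|exact: hBC].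
Qed.

Lemma sumsetS A A' B B' : A `<=` A' -> B `<=` B' -> sumset A B `<=` sumset A' B'.
Proof.
by move=> AS BS _ [u Au [v Bv <-]]; exists u; [exact: AS|exists v => //; exact: BS].
Qed.

Lemma sumsetC A B : sumset A B = sumset B A.
Proof.
by apply/seteqP; split=> _ [u Au [v Bv <-]]; exists v => //; exists u; rewrite // addrC.
Qed.

(** The quotient of A by B is a line. *)
Definition covers A B : Prop := B `<=` A /\
  exists v, [/\ A v, ~ B v & forall u, A u -> exists a, B (u - a *: v)].

(** Any vector of A outside B can play the role of the generator. *)
Lemma covers_gen A B v : is_subspace A -> is_subspace B -> covers A B ->
  A v -> ~ B v -> forall u, A u -> exists a, B (u - a *: v).
Proof.
move=> As Bs [hBA [w [Aw nBw Bg]]] Av nBv u Au.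
have [a Ba] := Bg _ Av; have [b Bb] := Bg _ Au.
have a0 : a != 0 by apply/eqP => a0; apply: nBv; rewrite a0 scale0r subr0 in Ba.
exists (b / a).
have -> : u - (b / a) *: v = (u - b *: w) - (b / a) *: (v - a *: w).
  by rewrite scalerBr scalerA divfK// opprB addrA subrK.
by apply: subspaceB => //; exact: subspaceZ.
Qed.

Lemma covers_between A B C : is_subspace A -> is_subspace B -> is_subspace C ->
  covers A B -> B `<=` C -> C `<=` A -> C = A \/ C = B.
Proof.
move=> As Bs Cs hAB hBC hCA; have [hCB|/existsNP[v /not_implyP[Cv nBv]]] := pselect (C `<=` B).
  by right; apply/seteqP.
left; apply/seteqP; split=> // u Au.
have [a Ba] := covers_gen As Bs hAB (hCA _ Cv) nBv Au.
by rewrite -(subrK (a *: v) u); apply: subspaceD (hBC _ Ba) (subspaceZ _ Cs Cv).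
Qed.

Definition adjoin B v : set E := [set u | exists a, B (u - a *: v)].

Lemma subspace_adjoin B v : is_subspace B -> is_subspace (adjoin B v).
Proof.
move=> Bs; split=> [|a u w [b Bb] [c Bc]].
  by exists 0; rewrite scale0r subr0; case: Bs.
exists (a * b + c).
have -> : a *: u + w - (a * b + c) *: v = a *: (u - b *: v) + (w - c *: v).
  by rewrite scalerBr scalerDl scalerA opprD addrACA.
by case: Bs => _; apply.
Qed.

Lemma adjoin_sub B v : B `<=` adjoin B v.
Proof. by move=> u Bu; exists 0; rewrite scale0r subr0. Qed.

Lemma adjoin_mem B v : is_subspace B -> adjoin B v v.
Proof. by move=> [B0 _]; exists 1; rewrite scale1r subrr. Qed.

Lemma adjoin_min B v C : is_subspace C -> B `<=` C -> C v -> adjoin B v `<=` C.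
Proof.
move=> Cs hBC Cv u [a Ba]; rewrite -(subrK (a *: v) u).
by apply: subspaceD (hBC _ Ba) (subspaceZ _ Cs Cv).
Qed.

Lemma covers_adjoin B v : is_subspace B -> ~ B v -> covers (adjoin B v) B.
Proof.
by move=> Bs nBv; split; [exact: adjoin_sub|exists v; split=> //; exact: adjoin_mem].
Qed.

(** The dimension of A / B, as the length of a chain of covers: such chains are what full flags are
made of. *)
Inductive rdim A : set E -> nat -> Prop :=
| rdim0 : rdim A A 0%N
| rdimS B C d : rdim A B d -> is_subspace C -> covers B C -> rdim A C d.+1.

Lemma rdim_sub A B d : rdim A B d -> B `<=` A.
Proof.
elim=> {B d} [//|B C d _ hBA _ [hCB _]]; exact: subset_trans hBA.
Qed.

Lemma rdim_subspace A B d : rdim A B d -> is_subspace A -> is_subspace B.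
Proof. by case. Qed.

Lemma rdim_trans A B C d e : rdim A B d -> rdim B C e -> rdim A C (d + e)%N.
Proof.
move=> hAB; elim=> {C e} [|C D e _ hAC sD CD]; first by rewrite addn0.
by rewrite addnS; exact: rdimS hAC sD CD.
Qed.

(** Second isomorphism theorem: if A = B + (X and A) then intersecting with X loses nothing, as the
generator of each step may be chosen in X. *)
Lemma rdim_cap A B X d : is_subspace A -> is_subspace X -> rdim A B d ->
  A `<=` sumset B X -> rdim (X `&` A) (X `&` B) d.
Proof.
move=> sA sX; elim=> {B d} [|B C d hAB IH sC hBC] AX; first exact: rdim0.
have sB := rdim_subspace hAB sA; have hBA := rdim_sub hAB; have [hCB _] := hBC.
apply: (@rdimS _ (X `&` B)); first by apply: IH; apply: subset_trans AX (sumsetS _ _).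
  exact: subspaceI.
split; first by apply: setIS.
have [_ [v [Bv nCv _]]] := hBC.
have [c Cc [x Xx cx]] := AX v (hBA _ Bv).
have xE : x = v - c by rewrite -cx addrAC subrr add0r.
have Bx : B x by rewrite xE; apply: subspaceB => //; exact: hCB.
have nCx : ~ C x by move=> Cx; apply: nCv; rewrite -cx; exact: subspaceD.
exists x; split; [by []|by case|move=> u [Xu Bu]].
have [a Ca] := covers_gen sB sC hBC Bx nCx Bu.
by exists a; split=> //; apply: subspaceB (subspaceZ _ _ _).
Qed.

(** Second isomorphism theorem in the other direction, for Y that meets A inside B. *)
Lemma rdim_add A B Y d : is_subspace A -> is_subspace Y -> rdim A B d ->
  A `&` Y `<=` B -> rdim (sumset A Y) (sumset B Y) d.
Proof.
move=> sA sY; elim=> {B d} [|B C d hAB IH sC hBC] AY; first exact: rdim0.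
have sB := rdim_subspace hAB sA; have hBA := rdim_sub hAB; have [hCB _] := hBC.
apply: (@rdimS _ (sumset B Y)).
- by apply: IH; apply: subset_trans AY hCB.
- exact: subspace_sum.
split; first exact: sumsetS.
have [_ [v [Bv nCv vg]]] := hBC.
exists v; split; first exact: sumset_subl.
  move=> [c Cc [y Yy cy]]; apply: nCv; rewrite -cy; apply: subspaceD => //.
  apply: AY; split=> //; have -> : y = v - c by rewrite -cy addrAC subrr add0r.
  by apply: subspaceB => //; apply: hBA => //; exact: hCB.
move=> _ [b Bb [y Yy <-]]; have [a Ca] := vg _ Bb.
by exists a; exists (b - a *: v) => //; exists y; rewrite // addrAC.
Qed.

(** Jordan-Hoelder. The last step B / C of the chain is attributed to M / C if M contains B, and to
A / M otherwise, by comparing M with M + B. *)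
Lemma rdim_split A B M d : is_subspace A -> is_subspace M -> rdim A B d ->
  B `<=` M -> M `<=` A ->
  exists d1 d2, [/\ rdim A M d1, rdim M B d2 & (d1 + d2)%N = d].
Proof.
move=> sA sM hAB; elim: hAB M sM => {B d} [|B C d hAB IH sC hBC] M sM CM MA.
  have -> : M = A by apply/seteqP.
  by exists 0%N, 0%N; split=> //; exact: rdim0.
have sB := rdim_subspace hAB sA; have hBA := rdim_sub hAB; have [hCB _] := hBC.
have sMB : is_subspace (sumset M B) by exact: subspace_sum.
have [|d1 [d2 [r1 r2 <-]]] := IH _ sMB (sumset_subr sM); first exact: sumset_min.
have [BM|nBM] := pselect (B `<=` M).
  have e : sumset M B = M.
    by apply/seteqP; split; [exact: sumset_min|exact: sumset_subl].
  exists d1, d2.+1; split; rewrite ?addnS//; first by rewrite -e.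
  by apply: (@rdimS _ B) hBC => //; rewrite -{1}e.
have CE : M `&` B = C.
  have [] := covers_between sB sC (subspaceI sM sB) hBC.
  - by move=> x Cx; split; [exact: CM|exact: hCB].
  - by move=> x [].
  - by move=> e; case: nBM; rewrite -e => x [].
  - by [].
exists d1.+1, d2; split; last by rewrite addSn.
- apply: (rdimS r1) => //; split; first exact: sumset_subl.
  have /existsNP[v /not_implyP[Bv nMv]] := nBM.
  exists v; split; [exact: sumset_subr|by []|].
  move=> _ [m Mm [b Bb <-]].
  have [|a Ca] := covers_gen sB sC hBC Bv _ Bb; first by move=> /CM.
  by exists a; rewrite -addrA; apply: subspaceD => //; exact: CM.
- rewrite -CE; have {1}-> : M = M `&` sumset M B.
    by apply/seteqP; split=> [x Mx|x []//]; split=> //; exact: sumset_subl.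
  by apply: rdim_cap r2 _ => //; rewrite sumsetC.
Qed.

Lemma rdim_eq0 A B : is_subspace A -> rdim A B 0%N -> A = B.
Proof. by move=> sA; move e: 0%N => d r; case: r e. Qed.

Lemma rdimSn A B d : rdim A B d.+1 -> is_subspace A ->
  exists C, [/\ rdim A C d, is_subspace C, is_subspace B & covers C B].
Proof.
move e: d.+1 => m r; case: r e => // C D k hAC sD CD [->] sA.
by exists C; split=> //; exact: rdim_subspace hAC sA.
Qed.

Lemma covers_neq A B : covers A B -> A <> B.
Proof. by move=> [_ [v [Av nBv _]]] e; apply: nBv; rewrite -e. Qed.

Lemma rdim_refl A d : is_subspace A -> rdim A A d -> d = 0%N.
Proof.
case: d => // d sA /rdimSn-/(_ sA)[C [r sC _ hCA]]; exfalso.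
apply: (covers_neq hCA); apply/seteqP; split; last by case: hCA.
exact: rdim_sub r.
Qed.

Lemma rdim_covers1 A B d : is_subspace A -> covers A B -> rdim A B d -> d = 1%N.
Proof.
move=> sA hAB; case: d => [/(rdim_eq0 sA)/(covers_neq hAB)//|d].
move=> /rdimSn-/(_ sA)[C [r sC sB hCB]]; congr S.
have [e|e] := covers_between sA sB sC hAB (proj1 hCB) (rdim_sub r).
  by move: r; rewrite e; exact: rdim_refl.
by case: (covers_neq hCB).
Qed.

Lemma rdim_uniq A B d d' : is_subspace A -> rdim A B d -> rdim A B d' -> d = d'.
Proof.
move=> sA r; elim: r d' => {B d} [d' /(rdim_refl sA)//|B C d hAB IH sC hBC d' hAC].
have [d1 [d2 [r1 r2 <-]]] := rdim_split sA (rdim_subspace hAB sA) hAC (proj1 hBC) (rdim_sub hAB).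
by rewrite (IH _ r1) (rdim_covers1 (rdim_subspace hAB sA) hBC r2) addn1.
Qed.

Lemma modular A B N : is_subspace B -> A `<=` B ->
  B `&` sumset A N = sumset (B `&` N) A.
Proof.
move=> sB hAB; apply/seteqP; split=> [x [Bx [a Aa [v Nv e]]]|_ [u [Bu Nu] [a Aa <-]]].
  exists v; last by exists a; rewrite // addrC e.
  split=> //; have -> : v = a + v - a by rewrite addrAC subrr add0r.
  by rewrite e; apply: subspaceB => //; exact: hAB.
split; first by apply: subspaceD => //; exact: hAB.
by exists a => //; exists u; rewrite // addrC.
Qed.

(** Through the isomorphism (B + N) / (A + N) = B / (A + (B and N)), the quotient B / A is cut by
A + (B and N) into its parts modulo N and inside N. *)
Lemma rdim_modular A B N d1 d2 :
  is_subspace A -> is_subspace B -> is_subspace N -> A `<=` B ->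
  rdim (sumset B N) (sumset A N) d1 -> rdim (B `&` N) (A `&` N) d2 ->
  rdim B A (d1 + d2)%N.
Proof.
move=> sA sB sN hAB r1 r2; apply: (@rdim_trans _ (sumset (B `&` N) A)).
  rewrite -modular//; have {1}-> : B = B `&` sumset B N.
    by apply/seteqP; split=> [x Bx|x []//]; split=> //; exact: sumset_subl.
  apply: rdim_cap r1 _ => //; first exact: subspace_sum.
  move=> _ [b Bb [v Nv <-]]; exists v; first exact: sumset_subr.
  by exists b; rewrite // addrC.
have {2}-> : A = sumset (A `&` N) A.
  apply/seteqP; split; first by apply: sumset_subr; exact: subspaceI.
  by apply: sumset_min => // x [].
by apply: rdim_add r2 _ => //; [exact: subspaceI|move=> x [[Bx Nx] Ax]].
Qed.

Lemma rdim_modular_inv A B N d :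
  is_subspace A -> is_subspace B -> is_subspace N -> rdim B A d ->
  exists d1 d2, [/\ rdim (sumset B N) (sumset A N) d1,
    rdim (B `&` N) (A `&` N) d2 & (d1 + d2)%N = d].
Proof.
move=> sA sB sN r; have hAB := rdim_sub r.
have sBN := subspaceI sB sN; have sM := subspace_sum sBN sA.
have [||d1 [d2 [r1 r2 <-]]] := rdim_split sB sM r.
- exact: sumset_subr.
- by apply: sumset_min => // x [].
exists d1, d2; split=> //.
- have -> : sumset A N = sumset (sumset (B `&` N) A) N.
    apply/seteqP; split; first by apply: sumsetS => //; exact: sumset_subr.
    have sAN := subspace_sum sA sN.
    apply: sumset_min => //; last exact: sumset_subr.
    apply: sumset_min => //; last exact: sumset_subl.
    by move=> x [_ Nx]; apply: sumset_subr.
  apply: rdim_add r1 _ => //.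
  by move=> x BNx; apply: sumset_subl.
- have := rdim_cap sM sBN r2 (_ : _ `<=` sumset A (B `&` N)).
  rewrite sumsetC => /(_ (@subset_refl _ _)).
  have -> : B `&` N `&` sumset A (B `&` N) = B `&` N.
    by apply/seteqP; split=> [x []//|x BNx]; split=> //; exact: sumset_subr.
  have -> // : B `&` N `&` A = A `&` N.
  by apply/seteqP; split=> [x [[]]//|x [Ax Nx]]; do !split=> //; exact: hAB.
Qed.

(** Adjoin the spanning vectors one at a time; each one adds one dimension or none. *)
Lemma finite_codim_rdim A V : is_subspace A -> is_subspace V -> A `<=` V ->
  finite_codim A V -> exists d, rdim V A d.
Proof.
move=> sA sV AV [m [b [bV bg]]].
elim: m A sA AV b bV bg => [|m IH] A sA AV b bV bg.
  exists 0%N; have -> : A = V; last exact: rdim0.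
  by apply/seteqP; split=> // v /bg[c]; rewrite big_ord0 subr0.
have sA' := subspace_adjoin (b ord0) sA.
have [||v Vv|d r] := IH _ sA' _ (fun i => b (lift ord0 i)).
- exact: adjoin_min.
- by move=> i; exact: bV.
- have [c Ac] := bg v Vv; exists (fun i => c (lift ord0 i)), (c ord0).
  by move: Ac; rewrite big_ord_recl opprD addrCA addrC.
have [Ab|nAb] := pselect (A (b ord0)).
  exists d; suff -> : A = adjoin A (b ord0) by [].
  by apply/seteqP; split; [exact: adjoin_sub|exact: adjoin_min].
by exists d.+1; apply: rdimS r sA (covers_adjoin sA nAb).
Qed.

Lemma rdim_finite_codim A V d : is_subspace V -> rdim V A d -> finite_codim A V.
Proof.
move=> sV; elim=> {A d} [|B A d r [m [b [bV bg]]] sA hBA].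
  exists 0%N, (fun=> 0); split=> [[]//|v Vv].
  by exists (fun=> 0); rewrite big_ord0 subr0.
have BV := rdim_sub r.
have [hAB [w [Bw nAw wg]]] := hBA.
exists m.+1, (fun i => if unlift ord0 i is Some j then b j else w); split.
  by move=> i; case: unliftP => [j|] _; [exact: bV|exact: BV].
move=> v /bg[c /wg[a Aa]].
exists (fun i => if unlift ord0 i is Some j then c j else a).
rewrite big_ord_recl unlift_none opprD addrCA addrC.
by under eq_bigr do rewrite liftK.
Qed.

Lemma finite_dim_rdim V : is_subspace V -> finite_dim V -> exists d, rdim V [set 0] d.
Proof.
move=> sV [m [b bg]]; apply: finite_codim_rdim => //; first exact: subspace0.
  by move=> _ ->; case: sV.
exists m, b; split=> [i|v].
  rewrite bg; exists (fun j => (j == i)%:R); rewrite (bigD1 i)//= eqxx scale1r.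
  by rewrite big1 ?addr0// => j /negPf->; rewrite scale0r.
by rewrite {1}bg => -[c ->]; exists c => /=; rewrite subrr.
Qed.

Lemma rdim_finite_dim V d : is_subspace V -> rdim V [set 0] d -> finite_dim V.
Proof.
move=> sV /(rdim_finite_codim sV)[m [b [bV bg]]]; exists m, b.
apply/seteqP; split=> [v /bg[c /eqP]|_ [c ->]].
  by rewrite subr_eq0 => /eqP ->; exists c.
by elim/big_ind: _ => [|u w|i _]; [case: sV|exact: subspaceD|exact: subspaceZ].
Qed.

Lemma finite_dim_subspace V : finite_dim V -> is_subspace V.
Proof.
move=> [m [b ->]]; split; first by exists (fun=> 0); rewrite big1// => i; rewrite scale0r.
move=> a _ _ [c ->] [c' ->]; exists (fun i => a * c i + c' i).
rewrite scaler_sumr -big_split; apply: eq_bigr => i _ /=.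
by rewrite scalerDl scalerA.
Qed.

Lemma rdim_image (f : E -> E) A B d : (forall a u v, f (a *: u + v) = a *: f u + f v) ->
  injective f -> rdim A B d -> rdim (f @` A) (f @` B) d.
Proof.
move=> fl fi; have f0 : f 0 = 0.
  by have := fl (-1) 0 0; rewrite scaler0 addr0 scaleN1r addNr.
elim=> {B d} [|B C d _ r [C0 sC] [hCB [v [Bv nCv vg]]]]; first exact: rdim0.
apply: rdimS r _ _.
  split=> [|a _ _ [u Cu <-] [w Cw <-]]; first by exists 0.
  by rewrite -fl; exists (a *: u + w) => //; exact: sC.
split; first exact: image_subset.
exists (f v); split; [by exists v|by move=> [u Cu /fi uv]; apply: nCv; rewrite -uv|].
move=> _ [u Bu <-]; have [a Ca] := vg _ Bu; exists a; exists (u - a *: v) => //.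
by rewrite addrC -scaleNr fl scaleNr addrC.
Qed.

Lemma subspace_image (f : E -> E) A : (forall a u v, f (a *: u + v) = a *: f u + f v) ->
  is_subspace A -> is_subspace (f @` A).
Proof.
move=> fl [A0 sA]; have f0 : f 0 = 0.
  by have := fl (-1) 0 0; rewrite scaler0 addr0 scaleN1r addNr.
split; first by exists 0.
move=> a _ _ [u Au <-] [v Av <-]; rewrite -fl; exists (a *: u + v) => //; exact: sA.
Qed.

End Subspaces.

(** * The affine symmetric group *)

Section AffineWeylGroup.
Context (n : nat) (n_ge2 : (2 <= n)%N).
Local Notation I := 'I_n.
Implicit Types (i j : I) (u v w : seq I) (k a b c d q r : int) (p f : int -> int).

(** The transposition of a - 1 and a modulo n. *)
Definition sref (a k : int) : int :=
  if (n %| k - a)%Z then k - 1 else if (n %| k - a + 1)%Z then k + 1 else k.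

Lemma dvd_small (x : int) : - n%:Z < x -> x < n%:Z -> (n %| x)%Z = (x == 0).
Proof.
move=> x1 x2; apply/idP/eqP => [/dvdzP[q e]|->]; last exact: dvdz0.
have [q0|q0|q0] := ltgtP q 0; last by rewrite e q0 mul0r.
  have : q * n%:Z <= -1 * n%:Z by apply: ler_wpM2r => //; lia.
  lia.
have : 1 * n%:Z <= q * n%:Z by apply: ler_wpM2r => //; lia.
lia.
Qed.

(** Residues are counted from a - 1 to a + n - 2, so that a - 1 and a are not separated by the end
of the period. *)
Lemma window (a k : int) : exists q r, [/\ k = a + r + q * n%:Z, -1 <= r & r <= n%:Z - 2].
Proof.
have n0 : n%:Z != 0 by lia.
exists ((k - a + 1) %/ n)%Z, (((k - a + 1) %% n)%Z - 1).
have e := divz_eq (k - a + 1) n%:Z.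
have h0 := modz_ge0 (k - a + 1) n0.
have h1 := ltz_pmod (k - a + 1) (_ : 0 < n%:Z).
split; [lia|lia|]; have := h1 ltac:(lia); lia.
Qed.

Lemma dvdzDM (x q : int) : (n %| x + q * n%:Z)%Z = (n %| x)%Z.
Proof. by rewrite rpredDr// dvdz_mull. Qed.

Lemma sref_window a b q s r d : b = a + d + s * n%:Z ->
  0 <= d -> d <= n%:Z - 2 -> -1 <= r -> r <= n%:Z - 2 ->
  sref b (a + r + q * n%:Z) =
  a + (if r == d then r - 1 else if r == d - 1 then r + 1 else r) + q * n%:Z.
Proof.
move=> -> d0 d1 r0 r1; rewrite /sref.
have -> : a + r + q * n%:Z - (a + d + s * n%:Z) = (r - d) + (q - s) * n%:Z by ring.
have -> : (r - d) + (q - s) * n%:Z + 1 = (r - d + 1) + (q - s) * n%:Z by ring.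
have e1 : (n %| r - d)%Z = (r == d) by rewrite dvd_small; lia.
have e2 : (n %| r - d + 1)%Z = (r == d - 1) by rewrite dvd_small; lia.
rewrite (dvdzDM (r - d) (q - s)) (dvdzDM (r - d + 1) (q - s)) e1 e2.
by case: (r == d); [lia|case: (r == d - 1); lia].
Qed.

Lemma sref0 a : sref a a = a - 1.
Proof. by rewrite /sref subrr dvdz0. Qed.

Lemma srefB1 a : sref a (a - 1) = a.
Proof.
have -> : a - 1 = a + -1 + 0 * n%:Z by ring.
by rewrite (@sref_window a a 0 0 (-1) 0)//=; lia.
Qed.

Lemma srefK a : involutive (sref a).
Proof.
move=> k; have [q [r [-> r0 r1]]] := window a k.
have w x : -1 <= x -> x <= n%:Z - 2 -> sref a (a + x + q * n%:Z) =
    a + (if x == 0 then x - 1 else if x == 0 - 1 then x + 1 else x) + q * n%:Z.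
  by move=> x0 x1; rewrite (@sref_window a a q 0 x 0)//; lia.
rewrite w//; have [->|r1'] := eqVneq r 0; first by rewrite w//; lia.
have [->|r2'] := eqVneq r (0 - 1); first by rewrite w//; lia.
by rewrite w// (negPf r1') (negPf r2').
Qed.

Lemma srefDn a k q : sref a (k + q * n%:Z) = sref a k + q * n%:Z.
Proof.
rewrite /sref.
have -> : k + q * n%:Z - a = k - a + q * n%:Z by ring.
have -> : k - a + q * n%:Z + 1 = k - a + 1 + q * n%:Z by ring.
by rewrite (dvdzDM (k - a) q) (dvdzDM (k - a + 1) q); do 2 (case: ifP => _; first by ring); ring.
Qed.

Lemma sref_eqmod a b k : (n %| b - a)%Z -> sref b k = sref a k.
Proof.
move=> /dvdzP[q e]; rewrite /sref.
have -> : k - b = k - a + (- q) * n%:Z by rewrite mulNr -e; ring.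
have -> : k - a + - q * n%:Z + 1 = k - a + 1 + (- q) * n%:Z by ring.
by rewrite (dvdzDM (k - a) (- q)) (dvdzDM (k - a + 1) (- q)).
Qed.

Lemma sref_shift a k c : sref (a + c) (k + c) = sref a k + c.
Proof.
rewrite /sref; have -> : k + c - (a + c) = k - a by ring.
by do 2 (case: ifP => _; first by ring); ring.
Qed.

(** Such a map is onto, as it permutes the residues modulo n. *)
Definition affine_perm p : Prop := (forall k, p (k + n%:Z) = p k + n%:Z) /\ injective p.

Lemma affine_permDn p k q : affine_perm p -> p (k + q * n%:Z) = p k + q * n%:Z.
Proof.
move=> [pn _]; have nat (m : nat) k' : p (k' + m%:Z * n%:Z) = p k' + m%:Z * n%:Z.
  elim: m => [|m IH]; first by rewrite mul0r !addr0.
  have e : m.+1%:Z * n%:Z = m%:Z * n%:Z + n%:Z by rewrite intS; ring.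
  by rewrite e !addrA pn IH.
case: q => m; first exact: nat.
rewrite NegzE mulNr; apply/eqP; rewrite eq_sym subr_eq; apply/eqP.
by rewrite -nat subrK.
Qed.

Lemma affine_perm_sref p a : affine_perm p -> affine_perm (p \o sref a).
Proof.
move=> ap; split=> [k|]; last by apply: inj_comp; [case: ap|exact: (can_inj (srefK a))].
by rewrite /= -[n%:Z]mul1r srefDn affine_permDn.
Qed.

Definition act w : int -> int := foldr (fun i g => sref i%:Z \o g) id w.

Lemma act_cat u v k : act (u ++ v) k = act u (act v k).
Proof. by elim: u => //= i u IH; rewrite IH. Qed.

Lemma act_rcons w i k : act (rcons w i) k = act w (sref i%:Z k).
Proof. by rewrite -cats1 act_cat. Qed.

Lemma act_affine w : affine_perm (act w).
Proof.
elim/last_ind: w => [|w i IH]; first by split.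
have [h1 h2] := affine_perm_sref i%:Z IH.
split=> [k|k l]; rewrite !act_rcons; first exact: h1.
exact: h2.
Qed.

Lemma act_rev w k : act (rev w) (act w k) = k.
Proof.
elim: w k => // i w IH k.
by rewrite rev_cons act_rcons /= srefK IH.
Qed.

Lemma act_revK w k : act w (act (rev w) k) = k.
Proof. by rewrite -{1}(revK w) act_rev. Qed.

Lemma ord_dvd i j : (n %| i%:Z - j%:Z)%Z -> i = j.
Proof.
have := ltn_ord i; have := ltn_ord j => lj li.
by rewrite dvd_small; [move=> /eqP e; apply: val_inj => /=; lia|lia|lia].
Qed.

Lemma ord_of_int (k : int) : exists (i : I) q, k = i%:Z + q * n%:Z.
Proof.
have n0 : n%:Z != 0 by lia.
have h0 := modz_ge0 k n0; have := ltz_pmod k (_ : 0 < n%:Z) => /(_ ltac:(lia)) h1.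
have lt : (`|(k %% n)%Z| < n)%N by lia.
exists (Ordinal lt), (k %/ n)%Z => /=; rewrite {1}(divz_eq k n) addrC gez0_abs//.
Qed.

Lemma sref_fix a k : ~~ (n %| k - a)%Z -> ~~ (n %| k - (a - 1))%Z -> sref a k = k.
Proof.
move=> /negPf h1 /negPf h2; rewrite /sref h1.
have -> : k - a + 1 = k - (a - 1) by ring.
by rewrite h2.
Qed.

(** The two displaced terms are singled out, for the total displacement and for the spread below. *)
Lemma sum_sref (F : int -> int) p i : affine_perm p -> exists rest,
  \sum_(k < n) F (p k%:Z - k%:Z) =
    F (p i%:Z - i%:Z) + F (p (i%:Z - 1) - (i%:Z - 1)) + rest /\
  \sum_(k < n) F (p (sref i%:Z k%:Z) - k%:Z) =
    F (p (i%:Z - 1) - i%:Z) + F (p i%:Z - (i%:Z - 1)) + rest.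
Proof.
move=> ap; have [i' [q e]] := ord_of_int (i%:Z - 1).
have ii' : i' != i.
  apply/eqP => ii'; have : (n %| 1)%Z.
    apply/dvdzP; exists (- q); move: e; rewrite ii' => e; rewrite mulNr; lia.
  by rewrite dvd_small; lia.
have pe : p (i%:Z - 1) - (i%:Z - 1) = p i'%:Z - i'%:Z.
  by rewrite e affine_permDn//; ring.
exists (\sum_(k < n | (k != i) && (k != i')) F (p k%:Z - k%:Z)); split.
  by rewrite (bigD1 i)//= (bigD1 i')//= pe addrA.
rewrite (bigD1 i)//= (bigD1 i')//= addrA; congr (_ + _ + _).
- by rewrite sref0.
- have -> : i'%:Z = i%:Z - 1 + (- q) * n%:Z by rewrite e; ring.
  by rewrite srefDn srefB1 affine_permDn//; congr F; ring.
- apply: eq_bigr => k /andP[ki ki']; rewrite sref_fix//.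
    by apply: contra ki => /ord_dvd ->.
  apply: contra ki' => d; apply/eqP; apply: ord_dvd.
  have -> : k%:Z - i'%:Z = k%:Z - (i%:Z - 1) + q * n%:Z by rewrite e; ring.
  by rewrite dvdzDM.
Qed.

Lemma sum_act w : \sum_(k < n) (act w k%:Z - k%:Z) = 0.
Proof.
elim/last_ind: w => [|w i IH]; first by rewrite big1// => k _; rewrite subrr.
have [rest [e1 e2]] := sum_sref id i (act_affine w).
under eq_bigr do rewrite act_rcons.
by rewrite e2 -IH e1; ring.
Qed.

(** A measure for sorting that, unlike the number of inversions, is a sum over one period. *)
Definition spread p : nat := absz (\sum_(k < n) (p k%:Z - k%:Z) ^+ 2).

(** The spread drops by 2 (p (i - 1) - p i). *)
Lemma spread_descent p i : affine_perm p -> p i%:Z < p (i%:Z - 1) ->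
  (spread (p \o sref i%:Z) < spread p)%N.
Proof.
move=> ap lt; have [rest [e1 e2]] := sum_sref (fun x => x ^+ 2) i ap.
have pos (g : int -> int) : 0 <= \sum_(k < n) (g k%:Z - k%:Z) ^+ 2.
  by apply: sumr_ge0 => k _; exact: sqr_ge0.
rewrite -ltz_nat /spread (gez0_abs (pos p)) (gez0_abs (pos (p \o sref i%:Z))).
rewrite /= e1 e2 ltrD2r -subr_gt0.
have -> (x y : int) : (x - i%:Z) ^+ 2 + (y - (i%:Z - 1)) ^+ 2 -
    ((y - i%:Z) ^+ 2 + (x - (i%:Z - 1)) ^+ 2) = 2 * (y - x) by ring.
by rewrite mulr_gt0// subr_gt0.
Qed.

(** Each letter creates a descent, so these are the reduced words. *)
Inductive ascending : seq I -> Prop :=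
| ascending_nil : ascending [::]
| ascending_rcons w i : ascending w -> act w (i%:Z - 1) < act w i%:Z ->
    ascending (rcons w i).

(** Without descents p increases by at least 1 at each step and by n over n steps. *)
Lemma affine_descent p : affine_perm p ->
  (exists i, p i%:Z < p (i%:Z - 1)) \/ (exists c, forall k, p k = k + c).
Proof.
move=> ap; have [|nd] := pselect (exists i, p i%:Z < p (i%:Z - 1)); first by left.
right; exists (p 0).
have asc k : p (k - 1) + 1 <= p k.
  have [i [q ->]] := ord_of_int k.
  have -> : i%:Z + q * n%:Z - 1 = i%:Z - 1 + q * n%:Z by ring.
  rewrite !affine_permDn// addrAC lerD2r; have [//|le] := ltP (p (i%:Z - 1)) (p i%:Z).
    by lia.
  case: (ltgtP (p i%:Z) (p (i%:Z - 1))) le => // [h|h] _.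
    by case: nd; exists i.
  by have := proj2 ap _ _ h; lia.
have up (m : nat) k : p k + m%:Z <= p (k + m%:Z).
  elim: m => [|m IH]; first by rewrite !addr0.
  have := asc (k + m.+1%:Z); have -> : k + m.+1%:Z - 1 = k + m%:Z by rewrite intS; ring.
  by rewrite intS; lia.
have key (m : nat) : p m%:Z = m%:Z + p 0.
  have h1 := up m 0; have h2 := up (m * n - m)%N m%:Z.
  have e : m%:Z + (m * n - m)%N%:Z = 0 + m%:Z * n%:Z.
    by rewrite add0r -PoszM -PoszD subnKC// leq_pmulr//; lia.
  rewrite e affine_permDn// in h2; rewrite add0r in h1.
  have arith (x y z t : int) : m%:Z + x = 0 + y -> t + m%:Z <= z -> z + x <= t + y ->
      z = m%:Z + t by lia.
  exact: arith e h1 h2.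
by move=> k; have [i [q ->]] := ord_of_int k; rewrite affine_permDn// key; ring.
Qed.

(** Remove descents until only a translation is left. If p carries the ray from i onto a ray then i
is not a descent, and it remains none while other letters are sorted; the predicate P records
such letters. *)
Lemma sort_affine (P : pred I) p : affine_perm p ->
  (forall i, P i -> exists c, forall k, (i%:Z <= k) = (c <= p k)) ->
  exists w c, [/\ ascending w, forall k, p k = act w k + c & forall i, i \in w -> ~~ P i].
Proof.
have [m] := ubnP (spread p); elim: m p => // m IH p lem ap Pp.
have [[i di]|[c pc]] := affine_descent ap; last first.
  by exists [::], c; split=> //; exact: ascending_nil.
have nPi : ~~ P i.
  apply/negP => /Pp[c h]; have := h i%:Z; have := h (i%:Z - 1).
  by rewrite lexx; case: leP; case: leP => //; lia.
have ltm := leq_trans (spread_descent ap di) lem.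
have [|w [c [asc wc wP]]] := IH _ ltm (affine_perm_sref i%:Z ap).
  move=> j Pj; have [c h] := Pp j Pj; exists c => k; rewrite /= -h.
  have nij : ~~ (n %| j%:Z - i%:Z)%Z by apply: contra nPi => /ord_dvd <-.
  rewrite /sref; case: ifP => [d|_].
    have : k != j%:Z by apply: contra nij => /eqP <-.
    by lia.
  case: ifP => // d; have : k + 1 != j%:Z.
    by apply: contra nij => /eqP <-; rewrite addrAC.
  lia.
exists (rcons w i), c; split.
- apply: ascending_rcons => //.
  have h1 := wc (i%:Z - 1); have h2 := wc i%:Z.
  by rewrite /= srefB1 in h1; rewrite /= sref0 in h2; lia.
- by move=> k; rewrite act_rcons -wc /= srefK.
- by move=> j; rewrite mem_rcons inE => /predU1P[->//|/wP].
Qed.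

Lemma translation_act w w' c : (forall k, act w k = act w' k + c) -> c = 0.
Proof.
move=> e; have := sum_act w; under eq_bigr do rewrite e addrAC.
rewrite big_split /= sum_act add0r sumr_const card_ord => /eqP.
by rewrite mulrn_eq0; case/orP => /eqP //; lia.
Qed.

(** The action of a transposition on the residues counted as in the window lemma. *)
Definition swap (d r : int) : int := if r == d then r - 1 else if r == d - 1 then r + 1 else r.

Lemma swap_out d r : r != d -> r != d - 1 -> swap d r = r.
Proof. by rewrite /swap => /negPf -> /negPf ->. Qed.

Lemma swap_l d : swap d d = d - 1. Proof. by rewrite /swap eqxx. Qed.

Lemma swap_r d : swap d (d - 1) = d.
Proof. by rewrite /swap eqxx subrK; case: eqP => [e|//]; exfalso; lia. Qed.

Lemma swap_bound d r : 0 <= d <= n%:Z - 2 -> -1 <= r <= n%:Z - 2 ->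
  -1 <= swap d r <= n%:Z - 2.
Proof.
move=> /andP[d0 d1] /andP[r0 r1]; rewrite /swap.
have [->|_] := eqVneq r d; first by apply/andP; split; lia.
have [->|_] := eqVneq r (d - 1); first by apply/andP; split; lia.
by rewrite r0.
Qed.

Lemma sref_swap a b q s r d : b = a + d + s * n%:Z -> 0 <= d <= n%:Z - 2 ->
  -1 <= r <= n%:Z - 2 -> sref b (a + r + q * n%:Z) = a + swap d r + q * n%:Z.
Proof. by move=> be /andP[d0 d1] /andP[r0 r1]; exact: sref_window be d0 d1 r0 r1. Qed.

Lemma sref_braid a b s k : (3 <= n)%N -> b = a + 1 + s * n%:Z ->
  sref a (sref b (sref a k)) = sref b (sref a (sref b k)).
Proof.
move=> n3 be; have [q [r [-> r0 r1]]] := window a k.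
have A x : -1 <= x <= n%:Z - 2 -> sref a (a + x + q * n%:Z) = a + swap 0 x + q * n%:Z.
  by apply: (@sref_swap _ _ _ 0); [ring|lia].
have B x : -1 <= x <= n%:Z - 2 -> sref b (a + x + q * n%:Z) = a + swap 1 x + q * n%:Z.
  by apply: sref_swap be _; lia.
have r01 : -1 <= r <= n%:Z - 2 by rewrite r0.
rewrite !(A, B) ?swap_bound//; try lia.
congr (_ + _ + _); have [->//|h0] := eqVneq r 0.
have [->//|h1] := eqVneq r 1; have [->//|h2] := eqVneq r (-1).
by rewrite !(@swap_out _ r); lia.
Qed.

Lemma sref_commute a b s d k : b = a + d + s * n%:Z -> 2 <= d -> d <= n%:Z - 2 ->
  sref a (sref b k) = sref b (sref a k).
Proof.
move=> be d0 d1; have [q [r [-> r0 r1]]] := window a k.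
have A x : -1 <= x <= n%:Z - 2 -> sref a (a + x + q * n%:Z) = a + swap 0 x + q * n%:Z.
  by apply: (@sref_swap _ _ _ 0); [ring|lia].
have B x : -1 <= x <= n%:Z - 2 -> sref b (a + x + q * n%:Z) = a + swap d x + q * n%:Z.
  by apply: sref_swap be _; lia.
have r01 : -1 <= r <= n%:Z - 2 by rewrite r0.
rewrite !(A, B) ?swap_bound//; try lia.
congr (_ + _ + _).
have [->|h0] := eqVneq r 0; first by rewrite (@swap_out d 0) ?swap_l ?(@swap_out d (0 - 1)); lia.
have [->|h1] := eqVneq r (0 - 1); first by rewrite (@swap_out d (0 - 1)) ?swap_r ?(@swap_out d 0); lia.
have [->|h2] := eqVneq r d; first by rewrite (@swap_out 0 d) ?swap_l ?(@swap_out 0 (d - 1)); lia.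
have [->|h3] := eqVneq r (d - 1); first by rewrite (@swap_out 0 (d - 1)) ?swap_r ?(@swap_out 0 d); lia.
by rewrite !(@swap_out _ r); lia.
Qed.

(** The diagram is the cycle with n vertices; for n = 2 its edge carries infinity. *)
Definition affine_matrix i j : nat :=
  if i == j then 1%N else if n == 2%N then 0%N
  else if (n %| j%:Z - i%:Z - 1)%Z || (n %| i%:Z - j%:Z - 1)%Z then 3%N else 2%N.

Local Notation m := affine_matrix.

(** A view for the entries of the matrix, with the relative position of j after i. *)
Variant affine_matrix_spec i j : nat -> Prop :=
| MatrixDiag of i = j : affine_matrix_spec i j 1%N
| MatrixInf of n = 2%N & i != j : affine_matrix_spec i j 0%N
| MatrixNext s of (3 <= n)%N & i != j & j%:Z = i%:Z + 1 + s * n%:Z : affine_matrix_spec i j 3%N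
| MatrixPrev s of (3 <= n)%N & i != j & i%:Z = j%:Z + 1 + s * n%:Z : affine_matrix_spec i j 3%N
| MatrixFar s d of (3 <= n)%N & i != j & j%:Z = i%:Z + d + s * n%:Z & 2 <= d & d <= n%:Z - 2 :
    affine_matrix_spec i j 2%N.

Lemma affine_matrixP i j : affine_matrix_spec i j (m i j).
Proof.
rewrite /m; case: eqVneq => [|ij]; first exact: MatrixDiag.
case: (eqVneq n 2%N) => [e|n2]; first exact: MatrixInf e ij.
have n3 : (3 <= n)%N by lia.
case: (boolP (n %| j%:Z - i%:Z - 1)%Z) => [/dvdzP[s e]|nd1] /=.
  by apply: (@MatrixNext _ _ s) => //; rewrite -e; ring.
case: (boolP (n %| i%:Z - j%:Z - 1)%Z) => [/dvdzP[s e]|nd2] /=.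
  by apply: (@MatrixPrev _ _ s) => //; rewrite -e; ring.
have [q [r [e r0 r1]]] := window i%:Z j%:Z.
apply: (@MatrixFar _ _ q r) => //.
have rn0 : r != 0.
  apply: contra ij => /eqP r_0; rewrite eq_sym; apply/eqP/ord_dvd/dvdzP; exists q.
  by rewrite e r_0; ring.
have rn1 : r != 1.
  apply: contra nd1 => /eqP r_1; apply/dvdzP; exists q.
  by rewrite e r_1; ring.
have rn2 : r != -1.
  apply: contra nd2 => /eqP r_2; apply/dvdzP; exists (- q).
  by rewrite e r_2; ring.
lia.
Qed.

Local Notation "u ~ v" := (coxeter_eq m u v) (at level 70).

Lemma coxeter_eq_cat x y u v : u ~ v -> x ++ u ++ y ~ x ++ v ++ y.
Proof.
elim=> {u v} [w|w w' _|w w' w'' _ h1 _ h2|u v i j].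
- exact: coxeter_refl.
- exact: coxeter_sym.
- exact: coxeter_trans h1 h2.
- have := coxeter_rel m (x ++ u) (v ++ y) i j.
  by rewrite -!catA.
Qed.

Lemma coxeter_eq_catl x u v : u ~ v -> x ++ u ~ x ++ v.
Proof. by move=> /(coxeter_eq_cat x [::]); rewrite !cats0. Qed.

Lemma coxeter_eq_catr y u v : u ~ v -> u ++ y ~ v ++ y.
Proof. exact: (@coxeter_eq_cat [::]). Qed.

Lemma coxeter_eq_rcons i u v : u ~ v -> rcons u i ~ rcons v i.
Proof. by rewrite -!cats1; exact: coxeter_eq_catr. Qed.

Lemma coxeter_eq_act u v : u ~ v -> forall k, act u k = act v k.
Proof.
elim=> {u v} [w|w w' _ IH|w w' w'' _ h1 _ h2|u v i j] k //.
  by rewrite h1 h2.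
rewrite !act_cat; congr act; move: (act v k) => {k u v} k.
case: affine_matrixP => //= [->|s n3 _ e|s n3 _ e|s d n3 _ e d2 d3].
- exact: srefK.
- by rewrite (sref_braid _ n3 e) !srefK.
- by rewrite -(sref_braid _ n3 e) !srefK.
- by rewrite (sref_commute _ e d2 d3) !srefK.
Qed.

Lemma coxeter_eq_sqr u i : rcons (rcons u i) i ~ u.
Proof.
have := coxeter_rel m u [::] i i.
by rewrite /affine_matrix eqxx /= cats0 -!cats1 -catA.
Qed.

Lemma coxeter_eq_rev v : v ++ rev v ~ [::].
Proof.
elim: v => [|i v IH]; first exact: coxeter_refl.
have -> : (i :: v) ++ rev (i :: v) = [:: i] ++ (v ++ rev v) ++ [:: i].
  by rewrite rev_cons -cats1 /= catA.
apply: coxeter_trans (coxeter_eq_cat [:: i] [:: i] IH) _.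
exact: (coxeter_eq_sqr [::] i).
Qed.

Lemma coxeter_eq_of_rel u v : u ++ v ~ [::] -> u ~ rev v.
Proof.
move=> h; apply: coxeter_trans (_ : u ++ v ++ rev v ~ _).
  by apply: coxeter_sym; rewrite -[X in _ ~ X]cats0; apply: coxeter_eq_catl (coxeter_eq_rev v).
by rewrite catA; exact: (coxeter_eq_catr (rev v) h).
Qed.

Lemma ascending_inv w : ascending w -> forall u i, w = rcons u i ->
  ascending u /\ act u (i%:Z - 1) < act u i%:Z.
Proof. by case=> [[]//|u i asc lt v j /rcons_inj[<- <-]]. Qed.

Lemma rcons_descent u i : act u (i%:Z - 1) < act u i%:Z ->
  act (rcons u i) i%:Z < act (rcons u i) (i%:Z - 1).
Proof. by rewrite !act_rcons sref0 srefB1. Qed.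

Lemma ascending_word w : exists u, ascending u /\ forall k, act u k = act w k.
Proof.
have [//|u [c [asc h _]]] := @sort_affine pred0 _ (act_affine w).
by exists u; split=> // k; rewrite h (translation_act h) addr0.
Qed.

Lemma ascent_shift p a b s : affine_perm p -> b = a + s * n%:Z ->
  (p (b - 1) < p b) = (p (a - 1) < p a).
Proof. by move=> ap ->; rewrite addrAC !affine_permDn// ltrD2r. Qed.

Lemma descent_shift p a b s : affine_perm p -> b = a + s * n%:Z ->
  (p b < p (b - 1)) = (p a < p (a - 1)).
Proof. by move=> ap ->; rewrite addrAC !affine_permDn// ltrD2r. Qed.

(** The permutation carries i - 1, i, i + 1 to a decreasing triple. Sorting the triple leaves w, and
the two ways of unsorting it are the two sides of the braid relation. *)
Lemma braid_step u i j s : (3 <= n)%N -> j%:Z = i%:Z + 1 + s * n%:Z -> m i j = 3%N ->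
  act u i%:Z < act u (i%:Z - 1) -> act u j%:Z < act u (j%:Z - 1) ->
  exists w, [/\ ascending (w ++ [:: i; j; i]), ascending (w ++ [:: j; i; j]),
    forall k, act (w ++ [:: i; j; i]) k = act u k,
    forall k, act (w ++ [:: j; i; j]) k = act u k &
    w ++ [:: i; j; i] ~ w ++ [:: j; i; j]].
Proof.
move=> n3 e mij di dj.
have [w [asc aw]] := ascending_word (u ++ [:: i; j; i]).
have br := sref_braid _ n3 e.
pose vals v a b c := [/\ act v (i%:Z - 1) = a, act v i%:Z = b & act v (i%:Z + 1) = c].
have sj k : sref j%:Z k = sref (i%:Z + 1) k.
  by apply: sref_eqmod; rewrite e addrAC subrr add0r dvdz_mull.
have vi v a b c : vals v a b c -> vals (rcons v i) b a c.
  move=> [<- <- <-]; split; rewrite act_rcons ?srefB1 ?sref0// sref_fix//.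
    by rewrite (_ : i%:Z + 1 - i%:Z = 1); [rewrite dvd_small; lia|ring].
  by rewrite (_ : i%:Z + 1 - (i%:Z - 1) = 2); [rewrite dvd_small; lia|ring].
have vj v a b c : vals v a b c -> vals (rcons v j) a c b.
  move=> [<- <- <-]; split; rewrite act_rcons sj ?sref0 ?addrK//.
    rewrite sref_fix//.
      by rewrite (_ : i%:Z - 1 - (i%:Z + 1) = - 2); [rewrite dvd_small; lia|ring].
    by rewrite (_ : i%:Z - 1 - (i%:Z + 1 - 1) = - 1); [rewrite dvd_small; lia|ring].
  by have := srefB1 (i%:Z + 1); rewrite addrK => ->.
have ai v a b c : ascending v -> vals v a b c -> a < b -> ascending (rcons v i).
  by move=> av [va vb vc] ab; apply: ascending_rcons; rewrite ?va ?vb.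
have aj v a b c : ascending v -> vals v a b c -> b < c -> ascending (rcons v j).
  move=> av [va vb vc] bc; apply: ascending_rcons => //.
  by rewrite (ascent_shift (act_affine v) e) addrK vb vc.
have vu : vals u (act u (i%:Z - 1)) (act u i%:Z) (act u (i%:Z + 1)) by split.
have vw : vals w (act u (i%:Z + 1)) (act u i%:Z) (act u (i%:Z - 1)).
  have := vi _ _ _ _ (vj _ _ _ _ (vi _ _ _ _ vu)).
  by move=> [h1 h2 h3]; split; rewrite aw -?h1 -?h2 -?h3 -!cats1 -!catA.
have lt1 := di; have lt2 := dj; rewrite (descent_shift (act_affine u) e) addrK in lt2.
have cr x y z v : rcons (rcons (rcons v x) y) z = v ++ [:: x; y; z].
  by rewrite -!cats1 -!catA.
have sq v k : act (u ++ [:: i; j; i]) (act v k) = act u (act (i :: j :: i :: v) k).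
  by rewrite act_cat.
have wi k : act (w ++ [:: i; j; i]) k = act u k.
  by rewrite act_cat aw sq /= !srefK.
exists w; split=> //.
- by rewrite -cr; apply: (ai _ _ _ _ _ (vj _ _ _ _ (vi _ _ _ _ vw))) => //;
    apply: (aj _ _ _ _ _ (vi _ _ _ _ vw)); [exact: ai vw lt2|exact: lt_trans lt1].
- by rewrite -cr; apply: (aj _ _ _ _ _ (vi _ _ _ _ (vj _ _ _ _ vw))) => //;
    apply: (ai _ _ _ _ _ (vj _ _ _ _ vw)); [exact: aj vw lt1|exact: lt_trans lt1].
- by move=> k; rewrite -wi !act_cat /= br.
apply: coxeter_eq_catl; apply: (@coxeter_eq_of_rel _ [:: j; i; j]).
by have := coxeter_rel m [::] [::] i j; rewrite mij.
Qed.

Lemma ascending_rcons_inv w i : ascending (rcons w i) ->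
  ascending w /\ act w (i%:Z - 1) < act w i%:Z.
Proof. by move=> h; exact: ascending_inv h _ _ erefl. Qed.

(** For n = 2 the generators 0 and 1 satisfy no braid relation; accordingly they are never both
descents, as p 0 < p (-1) and p 1 < p 0 would contradict p 1 = p (-1) + 2. *)
Lemma dihedral_step u i j : i != j ->
  act u i%:Z < act u (i%:Z - 1) -> act u j%:Z < act u (j%:Z - 1) ->
  exists ui uj, [/\ ascending (rcons ui i), ascending (rcons uj j),
    forall k, act (rcons ui i) k = act u k, forall k, act (rcons uj j) k = act u k &
    rcons ui i ~ rcons uj j].
Proof.
move=> ij di dj; move: (erefl (m i j)).
case: {1}(m i j) / affine_matrixP => [e|n2 _|s n3 _ e|s n3 _ e|s d n3 _ e d2 d3] mij.
- by rewrite e eqxx in ij.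
- have [s e] : exists s, j%:Z = i%:Z + 1 + s * n%:Z.
    have := ltn_ord i; have := ltn_ord j; move: ij; rewrite -val_eqE /= => ij lj li.
    by have [i0|i0] := posnP i; [exists 0|exists (-1)]; lia.
  rewrite (descent_shift (act_affine u) e) addrK in dj.
  have := affine_permDn (i%:Z - 1) 1 (act_affine u).
  have -> : i%:Z - 1 + 1 * n%:Z = i%:Z + 1 by lia.
  by move=> eq; rewrite eq in dj; have := lt_trans dj di; lia.
- have [w [h1 h2 h3 h4 h5]] := braid_step n3 e (esym mij) di dj.
  by exists (w ++ [:: i; j]), (w ++ [:: j; i]); rewrite !rcons_cat.
- have mji : m j i = 3%N by rewrite mij /m eq_sym orbC.
  have [w [h1 h2 h3 h4 h5]] := braid_step n3 e mji dj di.
  exists (w ++ [:: i; j]), (w ++ [:: j; i]); rewrite !rcons_cat; split=> //.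
  exact: coxeter_sym.
have [w [asc aw]] := ascending_word (u ++ [:: i; j]).
have {}aw k : act w k = act u (sref i%:Z (sref j%:Z k)) by rewrite aw act_cat.
have nd (x q : int) : - n%:Z < x -> x < n%:Z -> x != 0 -> ~~ (n %| x + q * n%:Z)%Z.
  by move=> x0 x1 nx; rewrite dvdzDM dvd_small.
have fij : sref i%:Z j%:Z = j%:Z.
  apply: sref_fix.
    by rewrite (_ : _ - _ = d + s * n%:Z); [apply: nd; lia|rewrite e; ring].
  by rewrite (_ : _ - _ = d + 1 + s * n%:Z); [apply: nd; lia|rewrite e; ring].
have fij1 : sref i%:Z (j%:Z - 1) = j%:Z - 1.
  apply: sref_fix.
    by rewrite (_ : _ - _ = d - 1 + s * n%:Z); [apply: nd; lia|rewrite e; ring].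
  by rewrite (_ : _ - _ = d + s * n%:Z); [apply: nd; lia|rewrite e; ring].
have fji : sref j%:Z i%:Z = i%:Z.
  apply: sref_fix.
    by rewrite (_ : _ - _ = - d + (- s) * n%:Z); [apply: nd; lia|rewrite e; ring].
  by rewrite (_ : _ - _ = 1 - d + (- s) * n%:Z); [apply: nd; lia|rewrite e; ring].
have fji1 : sref j%:Z (i%:Z - 1) = i%:Z - 1.
  apply: sref_fix.
    by rewrite (_ : _ - _ = - d - 1 + (- s) * n%:Z); [apply: nd; lia|rewrite e; ring].
  by rewrite (_ : _ - _ = - d + (- s) * n%:Z); [apply: nd; lia|rewrite e; ring].
have com := sref_commute _ e d2 d3.
exists (rcons w j), (rcons w i); split.
- apply: ascending_rcons; first apply: ascending_rcons => //.
    by rewrite !aw srefB1 sref0 fij fij1.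
  by rewrite !act_rcons !aw !srefK srefB1 sref0.
- apply: ascending_rcons; first apply: ascending_rcons => //.
    by rewrite !aw fji fji1 srefB1 sref0.
  by rewrite !act_rcons !aw -!com !srefK srefB1 sref0.
- by move=> k; rewrite !act_rcons aw !srefK.
- by move=> k; rewrite !act_rcons aw -com !srefK.
rewrite -!cats1 -!catA; apply: coxeter_eq_catl; apply: coxeter_sym.
apply: (@coxeter_eq_of_rel _ [:: i; j]).
by have := coxeter_rel m [::] [::] i j; rewrite -mij.
Qed.

(** Matsumoto's theorem. If the words end with different letters i and j, both are descents, and
both words are compared by induction with the words ending in i and j of the dihedral step. *)
Lemma ascending_coxeter_eq u v : ascending u -> ascending v ->
  (forall k, act u k = act v k) -> u ~ v.
Proof.
have [b] := ubnP (spread (act u)); elim: b u v => // b IH u v.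
have nonil w i : ascending (rcons w i) -> (forall k, act (rcons w i) k = k) -> False.
  by move=> /ascending_rcons_inv[aw /rcons_descent]; move=> + h; rewrite !h; lia.
case/lastP: u => [|u i]; case/lastP: v => [|v j] lt asc1 asc2 e.
- exact: coxeter_refl.
- by exfalso; apply: nonil asc2 _ => k; rewrite -e.
- by exfalso; apply: nonil asc1 e.
have [[au iu] [av jv]] := (ascending_rcons_inv asc1, ascending_rcons_inv asc2).
have IHi w x y : spread (act (rcons w x)) = spread (act (rcons u i)) ->
    ascending (rcons w x) -> ascending (rcons y x) ->
    (forall k, act (rcons w x) k = act (rcons y x) k) -> rcons w x ~ rcons y x.
  move=> es /ascending_rcons_inv[aw ltw] /ascending_rcons_inv[ay _] ewy.
  apply/coxeter_eq_rcons/IH => // [|k]; last first.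
    by have := ewy (sref x%:Z k); rewrite !act_rcons srefK.
  have := spread_descent (act_affine (rcons w x)) (rcons_descent ltw).
  have -> : act (rcons w x) \o sref x%:Z = act w.
    by apply/funext => k /=; rewrite act_rcons srefK.
  by rewrite es => h; apply: leq_trans h _.
have [ij|ij] := eqVneq i j.
  by move: asc2 e; rewrite -ij => asc2 e; exact: IHi.
have di := rcons_descent iu; have dj := rcons_descent jv.
rewrite -!e in dj.
have [ui [uj [h1 h2 h3 h4 h5]]] := dihedral_step ij di dj.
apply: coxeter_trans (coxeter_trans h5 _); first by apply: IHi => // k; rewrite h3.
by apply: IHi => // [|k]; rewrite ?h4 ?e//; congr spread; apply/funext.
Qed.

Lemma coxeter_ascending w : exists u, ascending u /\ w ~ u.
Proof.
elim/last_ind: w => [|w i [u [asc wu]]].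
  by exists [::]; split; [exact: ascending_nil|exact: coxeter_refl].
have [lt|] := ltP (act u (i%:Z - 1)) (act u i%:Z).
  by exists (rcons u i); split; [exact: ascending_rcons|exact: coxeter_eq_rcons].
rewrite le_eqVlt => /predU1P[/(proj2 (act_affine u))|lt]; first lia.
have [v [av ev]] := ascending_word (rcons u i).
exists v; split=> //.
apply: coxeter_trans (coxeter_eq_rcons i wu) _.
apply: coxeter_trans (coxeter_eq_sqr v i); apply: coxeter_eq_rcons.
apply: ascending_coxeter_eq => // [|k]; last by rewrite act_rcons ev act_rcons srefK.
by apply: ascending_rcons; rewrite // !ev !act_rcons srefB1 sref0.
Qed.

(** Ascending words represent all classes, and are determined by their action: the presentation has
no further elements than the affine permutations. *)
Theorem coxeter_eq_actP u v : u ~ v <-> (forall k, act u k = act v k).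
Proof.
split; [exact: coxeter_eq_act|move=> e].
have [u' [au uu]] := coxeter_ascending u; have [v' [av vv]] := coxeter_ascending v.
apply: (coxeter_trans uu); apply: (coxeter_trans _ (coxeter_sym vv)).
apply: ascending_coxeter_eq => // k.
by rewrite -(coxeter_eq_act uu) -(coxeter_eq_act vv).
Qed.

(** Only the letter i exchanges the two sides of the ray from i. *)
Lemma ray_fixed i v k : i \notin v -> (i%:Z <= act v k) = (i%:Z <= k).
Proof.
elim: v k => //= j v IH k; rewrite inE negb_or => /andP[ij iv].
rewrite -[RHS](IH k iv) /sref; case: ifP => [d|_].
  have : act v k != i%:Z by apply: contra ij => /eqP ik; rewrite -(ord_dvd (i := i) (j := j))// -ik.
  by lia.
case: ifP => // d; have : act v k + 1 != i%:Z.
  apply: contra ij => /eqP ik; rewrite -(ord_dvd (i := i) (j := j))// -ik.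
  by rewrite addrAC.
lia.
Qed.

(** The total displacement of a word over one period is 0, so nothing but the identity of rays can
remain after sorting. *)
Lemma act_ray w a b : (forall k, (a <= k) = (b <= act w k)) -> a = b.
Proof.
move=> h; have [i [q e]] := ord_of_int a.
have [|u [c [_ wu uP]]] := @sort_affine (pred1 i) _ (act_affine w).
  move=> _ /eqP ->; exists (b - q * n%:Z) => k.
  have := h (k + q * n%:Z); rewrite affine_permDn ?e//; last exact: act_affine.
  by rewrite lerD2r lerBlDr.
have c0 : c = 0 := translation_act wu.
have iu : i \notin u by apply/negP => /uP; rewrite /= eqxx.
have ray k : (a <= act w k) = (a <= k).
  have := ray_fixed (k - q * n%:Z) iu.
  have -> : act u (k - q * n%:Z) = act w k - q * n%:Z.
    by rewrite wu c0 addr0 -mulNr affine_permDn//; exact: act_affine.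
  by rewrite !lerBrDr -e.
have h' k : (a <= k) = (b <= k).
  by rewrite -[k in LHS](act_revK w) ray h act_revK.
by have := h' a; have := h' b; rewrite !lexx; lia.
Qed.

(** Sorting a permutation that preserves the ray from i never uses the letter i, so the stabiliser
of the ray is generated by the other letters. *)
Lemma parabolic_cosetP w i v : parabolic_coset m w [set~ i]%SET v <->
  (forall k, (i%:Z <= act (rev v) k) = (i%:Z <= act (rev w) k)).
Proof.
split=> [[x xP vx] k|h].
  have ix : i \notin x by apply/negP => /xP; rewrite !inE eqxx.
  have av l : act v l = act w (act x l) by rewrite (coxeter_eq_act vx) act_cat.
  by rewrite -[k in RHS](act_revK v) av act_rev (ray_fixed _ ix).
have [|x [c [_ ex xP]]] := @sort_affine (pred1 i) _ (act_affine (rev w ++ v)).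
  move=> _ /eqP ->; exists i%:Z => k.
  by rewrite act_cat -h act_rev.
have c0 : c = 0 := translation_act ex.
exists x; first by move=> j /xP /= ji; rewrite !inE.
apply/coxeter_eq_actP => k.
by rewrite act_cat -[act x k]addr0 -c0 -ex act_cat act_revK.
Qed.

Lemma ordS_dvd i : (n %| (ordS i)%:Z - i%:Z - 1)%Z.
Proof.
have e : (ordS i : nat) = ((i.+1) %% n)%N by [].
have := ltn_ord i; rewrite leq_eqVlt => /predU1P[li|li].
  rewrite e {1}li modnn; apply/dvdzP; exists (-1).
  by have := erefl n%:Z; rewrite -{1}li; lia.
by rewrite e modn_small// (_ : _ - 1 = 0) ?dvdz0//; lia.
Qed.

Lemma dvd_ordS i j : (n %| j%:Z - i%:Z - 1)%Z = (j == ordS i).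
Proof.
apply/idP/eqP => [d|->]; last exact: ordS_dvd.
apply: ord_dvd; have := rpredB d (ordS_dvd i).
by rewrite (_ : _ - _ = j%:Z - (ordS i)%:Z)//; ring.
Qed.

Lemma ordS_neq i : ordS i != i.
Proof.
apply/eqP => e; have := ordS_dvd i; rewrite e subrr sub0r dvd_small; lia.
Qed.

Lemma affine_matrixE i j : i != j -> m i j = if n == 2%N then 0%N else
  if (j == ordS i) || (i == ordS j) then 3%N else 2%N.
Proof. by move=> /negPf ij; rewrite /m ij !dvd_ordS. Qed.

Lemma affine_matrix_coxeter : coxeter_matrix m.
Proof.
split=> [i|i j|i j /negPf ij]; rewrite /m ?eqxx// ?ij.
  by rewrite eq_sym orbC.
by case: ifP => // _; case: ifP.
Qed.

(** A set closed under the cyclic successor is empty or everything. *)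
Lemma affine_matrix_irreducible : irreducible_diagram m.
Proof.
move=> J J0 JT.
suff [i iJ siJ] : exists2 i, i \in J & ordS i \notin J.
  exists i, (ordS i); split=> //; rewrite affine_matrixE ?eqxx 1?eq_sym ?ordS_neq//=.
  by case: ifP.
apply: contrapT => nex.
have closed i : i \in J -> ordS i \in J.
  by move=> iJ; apply/negPn/negP => niJ; apply: nex; exists i.
have [i iJ] := set0Pn _ J0.
have reach (k : nat) : exists2 j, j \in J & (n %| i%:Z + k%:Z - j%:Z)%Z.
  elim: k => [|k [j jJ d]]; first by exists i => //; rewrite addr0 subrr dvdz0.
  exists (ordS j); first exact: closed.
  have := rpredB d (ordS_dvd j).
  by rewrite (_ : _ - _ = i%:Z + k.+1%:Z - (ordS j)%:Z)// intS; ring.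
case/negP: JT; apply/eqP/setP => t; rewrite finset.in_setT.
have [j jJ d] := reach (n - i + t)%N.
suff -> : t = j by [].
apply: ord_dvd; rewrite -(dvdzDM _ 1).
by rewrite (_ : _ + _ = i%:Z + (n - i + t)%N%:Z - j%:Z)//; have := ltn_ord i; lia.
Qed.

(** By the triple angle formula, (c + 1) (2 c - 1)^2 = 0 for c = cos (pi / 3). *)
Lemma cos_pi3 (R : realType) : cos (pi / 3%:R) = 2^-1 :> R.
Proof.
set x : R := pi / 3%:R.
have pi_x : x + x + x = pi by rewrite /x; field.
have h1 : cos (x + x + x) = -1 by rewrite pi_x cospi.
have x0 : 0 < x by rewrite divr_gt0// pi_gt0.
have c0 : 0 < cos x.
  apply: cos_gt0_pihalf; rewrite (lt_trans _ x0) ?oppr_lt0 ?divr_gt0 ?pi_gt0//=.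
  by rewrite /x ltr_pM2l ?pi_gt0// ltf_pV2 ?posrE// ltr_nat.
move: h1; rewrite !(cosD, sinD); have := cos2Dsin2 x; set c := cos x; set s := sin x.
move=> h h1.
have : (c + 1) * (2 * c - 1) ^+ 2 = 0.
  have -> : (c + 1) * (2 * c - 1) ^+ 2 = ((c * c - s * s) * c - (s * c + c * s) * s + 1) +
    3 * c * (c ^+ 2 + s ^+ 2 - 1) by ring.
  by rewrite h1 h addNr subrr mulr0 addr0.
move/eqP; rewrite mulf_eq0 sqrf_eq0 => /orP[/eqP|/eqP]; last by lra.
by move=> e; rewrite -/c in c0; lra.
Qed.

(** On the cycle the form is half the sum of the squares of the differences of neighbours, and so it
vanishes on constant functions. *)
Lemma affine_matrix_affine (R : realType) : affine_type m R.
Proof.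
have formE (x : I -> R) : coxeter_form m x x = 2^-1 * \sum_i (x i - x (ordS i)) ^+ 2.
  have coef i j : (if m i j == 0%N then - 1 else - cos (pi / (m i j)%:R)) =
      (i == j)%:R - 2^-1 * ((j == ordS i)%:R + (i == ordS j)%:R) :> R.
    have [->|ij] := eqVneq i j.
      rewrite /m eqxx /= eq_sym (negPf (ordS_neq j)) /= divr1 cospi opprK.
      by rewrite addr0 mulr0 subr0.
    rewrite affine_matrixE//; case: (eqVneq n 2%N) => [n2|n2] /=.
      have nb (k l : I) : k != l -> l == ordS k.
        rewrite -dvd_ordS -val_eqE /= => kl; have := ltn_ord k; have := ltn_ord l => h1 h2.
        by apply/dvdzP; have [k0|k0] := posnP k; [exists 0|exists (-1)]; lia.
      rewrite (nb _ _ ij) nb 1?eq_sym//= sub0r -natrD mulVf//.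
    have [jSi|jSi] := eqVneq j (ordS i); have [iSj|iSj] := eqVneq i (ordS j).
    - have := ordS_dvd i; rewrite -jSi => d1; have := ordS_dvd j; rewrite -iSj => d2.
      have := rpredD d1 d2; rewrite (_ : _ + _ = - 2); last by ring.
      by rewrite dvd_small; lia.
    - by rewrite /= cos_pi3; ring.
    - by rewrite /= cos_pi3; ring.
    - by rewrite /= cos_pihalf; ring.
  rewrite /coxeter_form.
  under eq_bigr do under eq_bigr do rewrite coef mulrBr [_ * (2^-1 * _)]mulrCA mulrDr.
  have delta (f : I -> R) i : \sum_j f j * (j == i)%:R = f i.
    by rewrite (bigD1 i)//= eqxx mulr1 big1 ?addr0// => j /negPf ->; rewrite mulr0.
  have h1 : \sum_i \sum_j x i * x j * (i == j)%:R = \sum_i x i ^+ 2.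
    by apply: eq_bigr => i _; under eq_bigr do rewrite eq_sym; rewrite delta expr2.
  have h2 : \sum_i \sum_j x i * x j * (j == ordS i)%:R = \sum_i x i * x (ordS i).
    by apply: eq_bigr => i _; rewrite delta.
  have h3 : \sum_i \sum_j x i * x j * (i == ordS j)%:R = \sum_i x i * x (ordS i).
    rewrite exchange_big /=; apply: eq_bigr => j _.
    by rewrite (delta (fun i => x i * x j)) mulrC.
  have h4 : \sum_i x (ordS i) ^+ 2 = \sum_i x i ^+ 2.
    by rewrite [RHS](reindex_inj (@ordS_inj n)).
  under eq_bigr do rewrite sumrB -mulr_sumr big_split /= mulrDr.
  rewrite sumrB h1 big_split /= -!mulr_sumr h2 h3.
  under [in RHS]eq_bigr do rewrite sqrrB.
  rewrite big_split sumrB /= h4 sumrMnl.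
  set A := \sum_i x i ^+ 2; set B := \sum_i x i * x (ordS i); by rewrite -[B *+ 2]mulr_natl; field.
split; [exact: affine_matrix_irreducible| |].
  by move=> x; rewrite formE mulr_ge0// sumr_ge0// => i _; exact: sqr_ge0.
exists (fun=> 1); split; first by exists (Ordinal (ltnW n_ge2)); exact: oner_neq0.
by rewrite formE big1 ?mulr0// => i _; rewrite subrr expr0n.
Qed.

End AffineWeylGroup.

(** * Periodic flags and their complex *)

Lemma int_down (P : int -> Prop) N : (forall k, N <= k -> P k) ->
  (forall k, P (k + 1) -> P k) -> forall k, P k.
Proof.
move=> PN Pd k; have [/PN//|kN] := leP N k.
have [m e] : exists m : nat, N = k + m%:Z by exists (absz (N - k)); lia.
elim: m k {kN} e => [k e|m IH k e]; first by apply: PN; rewrite e addr0.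
by apply/Pd/IH; rewrite e intS; ring.
Qed.

Lemma int_jump (P : int -> Prop) j N : P j -> (forall k, N <= k -> ~ P k) ->
  exists k, P k /\ ~ P (k + 1).
Proof.
move=> Pj nP; apply: contrapT => nex.
suff : ~ P j by [].
move: j {Pj}; apply: (@int_down _ N nP) => k nPk1 Pk; apply: nex; by exists k.
Qed.

Lemma affine_perm_inv n (n_ge2 : (2 <= n)%N) (p : int -> int) : affine_perm n p ->
  exists p', [/\ affine_perm n p', cancel p p' & cancel p' p].
Proof.
move=> ap; have [//|w [c [_ e _]]] := @sort_affine n n_ge2 pred0 p ap.
have pK : cancel p (fun k => act (rev w) (k - c)).
  by move=> k; rewrite e addrK act_rev.
have p'K : cancel (fun k => act (rev w) (k - c)) p.
  by move=> k; rewrite e act_revK// subrK.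
exists (fun k => act (rev w) (k - c)); split=> //; split; last exact: can_inj p'K.
by move=> k; rewrite addrAC (proj1 (act_affine n_ge2 _)).
Qed.

Lemma affine_perm_comp n (p q : int -> int) : affine_perm n p -> affine_perm n q ->
  affine_perm n (p \o q).
Proof.
move=> [pn pi] [qn qi]; split; last exact: inj_comp.
by move=> k /=; rewrite qn pn.
Qed.

Lemma act_shift n (n_ge2 : (2 <= n)%N) (w : seq 'I_n) (c : int) :
  exists w' : seq 'I_n, forall k, act w' k = act w (k - c) + c.
Proof.
elim: w => [|i w [w' IH]]; first by exists [::] => k; rewrite /= subrK.
have [i' [q e]] := ord_of_int n_ge2 (i%:Z + c).
exists (i' :: w') => k; rewrite /= IH -(sref_shift n i%:Z _ c).
apply: sref_eqmod; apply/dvdzP; exists (- q); rewrite e; ring.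
Qed.

(** The common model D transports vertices of S to vertices of S'. *)
Lemma complex_iso_common (V V' : Type) (S S' : set (set V)) (D : set (set V')) phi :
  is_complex S -> is_complex S' -> complex_iso S D phi -> complex_iso S' D phi ->
  exists psi, complex_iso S S' psi /\
    forall v, vertices S v -> vertices S' v -> psi v = v.
Proof.
move=> cS cS' [injS DS] [injS' DS'].
have vS A v : S A -> A v -> vertices S v.
  by move=> SA Av; have [_ _] := cS A SA; apply=> [|_ ->//]; exists v.
have vS' A v : S' A -> A v -> vertices S' v.
  by move=> SA Av; have [_ _] := cS' A SA; apply=> [|_ ->//]; exists v.
have ex v : exists v', vertices S v -> vertices S' v' /\ phi v' = phi v.
  have [Sv|nS] := pselect (vertices S v); last by exists v.
  have : D [set phi v] by rewrite DS; exists [set v]; rewrite // image_set1.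
  rewrite DS' => -[A S'A e]; have [_ [v' Av'] _] := cS' A S'A.
  exists v' => _; split; first exact: vS' S'A Av'.
  have : (phi @` A) (phi v') by exists v'.
  by rewrite e.
have /choice[psi psiP] := ex.
have imgs A A' : S A -> S' A' -> phi @` A = phi @` A' -> psi @` A = A'.
  move=> SA SA' e; apply/seteqP; split.
    move=> _ [v Av <-]; have : (phi @` A') (phi v) by rewrite -e; exists v.
    move=> [v' A'v' ev]; have [h1 h2] := psiP v (vS _ _ SA Av).
    suff -> : psi v = v' by [].
    by apply: injS'; rewrite ?inE ?h2//; exact: vS' SA' A'v'.
  move=> v' A'v'; have : (phi @` A) (phi v') by rewrite e; exists v'.
  move=> [v Av ev]; exists v => //; have [h1 h2] := psiP v (vS _ _ SA Av).
  by apply: injS'; rewrite ?inE ?h2//; exact: vS' SA' A'v'.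
exists psi; split.
  split.
    move=> v w /set_mem Sv /set_mem Sw e; apply: injS; rewrite ?inE//.
    by have [_ <-] := psiP _ Sv; have [_ <-] := psiP _ Sw; rewrite e.
  apply/seteqP; split=> [A' SA'|_ [A SA <-]].
    have : D (phi @` A') by rewrite DS'; exists A'.
    by rewrite DS => -[A SA e]; exists A => //; exact: imgs.
  have : D (phi @` A) by rewrite DS; exists A.
  by rewrite DS' => -[A' SA' e]; rewrite (imgs _ _ SA SA' (esym e)).
move=> v Sv S'v; have [h1 h2] := psiP v Sv.
by apply: injS'; rewrite ?inE.
Qed.

Lemma complex_iso_comp (V : Type) (S S' S'' : set (set V)) phi psi : is_complex S ->
  complex_iso S S' phi -> complex_iso S' S'' psi -> complex_iso S S'' (psi \o phi).
Proof.
move=> cS [inj1 e1] [inj2 e2]; split.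
  have h v : vertices S v -> phi v \in vertices S'.
    by move=> Sv; rewrite inE e1; exists [set v]; rewrite // image_set1.
  move=> v w Sv Sw e; apply: inj1 => //; apply: inj2 => //.
    by apply/h/set_mem.
  by apply/h/set_mem.
rewrite e2 e1; apply/seteqP; split=> [_ [_ [A SA <-] <-]|_ [A SA <-]].
  by exists A => //; rewrite image_comp.
by exists (phi @` A); [exists A|rewrite image_comp].
Qed.

Section Periodic.
Context (n : nat) (n_ge2 : (2 <= n)%N) (X : Type) (x : int -> X -> X).
Context (xD : forall j k u, x (j + k) u = x j (x k u)) (x0 : forall u, x 0 u = u).

(** Frames, flags and the functions attached to them are all obtained from one period. *)
Lemma periodic_extension (g : 'I_n -> X) : exists h : int -> X,
  (forall i : 'I_n, h i%:Z = g i) /\ forall k q, h (k + q * n%:Z) = x q (h k).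
Proof.
have /choice[r /choice[s rs]] := fun k => ord_of_int n_ge2 k.
have rE (i : 'I_n) q : r (i%:Z + q * n%:Z) = i.
  apply/esym/(ord_dvd n_ge2)/dvdzP; exists (s (i%:Z + q * n%:Z) - q).
  have h := rs (i%:Z + q * n%:Z); rewrite mulrBl.
  transitivity ((i%:Z + q * n%:Z) - (r (i%:Z + q * n%:Z))%:Z - q * n%:Z); first by ring.
  by rewrite {1}h; ring.
have sE (i : 'I_n) q : s (i%:Z + q * n%:Z) = q.
  have := rs (i%:Z + q * n%:Z); rewrite rE => /addrI/eqP.
  rewrite -subr_eq0 -mulrBl mulf_eq0 => /orP[|]; last by lia.
  by rewrite subr_eq0 eq_sym => /eqP.
exists (fun k => x (s k) (g (r k))); split=> [i|k q].
  by have := rE i 0; have := sE i 0; rewrite !mul0r !addr0 => -> ->.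
have -> : k + q * n%:Z = (r k)%:Z + (q + s k) * n%:Z by rewrite {1}(rs k); ring.
by rewrite rE sE xD.
Qed.

End Periodic.

Section Flags.
Context (K : fieldType) (E : lmodType K) (n : nat) (n_ge2 : (2 <= n)%N).
Context (t : int -> E -> E).
Context (t_lin : forall k a u v, t k (a *: u + v) = a *: t k u + t k v).
Context (tD : forall j k u, t (j + k) u = t j (t k u)) (t0 : forall u, t 0 u = u).

Implicit Types (W M : set E) (U L : int -> set E) (f : int -> E) (p : int -> int)
  (j k q : int) (w : seq 'I_n).

Definition translate k W : set E := t k @` W.

Local Notation T := translate.

Lemma tK k : cancel (t k) (t (- k)).
Proof. by move=> u; rewrite -tD addNr t0. Qed.

Lemma tKN k : cancel (t (- k)) (t k).
Proof. by move=> u; rewrite -tD subrr t0. Qed.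

Lemma t_inj k : injective (t k). Proof. exact: can_inj (tK k). Qed.

Lemma translateD j k W : T (j + k) W = T j (T k W).
Proof.
apply/seteqP; split=> [_ [u Wu <-]|_ [_ [u Wu <-] <-]].
  by rewrite tD; exists (t k u) => //; exists u.
by exists u; rewrite // tD.
Qed.

Lemma translate0 W : T 0 W = W.
Proof.
by apply/seteqP; split=> [_ [u Wu <-]|u Wu]; [rewrite t0|exists u; rewrite ?t0].
Qed.

Lemma translateK k W : T (- k) (T k W) = W. Proof. by rewrite -translateD addNr translate0. Qed.

Lemma translateKN k W : T k (T (- k) W) = W. Proof. by rewrite -translateD subrr translate0. Qed.

Lemma translateS k W M : W `<=` M -> T k W `<=` T k M.
Proof. exact: image_subset. Qed.

Lemma translateE k W u : T k W u = W (t (- k) u).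
Proof.
by apply/propext; split=> [[v Wv <-]|Wu]; [rewrite tK|exists (t (- k) u); rewrite ?tKN].
Qed.

Lemma translate_subspace k W : is_subspace W -> is_subspace (T k W).
Proof. by move=> Ws; apply: subspace_image => //; exact: t_lin. Qed.

Lemma rdim_translate k W M d : rdim W M d -> rdim (T k W) (T k M) d.
Proof. by apply: rdim_image; [exact: t_lin|exact: t_inj]. Qed.

Lemma covers_translate k W M : covers W M -> covers (T k W) (T k M).
Proof.
move=> [MW [v [Wv nMv vg]]]; split; first exact: translateS.
exists (t k v); split; [by exists v|by move=> [u Mu /t_inj e]; rewrite e in Mu|].
move=> _ [u Wu <-]; have [a Ma] := vg _ Wu; exists a; exists (u - a *: v) => //.
by rewrite addrC -scaleNr t_lin scaleNr addrC.
Qed.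

Lemma translate_stableM W (m : nat) : T 1 W `<=` W -> T m%:Z W `<=` W.
Proof.
move=> W1; elim: m => [|m IH]; first by rewrite translate0.
by rewrite intS translateD; apply: subset_trans W1; exact: translateS.
Qed.

Lemma translate_stable W k : T 1 W `<=` W -> 0 <= k -> T k W `<=` W.
Proof. by move=> W1 k0; rewrite -(gez0_abs k0); exact: translate_stableM. Qed.

Lemma translate_stableS W a b : T 1 W `<=` W -> a <= b -> T b W `<=` T a W.
Proof.
move=> W1 ab; have -> : b = a + (b - a) by ring.
by rewrite translateD; apply: translateS; apply: translate_stable; rewrite // subr_ge0.
Qed.

Definition orb W : set (set E) := [set T k W | k in [set: int]].

Lemma orb_refl W : orb W W.
Proof. by exists 0; rewrite // translate0. Qed.

Lemma orb_translate k W : orb (T k W) = orb W.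
Proof.
apply/seteqP; split=> _ [j _ <-]; first by exists (j + k); rewrite // translateD.
by exists (j - k); rewrite // -translateD subrK.
Qed.

Lemma periodic_translate U k q : (forall k, T 1 (U k) = U (k + n%:Z)) ->
  T q (U k) = U (k + q * n%:Z).
Proof.
move=> U1; have nat (m : nat) k' : T m%:Z (U k') = U (k' + m%:Z * n%:Z).
  elim: m => [|m IH]; first by rewrite translate0 mul0r addr0.
  by rewrite intS translateD IH U1; congr U; ring.
case: q => m; first exact: nat.
have := nat m.+1 (k + Negz m * n%:Z); rewrite NegzE mulNr subrK => <-.
by rewrite translateK.
Qed.

Section Class.
Context (G : set (set E)).
Context (G_sub : forall W, G W -> is_subspace W).
Context (G_rdim : forall W, G W -> rdim W (T 1 W) n).
Context (G_between : forall W M a b, G W -> is_subspace M -> T 1 M `<=` M ->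
  T a W `<=` M -> M `<=` T b W -> G M).

Definition full_flag U : Prop := [/\ forall k, G (U k),
  forall k, covers (U k) (U (k + 1)) & forall k, T 1 (U k) = U (k + n%:Z)].

Definition flag_vertices U : set (set (set E)) := [set orb (U k) | k in [set: int]].

Lemma G_stable W : G W -> T 1 W `<=` W.
Proof. by move=> /G_rdim/rdim_sub. Qed.

Lemma G_translate W k : G W -> G (T k W).
Proof.
move=> GW; apply: (@G_between W _ k k) => //; first exact: translate_subspace (G_sub GW).
by rewrite -translateD addrC translateD; apply: translateS; exact: G_stable.
Qed.

Section OneFlag.
Context (U : int -> set E) (fU : full_flag U).

Lemma flag_sub k : is_subspace (U k).
Proof. by apply: G_sub; case: fU. Qed.

Lemma flagS j k : j <= k -> U k `<=` U j.
Proof.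
move=> jk; have -> : k = j + (absz (k - j))%:Z by lia.
elim: (absz _) => [|m IH]; first by rewrite addr0.
rewrite -addn1 PoszD addrA; apply: subset_trans IH.
by have [_ /(_ (j + m%:Z))[]] := fU.
Qed.

Lemma flag_translate k q : T q (U k) = U (k + q * n%:Z).
Proof. by apply: periodic_translate; case: fU. Qed.

Lemma flag_vertices_ord B : flag_vertices U B -> exists i : 'I_n, B = orb (U i%:Z).
Proof.
move=> [k _ <-]; have [i [q ->]] := ord_of_int n_ge2 k.
by exists i; rewrite -flag_translate orb_translate.
Qed.

Lemma flag_covers k v : U k v -> ~ U (k + 1) v ->
  forall u, U k u -> exists a, U (k + 1) (u - a *: v).
Proof.
have [_ /(_ k) c _] := fU.
by apply: (covers_gen _ _ c); exact: flag_sub.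
Qed.

Lemma flag_notin k : exists v, U k v /\ ~ U (k + 1) v.
Proof. by have [_ /(_ k)[_ [v []]]] := fU; exists v. Qed.

Lemma flag_lt j k : j < k -> ~ (U j `<=` U k).
Proof.
move=> jk le; have [v [Uv]] := flag_notin j; apply.
by apply: flagS (le _ Uv); lia.
Qed.

End OneFlag.

(** Periodicity only; independence comes from adapted flags. *)
Definition frame f : Prop := forall k q, f (k + q * n%:Z) = t q (f k).

Definition adapted f p U : Prop := forall k, U k (f (p k)) /\ ~ U (k + 1) (f (p k)).

Lemma frame_exists U : full_flag U -> exists f, frame f /\ adapted f id U.
Proof.
move=> fU; have /choice[v Uv] := fun i : 'I_n => flag_notin fU i%:Z.
have [f [fv fp]] := periodic_extension n_ge2 tD t0 v.
exists f; split=> // k /=; have [i [q ->]] := ord_of_int n_ge2 k.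
have [h1 h2] := Uv i; rewrite fp fv; split.
  by rewrite -flag_translate// translateE tK.
by rewrite addrAC -flag_translate// translateE tK.
Qed.

Context (G_comm : forall W M, G W -> G M -> exists a, T a W `<=` M).

(** Commensurability plays the role of the topology: deep members of a flag are contained in any
given lattice. *)
Lemma flag_deep U M : full_flag U -> G M ->
  exists N, forall k, N <= k -> U k `<=` M.
Proof.
move=> fU GM; have [G0 _ _] := fU; have [a aU] := G_comm (G0 0) GM.
exists (a * n%:Z) => k ak; apply: subset_trans (flagS fU ak) _.
by rewrite -[a * _]add0r -flag_translate.
Qed.

Lemma flag_high U M : full_flag U -> G M -> exists N, forall k, k <= N -> M `<=` U k.
Proof.
move=> fU GM; have [G0 _ _] := fU; have [a aM] := G_comm GM (G0 0).
exists ((- a) * n%:Z) => k ak; apply: subset_trans (flagS fU ak).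
by rewrite -[(- a) * _]add0r -flag_translate// -[M](translateK a); exact: translateS.
Qed.

(** Expand x along the frame from q on: since p j < q, the vector f (p j) does not occur, so x has no
component of index j in U. The induction runs downwards on q, from a place N beyond which L is
contained in U (j + 1); cancelling the leading term of x at q may lower j. *)
Lemma adapted_leading f p p' U L : full_flag U -> full_flag L -> affine_perm n p ->
  cancel p p' -> cancel p' p ->
  adapted f id L -> adapted f p U -> forall q j x, L q x -> U j x -> p j < q -> U (j + 1) x.
Proof.
move=> fU fL ap pK p'K aL aU q j0 x0 Lx Ux lt.
have GU : G (U (j0 + 1)) by case: fU.
have [N NL] := flag_deep fL GU.
suff main q' : forall j x, j <= j0 -> L q' x -> U j x -> p j < q' -> U (j + 1) x.
  exact: main q _ _ (lexx _) Lx Ux lt.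
move: q'; apply: (@int_down _ N) => [k Nk|k IH] j x jj Lkx Ujx jk.
  by apply: (flagS fU _ (NL _ Nk _ Lkx)); rewrite lerD2r.
have [Lk nLk] := aL k; have [a La] := flag_covers fL Lk nLk Lkx.
have [U1 U2] := aU (p' k); rewrite p'K in U1 U2.
have sU := flag_sub fU.
case: (ltgtP (p' k) j) => [lj|gj|ej]; last by rewrite -ej p'K ltxx in jk.
(* Suppose that f k occurs in x and lies less deep in U than x does. By induction x - a f k lies in
   U (p' k + 1), which would put f k there. *)
- have [a0|a0] := eqVneq a 0.
    by rewrite a0 scale0r subr0 in La; apply: IH => //; lia.
  have Uy : U (p' k) (x - a *: f k).
    by apply: subspaceB (subspaceZ _ _ U1) => //; apply: flagS Ujx => //; exact: ltW.
  have := IH (p' k) _ _ La Uy; rewrite p'K => /(_ ltac:(lia) ltac:(lia)) Uy1.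
  exfalso; apply: U2; apply: (subspaceZr (sU _) a0).
  rewrite (_ : a *: f k = x - (x - a *: f k)); last by rewrite opprB addrCA subrr addr0.
  by apply: subspaceB => //; apply: flagS Ujx => //; lia.
- have Ufk : U (j + 1) (f k) by apply: flagS U1 => //; lia.
  rewrite -(subrK (a *: f k) x); apply: subspaceD => //; last exact: subspaceZ.
  apply: IH => //; last by lia.
  apply: subspaceB => //; apply: subspaceZ => //; apply: flagS Ufk => //; lia.
Qed.

(** These places are defined from X and L alone, whereas membership of f k in X refers to a frame. *)
Definition jumps L M k : Prop := exists x, [/\ M x, L k x & ~ L (k + 1) x].

(** A jump gives a frame vector by the leading term argument with U and L exchanged. *)
Lemma adapted_jumps f p p' U L : full_flag U -> full_flag L -> affine_perm n p ->
  cancel p p' -> cancel p' p ->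
  adapted f id L -> adapted f p U -> forall i k, jumps L (U k) i <-> k <= p' i.
Proof.
move=> fU fL ap pK p'K aL aU i k; split=> [[x [Ukx Lx nLx]]|ki].
  rewrite leNgt; apply/negP => ki; apply: nLx.
  have ap' : affine_perm n p'.
    have [r [ar rK' rK]] := affine_perm_inv n_ge2 ap.
    by have -> : p' = r by apply/funext => l; rewrite -[l in RHS]p'K rK'.
  have aUid : adapted (f \o p) id U by [].
  have aLp' : adapted (f \o p) p' L by move=> l /=; rewrite p'K; exact: aL.
  exact: (adapted_leading fL fU ap' p'K pK aUid aLp' Ukx Lx ki).
have [U1 U2] := aU (p' i); rewrite p'K in U1 U2; have [L1 L2] := aL i.
by exists (f i); split=> //; exact: flagS U1.
Qed.

(** Modulo a deep member of U, contained in M, the space U k is spanned by frame vectors. *)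
Lemma adapted_sub f p U M k : full_flag U -> G M -> adapted f p U ->
  (forall j, k <= j -> M (f (p j))) -> U k `<=` M.
Proof.
move=> fU GM aU Mf; have [N NM] := flag_deep fU GM.
suff main j : k <= j -> U j `<=` M by exact: main (lexx k).
move: j; apply: (@int_down _ N) => [j Nj _|j IH kj]; first exact: NM.
move=> x Ux; have [U1 U2] := aU j; have [a Ua] := flag_covers fU U1 U2 Ux.
rewrite -(subrK (a *: f (p j)) x); apply: subspaceD (G_sub GM) _ _.
  by apply: IH Ua; lia.
exact: subspaceZ (G_sub GM) (Mf _ kj).
Qed.

(** Only the members of index congruent to i change. The new one is stable because z maps U (i - 1)
into U (i + 1), which uses n >= 2. *)
Lemma adjacent_flag U (i : int) v : full_flag U -> U (i - 1) v -> ~ U i v ->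
  exists U', [/\ full_flag U', forall k, ~~ (n %| k - i)%Z -> U' k = U k &
    U' i = adjoin (U (i + 1)) v].
Proof.
move=> fU Uv nUv; have sU := flag_sub fU; have [GU cU TU] := fU.
have [u [Uu nUu]] := flag_notin fU i.
pose M := adjoin (U (i + 1)) v.
have sM : is_subspace M by exact: subspace_adjoin.
have le1 : U (i + 1) `<=` M by exact: adjoin_sub.
have Mle : M `<=` U (i - 1) by apply: adjoin_min => //; apply: (flagS fU); lia.
have TM : T 1 M `<=` M.
  apply: subset_trans (translateS Mle) _; rewrite TU; apply: subset_trans le1.
  by apply: (flagS fU); lia.
have GM : G M.
  apply: (@G_between (U (i - 1)) M 1 0) => //; last by rewrite translate0.
  by rewrite TU; apply: subset_trans le1; apply: (flagS fU); lia.
have nU1v : ~ U (i + 1) v by move=> h; apply: nUv; apply: flagS h => //; lia.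
have c1 : covers M (U (i + 1)) by exact: covers_adjoin.
have c2 : covers (U (i - 1)) M.
  split=> //; exists u; split; first by apply: flagS Uu => //; lia.
    move=> [a Ua]; have [a0|a0] := eqVneq a 0.
      by rewrite a0 scale0r subr0 in Ua.
    apply: nUv; apply: (subspaceZr (sU _) a0).
    rewrite (_ : a *: v = u - (u - a *: v)); last by rewrite opprB addrCA subrr addr0.
    by apply: subspaceB => //; apply: flagS Ua => //; lia.
  have := @flag_covers _ fU (i - 1) v Uv; rewrite subrK => vg x Ux.
  have [a Ua] := vg nUv x Ux; have [b Ub] := flag_covers fU Uu nUu Ua.
  by exists b; exists a; rewrite addrAC.
have c1' k : (n %| k - i)%Z -> covers (T ((k - i) %/ n)%Z M) (U (k + 1)).
  move=> d; have -> : U (k + 1) = T ((k - i) %/ n)%Z (U (i + 1)).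
    by rewrite flag_translate//; congr U; rewrite divzK//; ring.
  exact: covers_translate.
have c2' k : (n %| k + 1 - i)%Z -> covers (U k) (T ((k + 1 - i) %/ n)%Z M).
  move=> d; have {1}-> : U k = T ((k + 1 - i) %/ n)%Z (U (i - 1)).
    by rewrite flag_translate//; congr U; rewrite divzK//; ring.
  exact: covers_translate.
have n0 : n%:Z != 0 by lia.
exists (fun k => if (n %| k - i)%Z then T ((k - i) %/ n)%Z M else U k); split.
- split=> k.
  + by case: ifP => _; [exact: G_translate|exact: GU].
  + case: ifPn => [d|nd]; case: ifPn => [d'|nd'] //; last exact: c2'.
      exfalso; have := rpredB d' d; rewrite (_ : _ - _ = 1); last by ring.
      by rewrite (dvd_small (n := n)); lia.
    exact: c1'.
  + have e1 : k + n%:Z - i = k - i + 1 * n%:Z by ring.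
    have e2 : ((k - i + 1 * n%:Z) %/ n)%Z = 1 + ((k - i) %/ n)%Z by rewrite addrC divzMDl.
    by rewrite e1 dvdzDM e2; case: ifP => _; rewrite ?TU// translateD.
- by move=> k /negPf ->.
- by rewrite subrr dvdz0 div0z translate0.
Qed.

(** Let s k be the last place where U still meets L k outside L (k + 1), and choose f k there. If
s k = s k' with k < k', then subtracting a multiple of f k' from f k moves it deeper into U
without moving it into L (k + 1), against the choice of s k; so s is injective. *)
Lemma common_frame L U : full_flag L -> full_flag U ->
  exists f p, [/\ frame f, affine_perm n p, adapted f id L & adapted f p U].
Proof.
move=> fL fU; have [GL _ _] := fL; have [GU _ _] := fU.
have jump (i : 'I_n) : exists xj : E * int, [/\ U xj.2 xj.1, L i%:Z xj.1, ~ L (i%:Z + 1) xj.1 &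
    forall y, U (xj.2 + 1) y -> L i%:Z y -> L (i%:Z + 1) y].
  (* Far out U contains L i, and further on it is contained in L (i + 1); hence a last place. *)
  have [N hN] := flag_high fU (GL i%:Z); have [x [Lx nLx]] := flag_notin fL i%:Z.
  have [N' hN'] := flag_deep fU (GL (i%:Z + 1)).
  have [||j [[y [Uy Ly nLy]] nj]] := @int_jump (fun j => jumps L (U j) i%:Z) N N'.
  - by exists x; split=> //; exact: (hN N).
  - by move=> k /hN' le [y [/le]].
  by exists (y, j); split=> // z Uz Lz; apply: contrapT => nLz; apply: nj; exists z.
have /choice[xj xjP] := jump.
have [f [fx fper]] := periodic_extension n_ge2 tD t0 (fun i => (xj i).1).
have [||s [sx sper]] := @periodic_extension n n_ge2 int (fun q k => k + q * n%:Z)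
    _ _ (fun i => (xj i).2).
- by move=> j k q; ring.
- by move=> k; ring.
have key k : [/\ U (s k) (f k), L k (f k), ~ L (k + 1) (f k) &
    forall y, U (s k + 1) y -> L k y -> L (k + 1) y].
  have [i [q ->]] := ord_of_int n_ge2 k; rewrite fper sper fx sx.
  have [h1 h2 h3 h4] := xjP i.
  rewrite ![_ + q * _ + 1]addrAC -!(flag_translate fU) -!(flag_translate fL) !translateE tK; split=> // y.
  by rewrite !translateE; exact: h4.
have s_inj : injective s.
  suff main k k' : k < k' -> s k <> s k'.
    by move=> k k' e; case: (ltgtP k k') => // /main; rewrite e.
  move=> lt e; have [h1 h2 h3 h4] := key k; have [h1' h2' h3' h4'] := key k'.
  have nU : ~ U (s k' + 1) (f k') by move=> /h4'/(_ h2').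
  have [|a Ua] := flag_covers fU h1' nU (u := f k); first by rewrite -e.
  have sL := flag_sub fL.
  have Lk' : L (k + 1) (f k') by apply: (flagS fL) h2'; lia.
  have La : L (k + 1) (f k - a *: f k').
    apply: h4; rewrite ?e//; apply: subspaceB => //; apply: subspaceZ => //.
    by apply: (flagS fL) Lk'; lia.
  by apply: h3; rewrite -(subrK (a *: f k') (f k)); apply: subspaceD (subspaceZ _ _ _).
have s_aff : affine_perm n s by split=> // k; have := sper k 1; rewrite mul1r.
have [p [ap pK p'K]] := affine_perm_inv n_ge2 s_aff.
exists f, p; split=> // [k|k].
  by have [] := key k.
have [h1 h2 h3 h4] := key (p k); rewrite p'K in h1 h4; split=> //.
by move=> /h4/(_ h2).
Qed.

Lemma adapted_period f p U k q : full_flag U -> frame f -> affine_perm n p ->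
  (U k (f (p k)) /\ ~ U (k + 1) (f (p k))) ->
  U (k + q * n%:Z) (f (p (k + q * n%:Z))) /\
  ~ U (k + q * n%:Z + 1) (f (p (k + q * n%:Z))).
Proof.
move=> fU ff ap; rewrite affine_permDn// ff addrAC -!(flag_translate fU) !translateE tK.
by [].
Qed.

(** Each letter exchanges two consecutive frame vectors, by passing to an adjacent flag. *)
Lemma word_flag f L w : frame f -> full_flag L -> adapted f id L ->
  exists U, full_flag U /\ adapted f (act w) U.
Proof.
move=> ff fL aL; elim/last_ind: w => [|w i [U [fU aU]]]; first by exists L.
have aw := act_affine n_ge2 w.
have [v1] := aU (i%:Z - 1); rewrite subrK => v2.
have [u1 u2] := aU i%:Z.
have [U' [fU' U'E U'i]] := adjacent_flag fU v1 v2.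
have sU := flag_sub fU; exists U'; split=> // k.
have [q [r [-> r0 r1]]] := window n_ge2 i%:Z k.
apply: (@adapted_period f (act (rcons w i)) U') => //; first exact: act_affine.
rewrite act_rcons.
have nd x : - n%:Z < x -> x < n%:Z -> x != 0 -> ~~ (n %| x)%Z.
  by move=> x0 x1; rewrite dvd_small.
have nv : ~ U (i%:Z + 1) (f (act w (i%:Z - 1))).
  by move=> h; apply: v2; apply: (flagS fU) h; lia.
have [->|r_0] := eqVneq r 0.
  rewrite addr0 sref0 U'i U'E; last by rewrite addrAC subrr add0r; apply: nd; lia.
  by split=> //; exact: adjoin_mem.
have [->|r_1] := eqVneq r (-1).
  rewrite srefB1// subrK U'i U'E; last by rewrite addrAC subrr add0r; apply: nd; lia.
  split; first by apply: (flagS fU) u1; lia.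
  move=> [a Ua]; have [a0|a0] := eqVneq a 0; first by rewrite a0 scale0r subr0 in Ua.
  apply: v2; apply: (subspaceZr (sU _) a0).
  rewrite (_ : a *: _ = f (act w i%:Z) - (f (act w i%:Z) - a *: f (act w (i%:Z - 1)))).
    by apply: subspaceB => //; apply: (flagS fU) Ua; lia.
  by rewrite opprB addrCA subrr addr0.
rewrite sref_fix; last 2 first.
- by rewrite (_ : _ - _ = r); [apply: nd; lia|ring].
- by rewrite (_ : _ - _ = r + 1); [apply: nd; lia|ring].
rewrite !U'E; first exact: aU.
- by rewrite (_ : _ - _ = r + 1); [apply: nd; lia|ring].
- by rewrite (_ : _ - _ = r); [apply: nd; lia|ring].
Qed.

Lemma shift_flag U c : full_flag U -> full_flag (fun k => U (k - c)).
Proof.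
move=> [GU cU TU]; split=> k //; first by rewrite addrAC.
by rewrite TU addrAC.
Qed.

Lemma shift_vertices U c : flag_vertices (fun k => U (k - c)) = flag_vertices U.
Proof.
apply/seteqP; split=> _ [k _ <-]; first by exists (k - c).
by exists (k + c); rewrite // addrK.
Qed.

(** Sorting p leaves a translation of the values, which is turned into a shift of the index of U; the
vertices do not see the shift. *)
Lemma adapted_word f p U : full_flag U -> affine_perm n p -> adapted f p U ->
  exists w V, [/\ full_flag V, adapted f (act w) V & flag_vertices V = flag_vertices U].
Proof.
move=> fU ap aU; have [//|w0 [c [_ e _]]] := @sort_affine n n_ge2 pred0 p ap.
have [w we] := act_shift n_ge2 w0 c.
exists w, (fun k => U (k - c)); split; [exact: shift_flag| |exact: shift_vertices].
by move=> k; rewrite we -e addrAC; exact: aU.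
Qed.

Definition apartment f : set (set (set (set E))) := [set A | A !=set0 /\
  exists U p, [/\ full_flag U, affine_perm n p, adapted f p U & A `<=` flag_vertices U]].

Definition full_complex : set (set (set (set E))) := [set A | A !=set0 /\
  exists2 U, full_flag U & A `<=` flag_vertices U].

Lemma finite_flag_vertices U : full_flag U -> finite_set (flag_vertices U).
Proof.
move=> fU; apply: (@sub_finite_set _ _ [set orb (U (nat_of_ord i)%:Z) | i in [set: 'I_n]]).
  by move=> B /(flag_vertices_ord fU)[i ->]; exists i.
exact/finite_image/finite_finset.
Qed.

Lemma full_complex_is_complex : is_complex full_complex.
Proof.
move=> A [A0 [U fU AU]]; split=> //.
  by apply: sub_finite_set AU _; exact: finite_flag_vertices.
by move=> B B0 BA; split=> //; exists U => //; exact: subset_trans AU.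
Qed.

Lemma apartment_is_complex f : is_complex (apartment f).
Proof.
move=> A [A0 [U [p [fU ap aU AU]]]]; split=> //.
  by apply: sub_finite_set AU _; exact: finite_flag_vertices.
by move=> B B0 BA; split=> //; exists U, p; split=> //; exact: subset_trans AU.
Qed.

Lemma apartment_sub f : apartment f `<=` full_complex.
Proof. by move=> A [A0 [U [p [fU _ _ AU]]]]; split=> //; exists U. Qed.

Local Notation m := (@affine_matrix n).

(** The words that carry a standard ray onto the set of jumps in L of a member of the orbit B. *)
Definition retraction L (B : set (set E)) : set (seq 'I_n) :=
  [set x | exists (X : set E) (i : 'I_n), B X /\
    forall k, jumps L X k <-> i%:Z <= act (rev x) k].

(** The charge of a ray is preserved by words, so the orbit and the type i are determined. *)
Lemma retraction_orb f L U w (i : 'I_n) : frame f -> full_flag L -> adapted f id L ->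
  full_flag U -> adapted f (act w) U ->
  retraction L (orb (U i%:Z)) = parabolic_coset m w [set~ i]%SET.
Proof.
move=> ff fL aL fU aU; have aw := act_affine n_ge2 w.
have J k l : jumps L (U k) l <-> k <= act (rev w) l.
  by apply: (adapted_jumps fU fL aw _ _ aL aU) => l'; rewrite ?act_rev ?act_revK.
apply/seteqP; split=> x.
  move=> [_ [i' [[q _ <-]]]]; rewrite flag_translate// => e.
  have {}e k : (i'%:Z <= k) = (i%:Z + q * n%:Z <= act (rev w ++ x) k).
    rewrite act_cat; apply/idP/idP => h.
      by apply/J/e; rewrite act_rev.
    by move: h => /J/e; rewrite act_rev.
  have e' := act_ray n_ge2 e.
  have ii' : i' = i.
    by apply: (ord_dvd n_ge2); apply/dvdzP; exists q; rewrite e'; ring.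
  apply/(parabolic_cosetP n_ge2) => k.
  by rewrite -{1}ii' e -e' ii' act_cat act_revK.
move=> /(parabolic_cosetP n_ge2) h; exists (U i%:Z), i; split; first exact: orb_refl.
by move=> k; rewrite h.
Qed.

Lemma apartment_vertex f B : vertices (apartment f) B ->
  exists w U (i : 'I_n), [/\ full_flag U, adapted f (act w) U & B = orb (U i%:Z)].
Proof.
move=> [_ [U [p [fU ap aU]]]] /(_ _ erefl) BU.
have [w [V [fV aV eV]]] := adapted_word fU ap aU.
rewrite -eV in BU; have [i e] := flag_vertices_ord fV BU.
by exists w, V, i.
Qed.

(** Injectivity: the coset recovers first the type and then the ray, and by adapted_sub the ray
recovers the lattice. *)
Lemma apartment_coxeter f L : frame f -> full_flag L -> adapted f id L ->
  complex_iso (apartment f) (coxeter_complex m) (retraction L).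
Proof.
move=> ff fL aL; split.
  move=> B B' /set_mem/apartment_vertex[w [U [i [fU aU ->]]]].
  move=> /set_mem/apartment_vertex[w' [U' [i' [fU' aU' ->]]]].
  rewrite (retraction_orb i ff fL aL fU aU) (retraction_orb i' ff fL aL fU' aU') => e.
  have wP : parabolic_coset m w [set~ i]%SET w by apply/(parabolic_cosetP n_ge2).
  have ww' := wP; rewrite e in ww'; move/(parabolic_cosetP n_ge2) in ww'.
  have [ii'|ii'] := eqVneq i i'.
    rewrite -ii' in ww' *; congr orb.
    have GU : G (U i%:Z) by case: fU.
    have GU' : G (U' i%:Z) by case: fU'.
    apply/seteqP; split.
      apply: (adapted_sub fU GU' aU) => j ij.
      rewrite -[act w j](act_revK n_ge2 w').
      have [h _] := aU' (act (rev w') (act w j)).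
      by apply: (flagS fU') h; rewrite -ww' act_rev.
    apply: (adapted_sub fU' GU aU') => j ij.
    rewrite -[act w' j](act_revK n_ge2 w).
    have [h _] := aU (act (rev w) (act w' j)).
    by apply: (flagS fU) h; rewrite ww' act_rev.
  have : parabolic_coset m w [set~ i]%SET (rcons w i').
    exists [:: i']; first by move=> j; rewrite !inE => /eqP ->; rewrite eq_sym.
    by rewrite cats1; exact: coxeter_refl.
  rewrite e => /(parabolic_cosetP n_ge2) h.
  have := h (act w i'%:Z); rewrite -ww' rev_rcons /= act_rev// sref0 lexx.
  by move=> h'; exfalso; lia.
apply/seteqP; split.
  move=> _ [w [J [JT ->]]].
  have [U [fU aU]] := word_flag w ff fL aL.
  exists [set orb (U (nat_of_ord i)%:Z) | i in [set i | i \notin J]]; last first.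
    apply/seteqP; split.
      move=> _ [_ [i iJ <-] <-]; exists i => //.
      by rewrite (retraction_orb i ff fL aL fU aU).
    move=> _ [i iJ <-]; exists (orb (U i%:Z)); first by exists i.
    by rewrite (retraction_orb i ff fL aL fU aU).
  split.
    have [i iJ] : exists i, i \notin J.
      apply: contrapT => nex; case/negP: JT; apply/eqP/setP => i.
      rewrite finset.in_setT; apply/negPn/negP => iJ; apply: nex; by exists i.
    by exists (orb (U i%:Z)), i.
  exists U, (act w); split=> //; first exact: act_affine.
  by move=> _ [i _ <-]; exists i%:Z.
move=> _ [A [[B AB] [U0 [p [fU0 ap aU0 AU0]]]] <-].
have [w [U [fU aU eU]]] := adapted_word fU0 ap aU0; rewrite -eU in AU0.
exists w, (finset (fun i : 'I_n => `[< ~ A (orb (U i%:Z)) >])); split.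
  have [i Bi] := flag_vertices_ord fU (AU0 _ AB).
  apply/eqP => /setP/(_ i); rewrite !inE => /asboolP; apply.
  by rewrite -Bi.
apply/seteqP; split.
  move=> _ [B' AB' <-]; have [i Bi] := flag_vertices_ord fU (AU0 _ AB').
  exists i; last by rewrite Bi (retraction_orb i ff fL aL fU aU).
  by rewrite /= inE; apply/negP => /asboolP; rewrite -Bi.
move=> _ [i /= iA <-]; exists (orb (U i%:Z)).
  by move: iA; rewrite inE => /asboolPn/contrapT.
by rewrite (retraction_orb i ff fL aL fU aU).
Qed.

Lemma orb_flag U k M : full_flag U -> orb M = orb (U k) -> exists l, M = U l.
Proof.
move=> fU e; have : orb (U k) M by rewrite -e; exact: orb_refl.
by move=> [q _ <-]; exists (k + q * n%:Z); rewrite flag_translate.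
Qed.

(** A lattice comparable with all members of U lies between two consecutive ones. *)
Lemma flag_chamber U : full_flag U -> chamber full_complex (flag_vertices U).
Proof.
move=> fU; have [GU _ _] := fU; split.
  by split; [exists (orb (U 0)), 0|exists U].
move=> B [_ [V fV BV]] UB; apply/seteqP; split=> // _ /BV[k _ <-].
have [GV _ _] := fV; have sU := flag_sub fU.
have mem j : exists l, U j = V l.
  have : flag_vertices V (orb (U j)) by apply/BV/UB; exists j.
  by move=> [l _ e]; apply: (orb_flag fV (esym e)).
have [N hN] := flag_high fU (GV k); have [N' hN'] := flag_deep fU (GV (k + 1)).
have [||j [Vj nVj]] := @int_jump (fun j => V k `<=` U j) N N'; first exact: hN.
  by move=> l /hN' h1 h2; apply: (flag_lt fV (_ : k < k + 1)); [lia|exact: subset_trans h1].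
have [l e] := mem (j + 1).
have Ujk : U (j + 1) `<=` V k.
  rewrite e; apply: (flagS fV); rewrite leNgt; apply/negP => lk; apply: nVj.
  by rewrite e; apply: (flagS fV); exact: ltW.
have [_ /(_ j) c _] := fU.
have [->|->] := covers_between (sU _) (sU _) (flag_sub fV _) c Ujk Vj.
  by exists j.
by exists (j + 1).
Qed.

Lemma flag_vertices_inj_at U V i : full_flag U -> full_flag V ->
  U (i - 1) = V (i - 1) -> U (i + 1) = V (i + 1) -> flag_vertices U = flag_vertices V ->
  U i = V i.
Proof.
move=> fU fV e1 e2 e; have : flag_vertices V (orb (U i)) by rewrite -e; exists i.
move=> [k _ /esym/(orb_flag fV)[l el]]; rewrite el; congr V.
have [h|h] := lerP l (i - 1).
  exfalso; apply: (flag_lt fU (_ : i - 1 < i)); first by lia.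
  by rewrite el e1; exact: (flagS fV h).
have [h'|h'] := lerP (i + 1) l; last by lia.
exfalso; apply: (flag_lt fU (_ : i < i + 1)); first by lia.
by rewrite el e2; exact: (flagS fV h').
Qed.

(** The panel of type i extends by the lines of the plane U (i - 1) / U (i + 1); those through the
classes of u, v and u + v are distinct. *)
Lemma full_complex_thick : thick full_complex.
Proof.
move=> A B [[B0 [U fU BU]] Bmax] [KA [x nAx eB]].
have {BU Bmax}eU : flag_vertices U = B.
  by apply: Bmax BU; split; [exists (orb (U 0)), 0|exists U].
have : B x by rewrite eB; right.
rewrite -eU => -[i _ ex].
have AU a : A a -> exists2 k, ~~ (n %| k - i)%Z & a = orb (U k).
  move=> Aa; have : B a by rewrite eB; left.
  rewrite -eU => -[k _ ea]; exists k => //; apply/negP => /dvdzP[q kq]; apply: nAx.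
  suff <- : a = x by [].
  rewrite -ea -ex -(orb_translate q (U i)) flag_translate//; congr (orb (U _)); lia.
have sU := flag_sub fU.
have [v [v1 v2]] := flag_notin fU (i - 1); rewrite subrK in v2.
have [u [u1 u2]] := flag_notin fU i.
have u1' : U (i - 1) u by apply: (flagS fU) u1; lia.
have w1 : U (i - 1) (v + u) by exact: subspaceD.
have w2 : ~ U i (v + u).
  by move=> h; apply: v2; rewrite -(addrK u v); exact: subspaceB.
have [V1 [fV1 V1E V1i]] := adjacent_flag fU v1 v2.
have [V2 [fV2 V2E V2i]] := adjacent_flag fU w1 w2.
have nd1 : ~~ (n %| i - 1 - i)%Z by rewrite dvd_small; lia.
have nd2 : ~~ (n %| i + 1 - i)%Z by rewrite dvd_small; lia.
have face V : full_flag V -> (forall k, ~~ (n %| k - i)%Z -> V k = U k) ->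
    chamber full_complex (flag_vertices V) /\ A `<=` flag_vertices V.
  move=> fV VE; split; first exact: flag_chamber.
  by move=> a /AU[k nk ->]; rewrite -VE//; exists k.
exists (flag_vertices U), (flag_vertices V1), (flag_vertices V2); split; last first.
  by split; apply: face.
split.
- move/(flag_vertices_inj_at (i := i) fU fV1); rewrite (V1E _ nd1) (V1E _ nd2) => /(_ erefl erefl) e.
  by apply: v2; rewrite e V1i; exact: adjoin_mem.
- move/(flag_vertices_inj_at (i := i) fV1 fV2); rewrite (V1E _ nd1) (V1E _ nd2) (V2E _ nd1) (V2E _ nd2) => /(_ erefl erefl) e.
  have : V1 i (v + u) by rewrite e V2i; exact: adjoin_mem.
  rewrite V1i => -[a Ua].
  have [a1|a1] := eqVneq a 1.
    by apply: u2; move: Ua; rewrite a1 scale1r addrAC subrr add0r.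
  apply: v2; apply: (@subspaceZr _ _ _ (1 - a)) => //; first by rewrite subr_eq0 eq_sym.
  rewrite (_ : (1 - a) *: v = v + u - a *: v - u); last first.
    by rewrite scalerBl scale1r [v + u - _]addrAC addrK.
  by apply: subspaceB => //; apply: (flagS fU) Ua; lia.
- move/(flag_vertices_inj_at (i := i) fU fV2); rewrite (V2E _ nd1) (V2E _ nd2) => /(_ erefl erefl) e.
  by apply: w2; rewrite e V2i; exact: adjoin_mem.
Qed.

Lemma frame_perm f p : frame f -> affine_perm n p -> frame (f \o p).
Proof. by move=> ff ap k q /=; rewrite affine_permDn. Qed.

Lemma apartment_perm f p : affine_perm n p -> apartment (f \o p) = apartment f.
Proof.
move=> ap; have [p' [ap' pK p'K]] := affine_perm_inv n_ge2 ap.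
apply/seteqP; split=> A [A0 [U [r [fU ar aU AU]]]]; split=> //; exists U.
  by exists (p \o r); split=> //; exact: affine_perm_comp.
exists (p' \o r); split=> //; first exact: affine_perm_comp.
by move=> k; rewrite /= p'K; exact: aU.
Qed.

Lemma apartment_iso f g L p : frame f -> frame g -> full_flag L ->
  affine_perm n p -> adapted f p L -> adapted g id L ->
  exists psi, complex_iso (apartment f) (apartment g) psi /\
    forall v, vertices (apartment f) v -> vertices (apartment g) v -> psi v = v.
Proof.
move=> ff fg fL ap afL agL; rewrite -(apartment_perm f ap).
apply: (@complex_iso_common _ _ _ _ (coxeter_complex m) (retraction L)).
- exact: apartment_is_complex.
- exact: apartment_is_complex.
- by apply: apartment_coxeter => //; exact: frame_perm.
- exact: apartment_coxeter.
Qed.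

(** For simplices A and B common to two apartments, take chambers containing A in the first and B in
the second, and an apartment containing both chambers: it shares a chamber with each of the two. *)
Theorem full_complex_building (R : realType) : thick_affine_building R full_complex.
Proof.
split; [exact: full_complex_is_complex|exact: full_complex_thick|].
exists 'I_n, m, [set apartment f | f in
  [set f | frame f /\ exists L, full_flag L /\ adapted f id L]].
split; [exact: affine_matrix_coxeter|exact: affine_matrix_affine|].
have idp : affine_perm n id by split.
split.
- move=> _ [f [ff [L [fL aL]]] <-]; split.
    by split; [exact: apartment_is_complex|exact: apartment_sub].
  by exists (retraction L); exact: apartment_coxeter.
- apply/seteqP; split=> [A [A0 [U fU AU]]|A [_ [f [ff _] <-]]]; last exact: apartment_sub.
  have [f [ff aU]] := frame_exists fU.
  by exists (apartment f); [exists f => //; split=> //; exists U|split=> //; exists U, id].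
- move=> A B [A0 [U fU AU]] [B0 [V fV BV]].
  have [f [p [ff ap aU aV]]] := common_frame fU fV.
  exists (apartment f); split; first by exists f => //; split=> //; exists U.
    by split=> //; exists U, id.
  by split=> //; exists V, p.
- move=> _ _ A B [f [ff _] <-] [f' [ff' _] <-] SA SB S'A S'B.
  have mem h D v : apartment h D -> D v -> vertices (apartment h) v.
    by move=> hD Dv; have [_ _] := apartment_is_complex hD; apply=> [|_ ->//]; exists v.
  have [_ [U [p [fU ap afU AU]]]] := SA.
  have [_ [V [p' [fV ap' af'V BV]]]] := S'B.
  (* U contains A and gives a chamber of S, V contains B and gives one of S', and g spans an apartment
     with both. *)
  have [g [q [fg aq agU agV]]] := common_frame fU fV.
  have [r [ar qK rK]] := affine_perm_inv n_ge2 aq.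
  have gA : apartment g A by split; [case: SA|exists U, id].
  have gB : apartment g B by split; [case: SB|exists V, q].
  have [psi1 [iso1 fix1]] := apartment_iso ff fg fU ap afU agU.
  have [psi2 [iso2 fix2]] : exists psi, complex_iso (apartment g) (apartment f') psi /\
      forall v, vertices (apartment g) v -> vertices (apartment f') v -> psi v = v.
    (* Permuting the frame f' makes it adapted to V in the trivial order. *)
    rewrite -(apartment_perm f' ap').
    by apply: (apartment_iso fg (frame_perm ff' ap') fV aq agV).
  exists (psi2 \o psi1).
    by apply: complex_iso_comp iso1 iso2; exact: apartment_is_complex.
  move=> v [Av|Bv] /=.
    by rewrite fix1 ?fix2//; exact: mem Av.
  by rewrite fix1 ?fix2//; exact: mem Bv.
Qed.

End Class.
Section City.
Context (G : set (set E)).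
Context (G_sub : forall W, G W -> is_subspace W).
Context (G_rdim : forall W, G W -> rdim W (T 1 W) n).
Context (G_between : forall W M a b, G W -> is_subspace M -> T 1 M `<=` M ->
  T a W `<=` M -> M `<=` T b W -> G M).

Definition commensurable W : set (set E) :=
  [set M | G M /\ exists a b, T a W `<=` M /\ M `<=` T b W].

Lemma commensurable_refl W : G W -> commensurable W W.
Proof. by move=> GW; split=> //; exists 0, 0; rewrite translate0; split; exact: subset_refl. Qed.

Lemma commensurable_trans W M M' : G M' -> commensurable W M ->
  (exists a b, T a M `<=` M' /\ M' `<=` T b M) -> commensurable W M'.
Proof.
move=> GM' [GM [a [b [aM Mb]]]] [a' [b' [aM' Mb']]]; split=> //.
exists (a' + a), (b' + b); rewrite !translateD; split.
  exact: subset_trans (translateS aM) aM'.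
exact: subset_trans Mb' (translateS Mb).
Qed.

Lemma commensurable_comm W M M' : commensurable W M -> commensurable W M' ->
  exists a, T a M `<=` M'.
Proof.
move=> [_ [a [b [_ Mb]]]] [_ [a' [b' [aM' _]]]]; exists (a' - b); rewrite translateD.
by apply: subset_trans aM'; apply: translateS; rewrite -[W](translateK b); exact: translateS.
Qed.

Lemma flag_commensurable U j k : full_flag G U ->
  exists a b, T a (U j) `<=` U k /\ U k `<=` T b (U j).
Proof.
move=> fU; exists (`|j| + `|k|), (- (`|j| + `|k|)).
have nb : `|j| + `|k| <= (`|j| + `|k|) * n%:Z :> int.
  by rewrite ler_peMr ?addr_ge0//; lia.
by rewrite !(flag_translate fU); split; apply: (flagS fU); lia.
Qed.

Lemma rdim_chain W M d : is_subspace W -> rdim W M d -> exists h : nat -> set E,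
  [/\ h 0%N = W, h d = M, forall i, (i <= d)%N -> is_subspace (h i) &
  forall i, (i < d)%N -> covers (h i) (h i.+1)].
Proof.
move=> sW; elim=> {M d} [|M M' d r [h [h0 hd hs hc]] sM' c].
  by exists (fun=> W); split.
exists (fun i => if (i <= d)%N then h i else M'); split=> //.
- by rewrite ltnn.
- by move=> i _; case: ifP => // /hs.
- move=> i id1; have [->|ne] := eqVneq i d; first by rewrite leqnn ltnn hd.
  have id : (i < d)%N by lia.
  by rewrite (ltnW id) id; exact: hc.
Qed.

(** Refine every step of the chain to a chain of covers. The total length is n by uniqueness of
dimensions, which is what makes the periodic extension a flag. Stability under z is automatic
between c 0 and its translate. *)
Lemma chain_flag (c : nat -> set E) (l : nat) : (forall i, (i <= l)%N -> G (c i)) ->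
  (forall i, (i < l)%N -> c i.+1 `<=` c i) -> c l = T 1 (c 0%N) ->
  exists U, full_flag G U /\ forall i, (i <= l)%N -> exists k, U k = c i.
Proof.
move=> Gc cS cl.
have cle (i j : nat) : (i <= j)%N -> (j <= l)%N -> c j `<=` c i.
  move=> ij; elim: j ij => [|j IH]; first by rewrite leqn0 => /eqP -> _; exact: subset_refl.
  rewrite leq_eqVlt => /predU1P[-> _|ij jl]; first exact: subset_refl.
  by apply: subset_trans (cS _ jl) (IH ij (ltnW jl)).
have Gc0 : G (c 0%N) by exact: Gc.
have sc i : (i <= l)%N -> is_subspace (c i) by move=> /Gc/G_sub.
have step i : (i < l)%N -> exists d, rdim (c i) (c i.+1) d.
  move=> il; have := G_rdim Gc0; rewrite -cl => r.
  have [d1 [d2 [_ r2 _]]] := rdim_split (sc _ (leq0n l)) (sc _ (ltnW il)) r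
    (cle _ _ (ltnW il) (leqnn l)) (cle _ _ (leq0n i) (ltnW il)).
  have [d3 [d4 [r3 _ _]]] := rdim_split (sc _ (ltnW il)) (sc _ il) r2
    (cle _ _ il (leqnn l)) (cle _ _ (leqnSn i) il).
  by exists d3.
have refine (j : nat) : (j <= l)%N -> exists d (h : nat -> set E), [/\ h 0%N = c 0%N, h d = c j,
    forall i, (i < d)%N -> covers (h i) (h i.+1),
    forall i, (i <= d)%N -> is_subspace (h i) &
    (forall i, (i <= j)%N -> exists2 k, (k <= d)%N & h k = c i) /\ rdim (c 0%N) (c j) d].
  elim: j => [_|j IH jl].
    exists 0%N, (fun=> c 0%N); split=> //; first by move=> i _; exact: sc.
    split; last exact: rdim0.
    by move=> i; rewrite leqn0 => /eqP ->; exists 0%N.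
  have [d [h [h0 hd hc hs [hj r]]]] := IH (ltnW jl).
  have [d' r'] := step _ jl; have [g [g0 gd gs gc]] := rdim_chain (sc _ (ltnW jl)) r'.
  pose h' (i : nat) := if (i <= d)%N then h i else g (i - d)%N.
  have h'g i : h' (d + i)%N = g i.
    rewrite /h'; case: leqP; rewrite ?addKn// -{2}[d]addn0 leq_add2l leqn0 => /eqP ->.
    by rewrite addn0 hd g0.
  have h'h i : (i <= d)%N -> h' i = h i by rewrite /h' => ->.
  exists (d + d')%N, h'; split.
  - by rewrite h'h.
  - by rewrite h'g.
  - move=> i id; have [lt|ge] := ltnP i d; first by rewrite !h'h//; [exact: hc|exact: ltnW].
    by rewrite -(subnKC ge) -addnS !h'g; apply: gc; lia.
  - move=> i id; have [lt|ge] := ltnP i d; first by rewrite h'h; [apply: hs|]; exact: ltnW.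
    by rewrite -(subnKC ge) !h'g; apply: gs; lia.
  split; last exact: rdim_trans r r'.
  move=> i; rewrite leq_eqVlt => /predU1P[->|ij].
    by exists (d + d')%N => //; rewrite h'g.
  by have [k kd <-] := hj _ ij; exists k; rewrite ?h'h//; exact: leq_trans (leq_addr _ _).
have [d [h [h0 hd hc hs [hj r]]]] := refine l (leqnn l).
(* The chain now runs from c 0 to its translate in single steps: it is one period of a flag. *)
have dn : d = n by apply: rdim_uniq r _; [exact: sc|rewrite cl; exact: G_rdim].
rewrite {}dn in hd hc hs hj r.
have hle i : (i <= n)%N -> c l `<=` h i /\ h i `<=` c 0%N.
  have mono (j k : nat) : (j <= k)%N -> (k <= n)%N -> h k `<=` h j.
    move=> jk; elim: k jk => [|k IH]; first by rewrite leqn0 => /eqP -> _; exact: subset_refl.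
    rewrite leq_eqVlt => /predU1P[-> _|jk kn]; first exact: subset_refl.
    by apply: subset_trans (IH jk (ltnW kn)); have [] := hc _ kn.
  by move=> ij; rewrite -hd -h0; split; exact: mono.
have Gh i : (i <= n)%N -> G (h i).
  move=> /[dup] /hle[h1 h2] ij; apply: (@G_between (c 0%N) _ 1 0) => //.
  - exact: hs.
  - by apply: subset_trans (translateS h2) _; rewrite -cl.
  - by rewrite -cl.
  - by rewrite translate0.
have [U [Uh Uper]] := periodic_extension n_ge2 translateD translate0 (fun i : 'I_n => h i).
have Un (i : nat) : (i <= n)%N -> U i%:Z = h i.
  rewrite leq_eqVlt => /predU1P[->|lt]; last exact: (Uh (Ordinal lt)).
  have := Uper 0 1; rewrite add0r mul1r => ->.
  by rewrite hd cl -h0 (Uh (Ordinal (ltnW n_ge2))).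
exists U; split.
  split=> k.
  - have [i [q ->]] := ord_of_int n_ge2 k; rewrite Uper Uh.
    by apply: G_translate => //; apply: Gh; exact: ltnW.
  - have [i [q ->]] := ord_of_int n_ge2 k; rewrite addrAC !Uper; apply: covers_translate.
    have -> : i%:Z + 1 = i.+1%:Z by rewrite intS addrC.
    by rewrite !Un//; [exact: hc|exact: ltnW].
  - by have := Uper k 1; rewrite mul1r.
by move=> i /hj[k kn <-]; exists k%:Z; rewrite Un.
Qed.

Lemma t_add k u v : t k (u + v) = t k u + t k v.
Proof. by have := t_lin k 1 u v; rewrite !scale1r. Qed.

(** After a translation M is contained in W, and the lattices M + z^j W descend from W to M with
consecutive ones incident. *)
Lemma commensurable_connected W M : G W -> commensurable W M ->
  connected_to (full_complex G) (orb W) (orb M).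
Proof.
move=> GW [GM [a [b [aM Mb]]]]; rewrite -(orb_translate b W).
have GbW : G (T b W) by exact: G_translate.
have N1 : T (absz (a - b))%:Z (T b W) `<=` M.
  rewrite -translateD; apply: subset_trans aM.
  by apply: translate_stableS; [exact: G_stable G_rdim _ _|lia].
move: (T b W) GbW (absz _) N1 Mb => V GV N NM MV {GW aM}.
have sV := G_sub GV; have sM := G_sub GM.
pose c (j : nat) := sumset M (T j%:Z V).
have sc (j : nat) : is_subspace (c j) by apply: subspace_sum => //; exact: translate_subspace.
have TcS (j : nat) : T 1 (c j) `<=` c j.+1.
  move=> _ [_ [u Mu [v Vv <-]] <-]; rewrite t_add; exists (t 1 u).
    by apply: (G_stable G_rdim GM); exists u.
  by exists (t 1 v) => //; rewrite intS translateD; exists v.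
have cS (j : nat) : c j.+1 `<=` c j.
  apply: sumsetS; first exact: subset_refl.
  by apply: translate_stableS; [exact: G_stable G_rdim _ _|rewrite lez_nat].
have Gc (j : nat) : G (c j).
  apply: (@G_between V _ N%:Z 0) => //.
  - exact: subset_trans (TcS j) (cS j).
  - by apply: subset_trans NM _; apply: sumset_subl; exact: translate_subspace.
  - by rewrite translate0; apply: sumset_min => //; apply: translate_stable => //; exact: G_stable G_rdim _ _.
have c0 : c 0%N = V.
  rewrite /c translate0; apply/seteqP; split; last exact: sumset_subr.
  exact: (sumset_min sV MV (@subset_refl _ V)).
have cN : c N = M.
  apply/seteqP; split; last by apply: sumset_subl; exact: translate_subspace.
  exact: (sumset_min sM (@subset_refl _ M) NM).
rewrite -c0 -cN; elim: N {NM cN} => [|j IH]; first exact: connected_refl.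
apply: connected_step IH _.
pose h i := if i is 0 then c j else if i is 1 then c j.+1 else T 1 (c j).
have [||//|U [fU hU]] := @chain_flag h 2.
- by case=> [|[|i]] _ //=; apply: G_translate.
- by case=> [|[|i]] //= _; exact: cS.
have [k0 e0] := hU 0%N isT; have [k1 e1] := hU 1%N isT.
split; first by exists (orb (c j)); left.
by exists U => // B [->|->]; [exists k0; rewrite // e0|exists k1; rewrite // e1].
Qed.

(** Consecutive vertices of a path lie on one flag, and so stay commensurable. *)
Lemma full_complex_component W : G W ->
  component (full_complex G) (orb W) = full_complex (commensurable W).
Proof.
move=> GW.
have class_flag U k : full_flag G U -> commensurable W (U k) ->
    full_flag (commensurable W) U.
  move=> fU Uk; have [GU cU TU] := fU; split=> // j.
  by apply: commensurable_trans (GU j) Uk (flag_commensurable k j fU).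
have conn B : connected_to (full_complex G) (orb W) B ->
    exists2 M, commensurable W M & B = orb M.
  elim=> [|_ B' _ [M WM ->] [_ [U fU UB]]].
    by exists W => //; exact: commensurable_refl.
  have [k _ /esym ek] := UB _ (or_introl erefl).
  have [k' _ ek'] := UB _ (or_intror erefl).
  have [l el] := orb_flag fU ek; rewrite {}el in WM.
  have [GU _ _] := fU; exists (U k') => //.
  exact: commensurable_trans (GU k') WM (flag_commensurable l k' fU).
apply/seteqP; split=> A.
  move=> [[[B AB] [U fU AU]] Ac]; split; first by exists B.
  exists U => //; have [k _ ek] := AU _ AB; have [M WM eM] := conn _ (Ac _ AB).
  rewrite eM in ek; have [l el] := orb_flag fU (esym ek).
  by apply: (class_flag U l fU); rewrite -el.
move=> [A0 [U fU AU]]; have [GU cU TU] := fU; split.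
  by split=> //; exists U => //; split=> // k; case: (GU k).
by move=> B /AU[k _ <-]; exact: commensurable_connected.
Qed.

Theorem full_complex_city (R : realType) : affine_city R (full_complex G).
Proof.
split; first exact: full_complex_is_complex.
move=> v [_ [U fU /(_ _ erefl)[k _ <-]]]; have [GU _ _] := fU.
rewrite full_complex_component//; apply: full_complex_building.
- by move=> M [/G_sub].
- by move=> M [/G_rdim].
- move=> M M' a b [GM UM] sM' TM' aM' M'b.
  apply: commensurable_trans (conj GM UM) _; last by exists a, b.
  exact: G_between aM' M'b.
- by move=> M M'; exact: commensurable_comm.
Qed.

Definition periodic_flag U : Prop := [/\ forall k, G (U k),
  forall k, U (k + 1) `<=` U k & forall k, T 1 (U k) = U (k + n%:Z)].

(** The sub-flag is indexed by sending k to the last place up to k of a member whose orbit is in A. *)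
Lemma subflag U (A : set (set (set E))) : full_flag G U -> A !=set0 ->
  A `<=` flag_vertices U -> exists V, periodic_flag V /\
  A = [set orb W | W in G] `&` [set B | B `<=` range V].
Proof.
move=> fU [B0 AB0] AU; have [GU _ TU] := fU.
pose S k := A (orb (U k)).
have Sn k q : S k -> S (k + q * n%:Z) by rewrite /S -(flag_translate fU) orb_translate.
have [k0 _ ek0] := AU _ AB0.
have Sk0 : S k0 by rewrite /S ek0.
have /choice[r rP] : forall k, exists s, [/\ S s, s <= k & forall s', S s' -> s' <= k -> s' <= s].
  move=> k; have [||j [[s [Ss js sk]] nj]] :=
      @int_jump (fun j => exists s, [/\ S s, j <= s & s <= k])
        (k0 - (`|k0| + `|k|) * n%:Z) (k + 1).
  - exists (k0 - (`|k0| + `|k|) * n%:Z); split=> //; first by rewrite -mulNr; exact: Sn.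
    have : `|k0| + `|k| <= (`|k0| + `|k|) * n%:Z :> int.
      by rewrite ler_peMr ?addr_ge0//; lia.
    by lia.
  - by move=> j kj [s [_ js sk]]; lia.
  - exists s; split=> // s' Ss' s'k; rewrite leNgt; apply/negP => ss'.
    by apply: nj; exists s'; split=> //; lia.
have rn k : r (k + n%:Z) = r k + n%:Z.
  have [S1 l1 m1] := rP k; have [S2 l2 m2] := rP (k + n%:Z).
  apply/eqP; rewrite eq_le; apply/andP; split.
    have := m1 _ (Sn _ (-1) S2); rewrite mulN1r; lia.
  by apply: m2; [have := Sn _ 1 S1; rewrite mul1r|rewrite lerD2r].
have rS k : r k <= r (k + 1).
  have [S1 l1 m1] := rP k; have [S2 l2 m2] := rP (k + 1).
  by apply: m2 => //; lia.
have rid k : S k -> r k = k.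
  by move=> Sk; have [S1 l1 m1] := rP k; have := m1 _ Sk (lexx k); lia.
exists (U \o r); split.
  split=> k /=; [exact: GU|exact: (flagS fU (rS k))|by rewrite TU rn].
apply/seteqP; split=> [B AB|_ [[W GW <-]] sub].
  have [k _ eB] := AU _ AB; split; first by exists (U k).
  rewrite -eB => _ [q _ <-]; exists (k + q * n%:Z) => //=.
  by rewrite (flag_translate fU) rid//; apply: Sn; rewrite /S eB.
have [k _ /= <-] := sub _ (orb_refl W).
by have [] := rP k.
Qed.

Lemma periodic_complexE :
  [set [set orb W | W in G] `&` [set B | B `<=` F] | F in [set range V | V in periodic_flag]] =
  full_complex G.
Proof.
apply/seteqP; split; last first.
  move=> A [A0 [U fU AU]]; have [V [pV eA]] := subflag fU A0 AU.
  by exists (range V); [exists V|].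
move=> _ [_ [V pV <-] <-]; have [GV VS VT] := pV.
have [||U [fU hU]] := @chain_flag (fun i => V i%:Z) n (fun i _ => GV i%:Z).
- by move=> i _; rewrite intS addrC; exact: VS.
- by rewrite VT add0r.
split.
  exists (orb (V 0)); split; first by exists (V 0).
  by move=> _ [q _ <-]; exists (0 + q * n%:Z); rewrite // periodic_translate.
exists U => // _ [[W GW <-] /(_ _ (orb_refl W))[k _ <-]].
have [i [q ->]] := ord_of_int n_ge2 k.
have [l el] := hU i (ltnW (ltn_ord i)).
by exists l; rewrite // el -periodic_translate// orb_translate.
Qed.

End City.
End Flags.

(** * Finite extensions of closed subspaces *)

Section FiniteExtensions.
Context (K : numFieldType) (V : normedModType K).
Context (bounded_compact : forall r : K, exists2 D : set K, compact D &
  forall c : K, `|c| <= r -> D c).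
Implicit Types (A : set V) (u v x : V) (c r : K).

Lemma closure_normP A x : closure A x <-> forall e : K, 0 < e -> exists2 a, A a & `|x - a| < e.
Proof.
split=> [h e e0|h B /nbhs_normP[e /= e0 eB]].
  have [|a [Aa /= xa]] := h [set a | `|x - a| < e]; last by exists a.
  by apply/nbhs_normP; exists e.
by have [a Aa xa] := h e e0; exists a; split=> //; exact: eB.
Qed.

(** The constant d is the distance from v to A. *)
Lemma adjoin_coef_bound A v : is_subspace A -> closed A -> ~ A v ->
  exists2 d : K, 0 < d & forall a c, A a -> `|c| * d <= `|a + c *: v|.
Proof.
move=> sA cA nAv.
have [e e0 he] : exists2 e : K, 0 < e & forall a, A a -> ~ `|v - a| < e.
  apply: contrapT => nex; apply/nAv/cA/closure_normP => e e0.
  apply: contrapT => nea; apply: nex; exists e => // a Aa h; apply: nea; by exists a.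
exists e => // a c Aa; have [->|c0] := eqVneq c 0; first by rewrite normr0 mul0r.
have -> : a + c *: v = c *: (v - - (c^-1 *: a)).
  by rewrite opprK scalerDr scalerA divff// scale1r addrC.
have le : e <= `|v - - (c^-1 *: a)|.
  rewrite real_leNgt; [|exact: gtr0_real|exact: normr_real].
  by apply/negP; apply: he; apply: subspaceN => //; exact: subspaceZ.
by rewrite normrZ ler_pM2l ?normr_gt0.
Qed.

(** The coefficients of v in a convergent family stay in a compact set. *)
Lemma adjoin_closed A v : is_subspace A -> closed A -> closed (adjoin A v).
Proof.
move=> sA cA; have [Av|nAv] := pselect (A v).
  suff -> : adjoin A v = A by [].
  by apply/seteqP; split; [exact: adjoin_min|exact: adjoin_sub].
have [d d0 hd] := adjoin_coef_bound sA cA nAv.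
move=> x /closure_normP cx.
pose near_coef (e : K) : set K := [set c | exists2 a, A a & `|x - (a + c *: v)| < e].
pose F : set_system K := [set S | exists2 e : K, 0 < e & near_coef e `<=` S].
have ne e : 0 < e -> near_coef e !=set0.
  move=> /cx[y [c Ac] h]; exists c, (y - c *: v) => //; by rewrite subrK.
have FF : ProperFilter F.
  split; first by move=> [e /ne[c hc] /(_ _ hc)].
  split; first by exists 1.
  - move=> P Q [e e0 eP] [e' e'0 eQ]; have /orP[ee|ee] := real_leVge (gtr0_real e0) (gtr0_real e'0).
      exists e => // c [a Aa h]; split; [by apply: eP; exists a|apply: eQ; exists a => //].
      exact: lt_le_trans ee.
    exists e' => // c [a Aa h]; split; [apply: eP; exists a => //|by apply: eQ; exists a].
    exact: lt_le_trans ee.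
  - by move=> P Q PQ [e e0 eP]; exists e => //; exact: subset_trans PQ.
have [D cD hD] := bounded_compact ((`|x| + 1) / d).
have FD : F D.
  exists 1 => // c [a Aa h]; apply: hD; rewrite ler_pdivlMr//.
  apply: le_trans (hd _ _ Aa) _.
  rewrite -[a + _](subKr x); apply: le_trans (ler_normB _ _) _.
  by rewrite lerD2l ltW.
have [c [_ cc]] := cD F FF FD; exists c; apply: cA; apply/closure_normP => e e0.
have e20 : 0 < e / 2 by rewrite divr_gt0.
have v10 : 0 < `|v| + 1 by rewrite ltr_wpDl.
have [||c' [[a Aa h1] /= h2]] := cc (near_coef (e / 2)) (ball c (e / 2 / (`|v| + 1))).
- by exists (e / 2).
- by apply: nbhsx_ballx; rewrite divr_gt0.
exists a => //; have -> : x - c *: v - a = (x - (a + c' *: v)) - (c - c') *: v.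
  by rewrite scalerBl opprD opprB !addrA subrK addrAC.
apply: le_lt_trans (ler_normB _ _) _; rewrite [ltRHS](splitr e) ltr_leD//.
rewrite normrZ; have {}h2 : `|c - c'| < e / 2 / (`|v| + 1) by [].
have h3 : `|v| <= `|v| + 1 by rewrite lerDl.
apply: le_trans (ler_pM _ _ (ltW h2) h3) _ => //.
by rewrite divfK// gt_eqF.
Qed.

Lemma compact_closure_sub (A D : set V) : compact D -> A `<=` D -> compact (closure A).
Proof.
move=> cD AD; apply: (subclosed_compact _ cD); first exact: closed_closure.
have cl : closed D by apply: compact_closed cD; exact: norm_hausdorff.
by move=> x /(closure_subset AD)/cl.
Qed.

Lemma compact_onS (P : V -> V) (A B : set V) : A `<=` B -> compact_on P B -> compact_on P A.
Proof.
move=> AB cB; apply: (compact_closure_sub cB); apply: subset_trans (@subset_closure _ _).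
by apply: image_subset => u [Au u1]; split=> //; exact: AB.
Qed.

(** P stands for an orthogonal projection, which is linear on the subspace S where it exists and 0
elsewhere. If the extension meets S in a vector outside A, this vector replaces v; otherwise
nothing new is projected. *)
Lemma adjoin_compact (P : V -> V) (S : set V) A v :
  is_subspace S -> (forall (a : K) u w, S u -> S w -> P (a *: u + w) = a *: P u + P w) ->
  (forall u, ~ S u -> P u = 0) ->
  is_subspace A -> closed A -> compact_on P A -> compact_on P (adjoin A v).
Proof.
move=> sS Pl P0 sA cA coA; have P00 : P 0 = 0.
  by have := Pl (-1) 0 0 (proj1 sS) (proj1 sS); rewrite scaler0 addr0 scaleN1r addNr.
have [[w [vw Sw nAw]]|nex] :=
  pselect (exists w, [/\ adjoin A v w, S w & ~ A w]); last first.
  apply: (compact_closure_sub coA) => _ [u [vu u1] <-]; apply: subset_closure.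
  have [Su|nSu] := pselect (S u); last first.
    by exists 0; [split; [case: sA|rewrite normr0]|rewrite P00 P0].
  by exists u => //; split=> //; apply: contrapT => nAu; apply: nex; exists u.
have nAv : ~ A v.
  by move=> Av; apply: nAw; apply: (adjoin_min sA _ Av vw).
have -> : adjoin A v = adjoin A w.
  apply/seteqP; split; last first.
    by apply: adjoin_min => //; [exact: subspace_adjoin|exact: adjoin_sub].
  exact: covers_gen (subspace_adjoin v sA) sA (covers_adjoin sA nAv) vw nAw.
have [d d0 hd] := adjoin_coef_bound sA cA nAw.
have [D cD hD] := bounded_compact d^-1.
pose s : K := 1 + d^-1 * `|w|.
have s0 : 0 < s by rewrite ltr_wpDr// mulr_ge0// invr_ge0 ltW.
pose Phi (xc : V * K^o) : V := s *: xc.1 + xc.2 *: P w.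
have cPhi : compact (Phi @` (closure (P @` [set u | A u /\ `|u| <= 1]) `*` D)).
  apply: continuous_compact; last exact: compact_setX.
  apply: continuous_subspaceT => xc.
  apply: cvgD; first by apply: cvgZr; exact: cvg_fst.
  by apply: cvgZl; exact: cvg_snd.
apply: (compact_closure_sub cPhi) => _ [u [[c Ac] u1] <-].
set a := u - c *: w in Ac; have ue : u = a + c *: w by rewrite subrK.
have c1 : `|c| <= d^-1.
  by rewrite -[leRHS]mul1r ler_pdivlMr//; apply: le_trans (hd _ _ Ac) _; rewrite -ue.
have a1 : `|a| <= s.
  apply: le_trans (ler_normB _ _) _; rewrite lerD// normrZ.
  by rewrite ler_wpM2r.
have [Sa|nSa] := pselect (S a).
  exists (P (s^-1 *: a), c); last first.
    rewrite /Phi /= -[s^-1 *: a]addr0 Pl//; last by case: sS.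
    rewrite P00 addr0 scalerA divff ?gt_eqF// scale1r.
    have -> : P u = P (c *: w + a) by rewrite addrC -ue.
    by rewrite Pl// addrC.
  split=> /=; last exact: hD.
  apply: subset_closure; exists (s^-1 *: a) => //; split; first exact: subspaceZ.
  by rewrite normrZ [`|s^-1|]gtr0_norm ?invr_gt0// ler_pdivrMl// mulr1.
have nSu : ~ S u.
  move=> Su; apply: nSa; rewrite /a; apply: subspaceB => //; exact: subspaceZ.
exists (P 0, 0); last by rewrite /Phi /= P00 scaler0 scale0r addr0 P0.
split=> /=; last by apply: hD; rewrite normr0 invr_ge0 ltW.
by apply: subset_closure; exists 0 => //; split; [case: sA|rewrite normr0].
Qed.

Lemma rdim_closed_compact (P : V -> V) (S A B : set V) d :
  is_subspace S -> (forall (a : K) u w, S u -> S w -> P (a *: u + w) = a *: P u + P w) ->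
  (forall u, ~ S u -> P u = 0) ->
  is_subspace B -> rdim B A d -> closed A -> compact_on P A ->
  closed B /\ compact_on P B.
Proof.
move=> sS Pl P0 sB; elim=> {A d} [//|M A d r IH sA c cA coA].
have sM := rdim_subspace r sB.
have [AM [v [Mv nAv vg]]] := c.
have e : M = adjoin A v.
  by apply/seteqP; split; [exact: vg|exact: (adjoin_min sM AM Mv)].
by apply: IH; rewrite e; [exact: adjoin_closed|exact: (adjoin_compact sS Pl P0 sA cA coA)].
Qed.

End FiniteExtensions.

Section ComplexDiscs.
Context (R : realType).
Local Notation C := R[i].
Local Open Scope complex_scope.

Lemma continuous_complex : continuous (fun x : R * R => (x.1%:C + 'i * x.2%:C : C^o)).
Proof.
have cC : continuous (fun x : R => (x%:C : C^o)).
  move=> x; apply/cvgrPdist_lt => e e0.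
  have ee : e = (complex.Re e)%:C by case: e e0 => a b; rewrite ltcE /= => /andP[/eqP ->].
  rewrite ee ltcR in e0.
  apply/nbhs_normP; exists (complex.Re e) => //= y /= h.
  rewrite -rmorphB /= normc_def /= expr0n /= addr0 sqrtr_sqr.
  by rewrite ee ltcR.
move=> x; apply: cvgD.
  by apply: (@cvg_comp _ _ _ fst (fun y : R => (y%:C : C^o))); [exact: cvg_fst|exact: cC].
apply: cvgM; first exact: cvg_cst.
by apply: (@cvg_comp _ _ _ snd (fun y : R => (y%:C : C^o))); [exact: cvg_snd|exact: cC].
Qed.

Lemma complex_bounded_compact (r : C) :
  exists2 D : set C, compact (D : set C^o) & forall c : C, `|c| <= r -> D c.
Proof.
pose I : set R := `[(- complex.Re r), (complex.Re r)]%classic.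
have cI : compact I by exact: segment_compact.
exists ((fun x : R * R => (x.1%:C + 'i * x.2%:C : C^o)) @` (I `*` I)).
  apply: continuous_compact; last exact: compact_setX.
  exact: continuous_subspaceT continuous_complex.
move=> [a b] h; exists (a, b); last first.
  by rewrite /=; simpc.
have : Num.sqrt (a ^+ 2 + b ^+ 2) <= complex.Re r.
  by move: h; rewrite normc_def lecE => /andP[].
have le x y : `|x| <= Num.sqrt (x ^+ 2 + y ^+ 2).
  by rewrite -sqrtr_sqr ler_wsqrtr// lerDl sqr_ge0.
move=> h'; split; rewrite /I /= in_itv /= -ler_norml; apply: le_trans h'; first exact: le.
by rewrite addrC; exact: le.
Qed.

End ComplexDiscs.

(** * Integrals on the circle *)

Local Open Scope complex_scope.
Local Open Scope quotient_scope.

Local Notation Re := complex.Re.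
Local Notation Im := complex.Im.

Section CircleIntegral.
Context {R : realType}.
Local Notation C := R[i].
Local Notation circle := (@circle R).
Local Notation L2R := (Lfun circle 2%:E).
Implicit Types (F G : R -> C) (f g : R -> R).

Definition rintegrable f : Prop := circle.-integrable [set: measurableTypeR R] (EFin \o f).

Definition cintegrable F : Prop :=
  rintegrable (fun t => Re (F t)) /\ rintegrable (fun t => Im (F t)).

Lemma rintegrableD f g : rintegrable f -> rintegrable g -> rintegrable (fun t => f t + g t).
Proof. by move=> If Ig; apply: (integrableD _ If Ig). Qed.

Lemma rintegrableZ (a : R) f : rintegrable f -> rintegrable (fun t => a * f t).
Proof. by move=> If; apply: (integrableZl _ a If). Qed.

Lemma ReD : {morph (@complex.Re R) : x y / x + y}. Proof. by case=> ? ? []. Qed.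
Lemma ImD : {morph (@complex.Im R) : x y / x + y}. Proof. by case=> ? ? []. Qed.

Lemma ReM (x y : C) : Re (x * y) = Re x * Re y - Im x * Im y.
Proof. by case: x y => ? ? []. Qed.

Lemma ImM (x y : C) : Im (x * y) = Re x * Im y + Im x * Re y.
Proof. by case: x y => ? ? []. Qed.

Lemma ReJ (x : C) : Re (x^*) = Re x. Proof. by case: x. Qed.
Lemma ImJ (x : C) : Im (x^*) = - Im x. Proof. by case: x. Qed.

Lemma complex_ext (x y : C) : Re x = Re y -> Im x = Im y -> x = y.
Proof. by case: x y => ? ? [? ?] /= -> ->. Qed.

Lemma rintegral_lin (a b : R) f g h : rintegrable f -> rintegrable g -> rintegrable h ->
  \int[circle]_t (a * f t + b * g t + h t) =
  a * \int[circle]_t f t + b * \int[circle]_t g t + \int[circle]_t h t.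
Proof.
move=> If Ig Ih; rewrite RintegralD//; last first.
  by apply: rintegrableD; exact: rintegrableZ.
by rewrite RintegralD ?RintegralZl//; exact: rintegrableZ.
Qed.

Lemma cintegrable_lin (a : C) F G : cintegrable F -> cintegrable G ->
  cintegrable (fun t => a * F t + G t).
Proof.
move=> [rF jF] [rG jG]; split.
  rewrite (_ : (fun t => _) = (fun t => Re a * Re (F t) + - Im a * Im (F t) + Re (G t))).
    by do !apply: rintegrableD => //; exact: rintegrableZ.
  by apply/funext => t; rewrite ReD ReM mulNr.
rewrite (_ : (fun t => _) = (fun t => Re a * Im (F t) + Im a * Re (F t) + Im (G t))).
  by do !apply: rintegrableD => //; exact: rintegrableZ.
by apply/funext => t; rewrite ImD ImM.
Qed.

Lemma circle_int_lin (a : C) F G : cintegrable F -> cintegrable G ->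
  circle_int (fun t => a * F t + G t) = a * circle_int F + circle_int G.
Proof.
move=> [rF jF] [rG jG]; apply: complex_ext.
  rewrite ReD ReM /= -mulNr -rintegral_lin//; apply: eq_Rintegral => t _.
  by rewrite ReD ReM mulNr.
rewrite ImD ImM /= -rintegral_lin//; apply: eq_Rintegral => t _.
by rewrite ImD ImM.
Qed.

Lemma circle_intJ F : cintegrable F -> circle_int (fun t => (F t)^*) = (circle_int F)^*.
Proof.
move=> [_ jF]; apply: complex_ext => /=; first by apply: eq_Rintegral => t _; rewrite ReJ.
rewrite -[RHS]mulN1r -RintegralZl//.
by apply: eq_Rintegral => t _; rewrite ImJ mulN1r.
Qed.

(** Elements of L2 are handled through representatives, so integrals are compared almost everywhere. *)
Lemma circle_int_ae F G : cintegrable F -> cintegrable G ->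
  {ae circle, forall t, F t = G t} -> circle_int F = circle_int G.
Proof.
move=> [rF jF] [rG jG] FG; apply: complex_ext => /=; congr fine; apply: ae_eq_integral => //.
- exact: (measurable_int _ rF).
- exact: (measurable_int _ rG).
- by move: FG; apply: (@filterS (measurableTypeR R)) => t -> _.
- exact: (measurable_int _ jF).
- exact: (measurable_int _ jG).
- by move: FG; apply: (@filterS (measurableTypeR R)) => t -> _.
Qed.

Lemma cintegrable0 : cintegrable (fun=> 0).
Proof.
have I0 : rintegrable (fun=> 0).
  by apply: (finite_measure_integrable_cst _ 0).
by split.
Qed.

Lemma cintegrable_sum (I : finType) (F : I -> R -> C) : (forall i, cintegrable (F i)) ->
  cintegrable (fun t => \sum_i F i t) /\
  circle_int (fun t => \sum_i F i t) = \sum_i circle_int (F i).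
Proof.
move=> IF; elim: (index_enum I) => [|i s [h1 h2]].
  split.
    by under eq_fun do rewrite big_nil; exact: cintegrable0.
  under eq_fun do rewrite big_nil.
  rewrite big_nil /circle_int; apply: complex_ext => /=.
    by rewrite Rintegral_cst// mul0r.
  by rewrite Rintegral_cst// mul0r.
have e : (fun t => \sum_(j <- i :: s) F j t) = (fun t => 1 * F i t + \sum_(j <- s) F j t).
  by apply/funext => t; rewrite big_cons mul1r.
rewrite e; split; first exact: cintegrable_lin.
by rewrite circle_int_lin// h2 mul1r big_cons.
Qed.

Lemma cintegrable_mulJ F G : (fun t => Re (F t)) \in L2R -> (fun t => Im (F t)) \in L2R ->
  (fun t => Re (G t)) \in L2R -> (fun t => Im (G t)) \in L2R ->
  cintegrable (fun t => F t * (G t)^*).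
Proof.
move=> rF jF rG jG; split.
  rewrite (_ : (fun t => _) = (fun t => Re (F t) * Re (G t) + Im (F t) * Im (G t))).
    by apply: rintegrableD; exact: L2R_prod.
  by apply/funext => t; rewrite ReM ReJ ImJ mulrN opprK.
rewrite (_ : (fun t => _) = (fun t => (- 1) * (Re (F t) * Im (G t)) + Im (F t) * Re (G t))).
  by apply: rintegrableD; [apply: rintegrableZ|]; exact: L2R_prod.
by apply/funext => t; rewrite ImM ReJ ImJ mulrN mulN1r.
Qed.

Lemma cintegrable_L2 F : (fun t => Re (F t)) \in L2R -> (fun t => Im (F t)) \in L2R ->
  cintegrable F.
Proof.
move=> rF jF; split.
  by have := L2R_prod rF (L2R_cst 1); congr (_.-integrable _ _); apply/funext => t /=; rewrite mulr1.
by have := L2R_prod jF (L2R_cst 1); congr (_.-integrable _ _); apply/funext => t /=; rewrite mulr1.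
Qed.

(** The integral of the nonnegative function 1 + f is computed by the fundamental theorem of calculus:
the periodic part Phi of its primitive contributes nothing, and the part t gives 1. *)
Lemma circle_mean_eq0 f (Phi : R -> R) : (forall t, -1 <= f t) -> continuous f ->
  rintegrable f -> (forall t : R, is_derive t 1 Phi (f t)) -> Phi (2 * pi) = Phi 0 ->
  \int[circle]_t f t = 0.
Proof.
move=> f1 cf If dPhi e.
have I1 : rintegrable (fun=> 1) by apply: (finite_measure_integrable_cst _ 1).
have d1 (t : R) : is_derive t 1 (fun t => t + Phi t) (1 + f t) by exact: is_deriveD.
have c1 : continuous (fun t : R => 1 + f t).
  by move=> t; apply: cvgD; [exact: cvg_cst|exact: cf].
have cPhi : continuous (fun t : R => t + Phi t).
  move=> t; apply: differentiable_continuous; apply/derivable1_diffP.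
  by have [] := d1 t.
have : \int[circle]_t (1 + f t) = 1.
  rewrite /Rintegral integral_uniform; last 2 first.
  - by apply/measurable_EFinP; exact: continuous_measurable_fun.
  - by move=> t; rewrite lee_fin -lerBlDl sub0r.
  rewrite (@continuous_FTC2 _ _ (fun t => t + Phi t)) ?two_pi_gt0//.
  - rewrite e -EFinB opprD addrACA subrr addr0 -EFinM mulVf// gt_eqF// subr0.
    exact: two_pi_gt0.
  - exact: continuous_subspaceT.
  - split.
    + by move=> t _; have [] := d1 t.
    + exact/cvg_at_right_filter/cPhi.
    + exact/cvg_at_left_filter/cPhi.
  - by move=> t _; rewrite derive1E; have [_ ->] := d1 t.
have P1 : circle [set: measurableTypeR R] = 1%E by exact: probability_setT.
rewrite RintegralD// Rintegral_cst// (_ : fine _ = 1); last by rewrite -[RHS]/(fine 1%E) -P1.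
rewrite mulr1 => /eqP.
by rewrite -subr_eq0 addrAC subrr add0r => /eqP.
Qed.

Lemma zeta_bound (k : int) (t : R) : (Re (zeta t ^ k)) ^+ 2 + (Im (zeta t ^ k)) ^+ 2 = 1.
Proof. by rewrite zetaX cos2Dsin2. Qed.

Lemma continuous_zeta (k : int) : continuous (fun t : R => cos (k%:~R * t)) /\
  continuous (fun t : R => sin (k%:~R * t)).
Proof.
have h (t : R) : {for t, continuous (fun t : R => k%:~R * t)}.
  by apply: cvgM; [exact: cvg_cst|exact: cvg_id].
by split=> t; apply: continuous_comp => //; [exact: continuous_cos|exact: continuous_sin].
Qed.

Lemma zeta_L2 (k : int) : (fun t : R => Re (zeta t ^ k)) \in L2R /\
  (fun t : R => Im (zeta t ^ k)) \in L2R.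
Proof.
have [cc cs] := continuous_zeta k.
have le1 (x y : R) : x ^+ 2 + y ^+ 2 = 1 -> (`|x| <= 1)%R.
  by move=> xy; rewrite ler_norml; apply/andP; split; nra.
have bnd (g : R -> R) : continuous g -> (forall t, `|g t| <= 1) -> g \in L2R.
  move=> cg g1; have -> : g = (fun t => g t * 1) by apply/funext => t; rewrite mulr1.
  by apply: L2RM (L2R_cst 1) => //; exact: continuous_measurable_fun.
split; apply: bnd => [|t].
- by rewrite (_ : (fun t => _) = (fun t => cos (k%:~R * t)))//; apply/funext => t; rewrite zetaX.
- exact: le1 (zeta_bound k t).
- by rewrite (_ : (fun t => _) = (fun t => sin (k%:~R * t)))//; apply/funext => t; rewrite zetaX.
- by apply: (le1 _ (Re (zeta t ^ k))); rewrite addrC zeta_bound.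
Qed.

Lemma circle_int_zeta (k : int) : k != 0 -> circle_int (fun t : R => zeta t ^ k) = 0.
Proof.
move=> k0; have kR : k%:~R != 0 :> R by rewrite intr_eq0.
have per : (cos (k%:~R * (2 * pi)) = 1 :> R) /\ (sin (k%:~R * (2 * pi)) = 0 :> R).
  have h (m : nat) : (cos (m%:R * (2 * pi)) = 1 :> R) /\ (sin (m%:R * (2 * pi)) = 0 :> R).
    elim: m => [|m [h1 h2]]; first by rewrite mulr0n mul0r cos0 sin0.
    rewrite -natr1 mulrDl mul1r cosD sinD h1 h2.
    by rewrite mulr_natl cos2pi sin2pi !mulr1 !mulr0 subr0 addr0.
  case: k {k0 kR} => m; first exact: h.
  have [h1 h2] := h m.+1.
  by rewrite NegzE mulrNz mulNr cosN sinN h1 h2 oppr0.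
have [c1 s1] := per; have [cc cs] := continuous_zeta k.
have dlin (t : R) : is_derive t 1 (fun t : R => k%:~R * t) (k%:~R : R).
  have : is_derive t 1 (k%:~R \*: (id : R -> R)) (k%:~R *: (1 : R)) by exact: is_deriveZ.
  by rewrite /GRing.scale /= mulr1.
have [zr zi] := cintegrable_L2 (zeta_L2 k).1 (zeta_L2 k).2.
apply: complex_ext => /=.
  apply: (@circle_mean_eq0 _ (fun t => k%:~R^-1 * sin (k%:~R * t))) => //.
  - by move=> t; rewrite zetaX /= cos_geN1.
  - by rewrite (_ : (fun t => _) = (fun t => cos (k%:~R * t)))//; apply/funext => t; rewrite zetaX.
  - move=> t; rewrite zetaX /=.
    have d : is_derive t 1 (k%:~R^-1 \*: (sin \o (fun t => k%:~R * t)))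
      (k%:~R^-1 *: (cos (k%:~R * t) * k%:~R)) by exact: is_deriveZ.
    by move: d; rewrite /GRing.scale /= [cos _ * _]mulrC mulKf.
  - by rewrite s1 !mulr0 sin0 mulr0.
apply: (@circle_mean_eq0 _ (fun t => - k%:~R^-1 * cos (k%:~R * t))) => //.
- by move=> t; rewrite zetaX /= sin_geN1.
- by rewrite (_ : (fun t => _) = (fun t => sin (k%:~R * t)))//; apply/funext => t; rewrite zetaX.
- move=> t; rewrite zetaX /=.
  have d : is_derive t 1 (- k%:~R^-1 \*: (cos \o (fun t => k%:~R * t)))
    (- k%:~R^-1 *: (- sin (k%:~R * t) * k%:~R)) by exact: is_deriveZ.
  by move: d; rewrite /GRing.scale /= !mulNr mulrN opprK [sin _ * _]mulrC mulKf.
- by rewrite c1 !mulr0 cos0.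
Qed.

Lemma circle_int_cst (c : C) : circle_int (fun=> c) = c.
Proof.
have P1 : circle [set: measurableTypeR R] = 1%E by exact: probability_setT.
apply: complex_ext => /=.
  by rewrite Rintegral_cst// (_ : fine _ = 1) ?mulr1// -[RHS]/(fine 1%E) -P1.
by rewrite Rintegral_cst// (_ : fine _ = 1) ?mulr1// -[RHS]/(fine 1%E) -P1.
Qed.

End CircleIntegral.

(** * The Hilbert space *)

Section HilbertSpace.
Context (R : realType) (n : nat).
Local Notation C := R[i].
Local Notation H := (L2 R n).
Local Notation circle := (@circle R).
Local Notation L2R := (Lfun circle 2%:E).
Implicit Types (u v w h : H) (a b : C) (k j : int).

Lemma aeS2 (P Q S : R -> Prop) : (forall t, P t -> Q t -> S t) ->
  {ae circle, forall t, P t} -> {ae circle, forall t, Q t} -> {ae circle, forall t, S t}.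
Proof. by move=> h; apply: (@filterS2 (measurableTypeR R)). Qed.

Lemma aeS1 (P Q : R -> Prop) : (forall t, P t -> Q t) ->
  {ae circle, forall t, P t} -> {ae circle, forall t, Q t}.
Proof. by move=> h; apply: (@filterS (measurableTypeR R)). Qed.

Lemma L2rep_pi (f : L2fun R n) : {ae circle, forall t, L2rep (\pi_(L2 R n) f) t = f t}.
Proof. by apply/L2_eqP; rewrite reprK. Qed.

Lemma L2_ext u v : {ae circle, forall t, L2rep u t = L2rep v t} -> u = v.
Proof. by move=> /L2_eqP/eqP; rewrite !reprK. Qed.

Lemma L2rep_lin a u v :
  {ae circle, forall t, L2rep (a *: u + v) t = a *: L2rep u t + L2rep v t}.
Proof.
have -> : a *: u + v = \pi_(L2 R n) (a *: repr u + repr v).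
  by rewrite pi_addr pi_L2scale !reprK.
exact: L2rep_pi.
Qed.

Lemma L2rep_coord u i : (fun t => Re (L2rep u t i 0)) \in L2R /\
  (fun t => Im (L2rep u t i 0)) \in L2R.
Proof. by have /forallP/(_ i)/andP[] := valP (repr u). Qed.

Lemma zmul_lin k a u v : zmul k (a *: u + v) = a *: zmul k u + zmul k v.
Proof.
apply: L2_ext.
have h1 := zmulE k (a *: u + v); have h2 := L2rep_lin a u v.
have h3 := L2rep_lin a (zmul k u) (zmul k v).
have h4 := zmulE k u; have h5 := zmulE k v.
apply: aeS2 (aeS2 (fun t => @conj _ _) h1 h2) (aeS2 (fun t => @conj _ _) h3 (aeS2 (fun t => @conj _ _) h4 h5)).
move=> {h1 h2 h3 h4 h5} t [h1 h2] [h3 [h4 h5]].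
have aux (z : C) (x y r s p q : 'cV[C]_n) : x = z *: y -> y = a *: p + q ->
    r = a *: s + (z *: q) -> s = z *: p -> x = r.
  by move=> -> -> -> ->; rewrite scalerDr !scalerA mulrC.
by apply: (aux _ _ _ _ _ _ _ h1 h2 _ h4); apply: etrans h3 _; congr (_ + _).
Qed.

Lemma zeta_neq0 (t : R) : zeta t != 0 :> C.
Proof.
apply/eqP => z0; have := zeta_bound 1 t; rewrite expr1z z0 /= expr0n addr0 => /eqP.
by rewrite eq_sym oner_eq0.
Qed.

Lemma zmulD j k u : zmul (j + k) u = zmul j (zmul k u).
Proof.
apply: L2_ext.
apply: aeS2 (zmulE (j + k) u) (aeS2 (fun t => @conj _ _) (zmulE j (zmul k u)) (zmulE k u)).
move=> t h1 [h2 h3].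
have aux (x y z p : 'cV[C]_n) : x = zeta t ^ (j + k) *: p -> y = zeta t ^ j *: z ->
    z = zeta t ^ k *: p -> x = y.
  by move=> -> -> ->; rewrite scalerA -expfzDr ?zeta_neq0.
exact: aux h1 h2 h3.
Qed.

Lemma zmul0 u : zmul 0 u = u.
Proof. by apply: L2_ext; apply: aeS1 (zmulE 0 u) => t h; apply: etrans h _; rewrite expr0z scale1r. Qed.

Lemma Cn_dot_lin a (x y z : 'cV[C]_n) : Cn_dot (a *: x + y) z = a * Cn_dot x z + Cn_dot y z.
Proof.
rewrite /Cn_dot mulr_sumr -big_split; apply: eq_bigr => i _.
by rewrite !mxE mulrDl mulrA.
Qed.

Lemma Cn_dotJ (x y : 'cV[C]_n) : (Cn_dot x y)^* = Cn_dot y x.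
Proof.
rewrite /Cn_dot rmorph_sum; apply: eq_bigr => i _.
by rewrite rmorphM /= conjcK mulrC.
Qed.

Lemma Cn_dot0 (x : 'cV[C]_n) : Cn_dot x 0 = 0.
Proof.
rewrite /Cn_dot big1// => i _; rewrite mxE.
have -> : (0 : C)^* = 0 by apply: complex_ext => //=; rewrite oppr0.
by rewrite mulr0.
Qed.

Lemma cintegrable_dot u v : cintegrable (fun t => Cn_dot (L2rep u t) (L2rep v t)).
Proof.
apply: (cintegrable_sum _).1 => i.
have [r1 j1] := L2rep_coord u i; have [r2 j2] := L2rep_coord v i.
exact: (@cintegrable_mulJ _ (fun t => L2rep u t i 0) (fun t => L2rep v t i 0)).
Qed.

Lemma L2dot_lin a u v w : L2dot (a *: u + v) w = a * L2dot u w + L2dot v w.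
Proof.
rewrite /L2dot -circle_int_lin; [|exact: cintegrable_dot..].
apply: circle_int_ae; [exact: cintegrable_dot| |].
  by apply: cintegrable_lin; exact: cintegrable_dot.
apply: aeS1 (L2rep_lin a u v) => t h.
exact: etrans (congr1 (fun x => Cn_dot x _) h) (Cn_dot_lin _ _ _ _).
Qed.

Lemma L2dotJ u v : L2dot v u = (L2dot u v)^*.
Proof.
rewrite /L2dot -circle_intJ; last exact: cintegrable_dot.
by congr circle_int; apply/funext => t; rewrite Cn_dotJ.
Qed.

Lemma zeta_norm k (t : R) : zeta t ^ k * (zeta t ^ k)^* = 1.
Proof.
have := zeta_bound k t; case: (zeta t ^ k) => x y /= xy.
apply: complex_ext => /=; first by rewrite mulrN opprK -!expr2.
by rewrite mulrN [y * x]mulrC addNr.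
Qed.

Lemma L2dot_zmul k u v : L2dot (zmul k u) (zmul k v) = L2dot u v.
Proof.
apply: circle_int_ae; [exact: cintegrable_dot..|].
have dotZ (z : C) (x y : 'cV[C]_n) : z * z^* = 1 -> Cn_dot (z *: x) (z *: y) = Cn_dot x y.
  move=> z1; rewrite /Cn_dot; apply: eq_bigr => i _; rewrite !mxE rmorphM mulrACA.
  by rewrite z1 mul1r.
apply: aeS2 (zmulE k u) (zmulE k v) => t h1 h2.
exact: etrans (congr2 _ h1 h2) (dotZ _ _ _ (zeta_norm k t)).
Qed.

Lemma L2normE u : `|u| = (Num.sqrt (Re (L2dot u u)))%:C. Proof. by []. Qed.

Lemma L2dot_eq0 u : L2dot u u = 0 -> u = 0.
Proof. by move=> u0; apply: normr0_eq0; rewrite L2normE u0 sqrtr0. Qed.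

Lemma norm_zmul k u : `|zmul k u| = `|u|.
Proof. by rewrite !L2normE L2dot_zmul. Qed.

Lemma cintegrable_fourier u k i : cintegrable (fun t => L2rep u t i 0 * zeta t ^ (- k)).
Proof.
have /forallP/(_ i)/andP[r1 j1] := square_integrable_zeta (- k) (valP (repr u)).
have := cintegrable_L2 r1 j1; congr cintegrable.
by apply/funext => t; rewrite mxE mulrC.
Qed.

Lemma fourier_lin a u v k : fourier (a *: u + v) k = a *: fourier u k + fourier v k.
Proof.
apply/matrixP => i j; rewrite !mxE -circle_int_lin; [|exact: cintegrable_fourier..].
apply: circle_int_ae; first exact: cintegrable_fourier.
  by apply: cintegrable_lin; exact: cintegrable_fourier.
apply: aeS1 (L2rep_lin a u v) => t h.
apply: etrans (congr1 (fun x : 'cV[C]_n => x i 0 * _) h) _.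
by rewrite !mxE mulrDl mulrA.
Qed.

Lemma fourier_zmul j u k : fourier (zmul j u) k = fourier u (k - j).
Proof.
apply/matrixP => i l; rewrite !mxE; apply: circle_int_ae; [exact: cintegrable_fourier..|].
apply: aeS1 (zmulE j u) => t h.
apply: etrans (congr1 (fun x : 'cV[C]_n => x i 0 * _) h) _; rewrite mxE mulrC mulrA -expfzDr ?zeta_neq0// mulrC.
by rewrite opprB addrC.
Qed.

Definition L2cst (c : 'cV[C]_n) : H := L2class (fun=> c).

Lemma L2cstE c : {ae circle, forall t, L2rep (L2cst c) t = c}.
Proof. by apply: L2rep_class; exact: square_integrable_cst. Qed.

Lemma L2cst_lin a x y : L2cst (a *: x + y) = a *: L2cst x + L2cst y.
Proof.
apply: L2_ext.
apply: aeS2 (aeS2 (fun t => @conj _ _) (L2cstE (a *: x + y)) (L2rep_lin a (L2cst x) (L2cst y)))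
  (aeS2 (fun t => @conj _ _) (L2cstE x) (L2cstE y)).
move=> t [h1 h2] [h3 h4].
by apply: etrans h1 _; apply/esym; apply: etrans h2 _; congr (_ *: _ + _).
Qed.

Lemma L2cst0 : L2cst 0 = 0.
Proof. by have := L2cst_lin (-1) 0 0; rewrite scaler0 addr0 scaleN1r addNr. Qed.

Lemma fourier_cst c k : fourier (L2cst c) k = if k == 0 then c else 0.
Proof.
apply/matrixP => i l; rewrite (ord1 l) mxE.
have cz : cintegrable (fun t : R => zeta t ^ (- k)).
  by have [h1 h2] := @zeta_L2 R (- k); exact: cintegrable_L2.
have cz0 := @cintegrable0 R.
have -> : circle_int (fun t => L2rep (L2cst c) t i 0 * zeta t ^ (- k)) =
    circle_int (fun t : R => c i 0 * zeta t ^ (- k) + 0).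
  apply: circle_int_ae; [exact: cintegrable_fourier|exact: cintegrable_lin|].
  apply: aeS1 (L2cstE c) => t h.
  by apply: etrans (congr1 (fun x : 'cV[C]_n => x i 0 * _) h) _; rewrite addr0.
rewrite circle_int_lin// circle_int_cst addr0; case: eqVneq => [->|k0].
  have -> : (fun t : R => zeta t ^ (- (0 : int))) = (fun=> 1).
    by apply/funext => t; rewrite oppr0 expr0z.
  by rewrite circle_int_cst mulr1.
by rewrite circle_int_zeta ?oppr_eq0// mulr0 mxE.
Qed.

Lemma L2dot_cst c u : L2dot (L2cst c) u = Cn_dot c (fourier u 0).
Proof.
have cf i : cintegrable (fun t => L2rep u t i 0).
  have := cintegrable_fourier u 0 i; congr cintegrable.
  by apply/funext => t; rewrite oppr0 expr0z mulr1.
rewrite L2dotJ -[RHS]conjcK; congr (_^*); rewrite Cn_dotJ.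
have -> : L2dot u (L2cst c) = circle_int (fun t => \sum_i (L2rep u t i 0 * (c i 0)^*)).
  apply: circle_int_ae; first exact: cintegrable_dot.
    apply: (cintegrable_sum _).1 => i.
    have := @cintegrable_lin _ ((c i 0)^*) _ _ (cf i) (@cintegrable0 R).
    by congr cintegrable; apply/funext => t; rewrite addr0 mulrC.
  apply: aeS1 (L2cstE c) => t h.
  exact: (congr1 (fun x => Cn_dot _ x) h).
have e i : (fun t => L2rep u t i 0 * (c i 0)^*) = (fun t => (c i 0)^* * L2rep u t i 0 + 0).
  by apply/funext => t; rewrite addr0 mulrC.
rewrite (cintegrable_sum _).2 => [|i]; last first.
  by rewrite e; apply: cintegrable_lin => //; exact: cintegrable0.
apply: eq_bigr => i _; rewrite e circle_int_lin//; last exact: cintegrable0.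
rewrite circle_int_cst addr0 mulrC; congr (_ * _); rewrite mxE.
by congr circle_int; apply/funext => t; rewrite oppr0 expr0z mulr1.
Qed.

End HilbertSpace.

(** * Fredholm pairs and the Grassmannian *)

Section Projection.
Context (R : realType) (n : nat).
Local Notation C := R[i].
Local Notation H := (L2 R n).
Implicit Types (V : set H) (u v w h p q : H) (a : C).

Definition perp V : set H := [set q | forall v, V v -> L2dot q v = 0].

Lemma L2dot0 u v : u = 0 -> L2dot u v = 0.
Proof.
by move=> ->; have := L2dot_lin (-1) 0 0 v; rewrite scaler0 addr0 mulN1r addNr.
Qed.

Lemma L2dotD u v w : L2dot (u + v) w = L2dot u w + L2dot v w.
Proof. by have := L2dot_lin 1 u v w; rewrite scale1r mul1r. Qed.

Lemma L2dotB u v w : L2dot (u - v) w = L2dot u w - L2dot v w.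
Proof. by have := L2dot_lin (-1) v u w; rewrite scaleN1r mulN1r addrC => ->; rewrite addrC. Qed.

Lemma L2dotDr u v w : L2dot u (v + w) = L2dot u v + L2dot u w.
Proof. by rewrite (L2dotJ v u) (L2dotJ w u) (L2dotJ (v + w) u) L2dotD rmorphD. Qed.

Lemma subspace_perp V : is_subspace V -> is_subspace (perp V).
Proof.
move=> _; split=> [v _|a u w pu pw v Vv]; first exact: L2dot0.
by rewrite L2dot_lin pu// pw// mulr0 addr0.
Qed.

Lemma perp_disjoint V u : V u -> perp V u -> u = 0.
Proof. by move=> Vu /(_ _ Vu)/L2dot_eq0. Qed.

Definition proj_dom V : set H := sumset V (perp V).

Lemma orth_projD V p q : is_subspace V -> V p -> perp V q -> orth_proj V (p + q) = p.
Proof.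
move=> sV Vp pq; rewrite /orth_proj; case: xgetP => [p' _ [Vp' h]|/(_ p)[]]; last first.
  by split=> // v Vv; rewrite addrAC subrr add0r; exact: pq.
apply/eqP; rewrite -subr_eq0; apply/eqP/(@perp_disjoint V); first exact: subspaceB.
move=> v Vv; have := h v Vv; rewrite !L2dotB L2dotD (pq v Vv) addr0 => /eqP.
by rewrite subr_eq0 => /eqP ->; rewrite subrr.
Qed.

(** This is the default value of xget. *)
Lemma orth_proj_out V u : is_subspace V -> ~ proj_dom V u -> orth_proj V u = 0.
Proof.
move=> sV nd; rewrite /orth_proj; case: xgetP => // p _ [Vp h]; exfalso; apply: nd.
by exists p => //; exists (u - p) => //; rewrite addrC subrK.
Qed.

Lemma subspace_proj_dom V : is_subspace V -> is_subspace (proj_dom V).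
Proof. by move=> sV; apply: subspace_sum => //; exact: subspace_perp. Qed.

Lemma orth_proj_lin V a u v : is_subspace V -> proj_dom V u -> proj_dom V v ->
  orth_proj V (a *: u + v) = a *: orth_proj V u + orth_proj V v.
Proof.
move=> sV [p Vp [q Nq <-]] [p' Vp' [q' Nq' <-]].
rewrite (orth_projD sV Vp Nq) (orth_projD sV Vp' Nq').
rewrite scalerDr addrACA orth_projD//; first by case: sV => _; apply.
by have [_] := subspace_perp sV; apply.
Qed.

Lemma orth_proj_spec V u : is_subspace V -> proj_dom V u ->
  V (orth_proj V u) /\ perp V (u - orth_proj V u).
Proof.
move=> sV [p Vp [q Nq <-]]; rewrite orth_projD//; split=> //.
by rewrite addrAC subrr add0r.
Qed.

End Projection.

Section OneSided.
Context (R : realType) (n : nat) (n_ge1 : (0 < n)%N) (e : int) (ee : e * e = 1).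
Local Notation C := R[i].
Local Notation H := (L2 R n).
Implicit Types (V W A B M : set H) (u v w h p q : H) (a : C) (k j : int) (c : 'cV[C]_n).

Definition mulz k : H -> H := zmul (e * k).

Lemma mulz_lin k a u v : mulz k (a *: u + v) = a *: mulz k u + mulz k v.
Proof. exact: zmul_lin. Qed.

Lemma mulzD j k u : mulz (j + k) u = mulz j (mulz k u).
Proof. by rewrite /mulz mulrDr zmulD. Qed.

Lemma mulz0 u : mulz 0 u = u.
Proof. by rewrite /mulz mulr0 zmul0. Qed.

Local Notation T := (translate mulz).
Local Notation translate_subspace := (translate_subspace mulz_lin).
Local Notation translateD := (translateD mulzD).
Local Notation translate0 := (translate0 mulz0).
Local Notation translateE := (translateE mulzD mulz0).
Local Notation translateK := (translateK mulzD mulz0).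
Local Notation translateKN := (translateKN mulzD mulz0).
Local Notation mulzK := (tK mulzD mulz0).
Local Notation mulzKN := (tKN mulzD mulz0).

Lemma mulzB k u v : mulz k (u - v) = mulz k u - mulz k v.
Proof. by have := mulz_lin k (-1) v u; rewrite !scaleN1r addrC => ->; rewrite addrC. Qed.

(** H^+ for e = 1 and H^- for e = -1. *)
Definition hardy : set H := [set h | forall k, k < 0 -> fourier h (e * k) = 0].

Lemma fourier0 k : fourier (0 : H) k = 0.
Proof. by have := fourier_lin (-1) (0 : H) 0 k; rewrite scaler0 addr0 scaleN1r addNr. Qed.

Lemma subspace_hardy : is_subspace hardy.
Proof.
split=> [k _|a u v hu hv k k0]; first exact: fourier0.
by rewrite fourier_lin hu// hv// scaler0 addr0.
Qed.

Local Notation N := (perp hardy).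
Local Notation D := (proj_dom hardy).

Lemma subspace_N : is_subspace N. Proof. exact: subspace_perp subspace_hardy. Qed.

Lemma subspace_D : is_subspace D. Proof. exact: subspace_proj_dom subspace_hardy. Qed.

Definition constants : set H := [set L2cst c | c in [set: 'cV[C]_n]].

Lemma const_hardy c : hardy (L2cst c).
Proof.
move=> k k0; rewrite fourier_cst mulf_eq0; case: eqP => [e0|_] /=.
  by move: ee; rewrite e0 mul0r.
by case: eqP => // k_0; rewrite k_0 ltxx in k0.
Qed.

Lemma hardy_mulz u : hardy u -> hardy (mulz 1 u).
Proof.
move=> hu k k0; rewrite fourier_zmul -mulrBr; apply: hu; lia.
Qed.

Lemma L2dot_mulz k u v : L2dot (mulz k u) (mulz k v) = L2dot u v.
Proof. exact: L2dot_zmul. Qed.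

Lemma hardy_decomp u : hardy u ->
  exists2 v, hardy v & u = L2cst (fourier u 0) + mulz 1 v.
Proof.
move=> hu; exists (mulz (-1) (u - L2cst (fourier u 0))); last first.
  by rewrite -[1]opprK mulzKN addrC subrK.
move=> k k0; rewrite fourier_zmul -mulrBr opprK.
have -> : u - L2cst (fourier u 0) = -1 *: L2cst (fourier u 0) + u by rewrite scaleN1r addrC.
rewrite fourier_lin fourier_cst mulf_eq0.
have e0 : e != 0 by apply/eqP => e0; move: ee; rewrite e0 mul0r.
rewrite (negPf e0) /=; case: eqP => k1.
  by rewrite k1 mulr0 scaleN1r addNr.
by rewrite scaler0 add0r; apply: hu; lia.
Qed.

Lemma fourier_mulz0 v : hardy v -> fourier (mulz 1 v) 0 = 0.
Proof. by move=> hv; rewrite fourier_zmul mulr1 sub0r -mulrN1; apply: hv. Qed.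

Lemma perp_mulz u : N u -> N (mulz (-1) u).
Proof.
move=> Nu v hv; rewrite -(L2dot_mulz 1) -mulzD subrr mulz0.
by apply: Nu; exact: hardy_mulz.
Qed.

(** Multiplication by z can only create a constant term. *)
Lemma perp_mulz_const u : N u -> exists2 c, N (mulz 1 u - L2cst c) & True.
Proof.
move=> Nu; exists (fourier (mulz 1 u) 0) => // v /hardy_decomp[v' hv' ->].
set c := fourier (mulz 1 u) 0; rewrite L2dotDr.
have -> : L2dot (mulz 1 u - L2cst c) (L2cst (fourier v 0)) = 0.
  rewrite L2dotJ L2dot_cst.
  have -> : mulz 1 u - L2cst c = -1 *: L2cst c + mulz 1 u by rewrite scaleN1r addrC.
  rewrite fourier_lin fourier_cst eqxx scaleN1r addNr.
  by rewrite Cn_dot0 rmorph0.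
rewrite add0r L2dotB L2dot_mulz (Nu _ hv') L2dot_cst fourier_mulz0//.
by rewrite Cn_dot0 subr0.
Qed.

Lemma mulz_const_perp c : N (mulz (-1) (L2cst c)).
Proof.
move=> v hv; rewrite -(L2dot_mulz 1) -mulzD subrr mulz0 L2dot_cst fourier_mulz0//.
exact: Cn_dot0.
Qed.

Lemma translate_perp : T 1 N = sumset N constants.
Proof.
apply/seteqP; split.
  move=> _ [u Nu <-]; have [c Nc _] := perp_mulz_const Nu.
  by exists (mulz 1 u - L2cst c) => //; exists (L2cst c); [exists c|rewrite subrK].
apply: sumset_min; first exact: translate_subspace subspace_N.
  by move=> u Nu; rewrite translateE; exact: perp_mulz.
by move=> _ [c _ <-]; rewrite translateE; exact: mulz_const_perp.
Qed.

Lemma hardyE : hardy = sumset (T 1 hardy) constants.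
Proof.
apply/seteqP; split.
  move=> u /hardy_decomp[v hv ->]; exists (mulz 1 v); first by exists v.
  by exists (L2cst (fourier u 0)); [exists (fourier u 0)|rewrite addrC].
apply: sumset_min; first exact: subspace_hardy.
  by move=> _ [u hu <-]; exact: hardy_mulz.
by move=> _ [c _ <-]; exact: const_hardy.
Qed.

(** The coordinates of the constants are released one at a time. *)
Lemma rdim_constants A : is_subspace A -> (forall c, A (L2cst c) -> c = 0) ->
  rdim (sumset A constants) A n.
Proof.
move=> sA nA.
pose F (m : nat) : set H :=
  sumset A [set L2cst c | c in [set c : 'cV[C]_n | forall i : 'I_n, (m <= i)%N -> c i 0 = 0]].
have sF m : is_subspace (F m).
  apply: subspace_sum => //; split.
    by exists 0; [move=> i _; rewrite mxE|exact: L2cst0].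
  move=> a _ _ [c c0 <-] [d d0 <-]; exists (a *: c + d); last exact: L2cst_lin.
  by move=> i mi; rewrite !mxE c0// d0// mulr0 addr0.
have F0 : F 0%N = A.
  apply/seteqP; split.
    apply: sumset_min => // _ [c c0 <-].
    have -> : c = 0 by apply/matrixP => i j; rewrite (ord1 j) mxE c0.
    by rewrite L2cst0; case: sA.
  by move=> u Au; exists u => //; exists 0; [exists 0; [move=> i _; rewrite mxE|exact: L2cst0]|rewrite addr0].
have Fn : F n = sumset A constants.
  apply/seteqP; split; apply: sumsetS => // _ [c _ <-]; exists c => // i ni.
  by have := ltn_ord i; rewrite ltnNge ni.
suff main (j : nat) : (j <= n)%N -> rdim (F n) (F (n - j)%N) j.
  by have := main n (leqnn n); rewrite subnn F0 Fn.
elim: j => [_|j IH jn]; first by rewrite subn0; exact: rdim0.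
apply: rdimS (IH (ltnW jn)) (sF _) _.
set m := (n - j.+1)%N; have -> : (n - j)%N = m.+1 by rewrite /m; lia.
have mn : (m < n)%N by rewrite /m; lia.
pose i0 := Ordinal mn; pose d : 'cV[C]_n := delta_mx i0 0.
split.
  apply: sumsetS => // _ [c c0 <-]; exists c => // i mi; apply: c0; exact: ltnW.
exists (L2cst d); split.
- apply: sumset_subr => //; exists d => // i mi; rewrite mxE.
  by rewrite -val_eqE /= gtn_eqF.
- move=> [u Au [_ [c c0 <-] uc]].
  have : A (L2cst (-1 *: c + d)).
    have -> : L2cst (-1 *: c + d) = -1 *: L2cst c + L2cst d by exact: L2cst_lin.
    by rewrite -uc addrCA scaleN1r addNr addr0.
  move=> /nA/matrixP/(_ i0 0); rewrite !mxE !eqxx c0 /= ?leqnn// mulr0 add0r.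
  by move/eqP; rewrite oner_eq0.
move=> _ [u Au [_ [c c0 <-] <-]]; exists (c i0 0); exists u => //.
exists (L2cst (- (c i0 0) *: d + c)).
  exists (- (c i0 0) *: d + c) => // i mi; rewrite !mxE eqxx andbT.
  have [->|ii0] := eqVneq i i0; first by rewrite mulr1 addNr.
  rewrite mulr0 add0r c0//.
  by rewrite ltn_neqAle mi andbT; apply: contra ii0 => /eqP ii0; rewrite -val_eqE /= -ii0.
have -> : L2cst (- (c i0 0) *: d + c) = - (c i0 0) *: L2cst d + L2cst c by exact: L2cst_lin.
by rewrite scaleNr addrCA addrC.
Qed.

Lemma rdim_translate_perp : rdim (T 1 N) N n.
Proof.
rewrite translate_perp; apply: rdim_constants; first exact: subspace_N.
move=> c Nc; have /= := Nc _ (const_hardy c); rewrite L2dot_cst fourier_cst eqxx => h.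
by apply: Re_Cn_dot_eq0; rewrite h.
Qed.

Lemma rdim_hardy : rdim hardy (T 1 hardy) n.
Proof.
rewrite {1}hardyE; apply: rdim_constants; first exact: translate_subspace subspace_hardy.
by move=> c [u hu uc]; have := fourier_mulz0 hu; rewrite uc fourier_cst eqxx.
Qed.

(** Otherwise the Hardy space and its proper translate would have the same dimension. *)
Lemma hardy_infinite m : ~ rdim hardy [set 0] m.
Proof.
move=> r; have := rdim_translate mulz_lin mulzD mulz0 1 r.
have -> : T 1 [set 0] = [set 0].
  have m0 : mulz 1 0 = 0.
    by have := mulz_lin 1 (-1) 0 0; rewrite scaler0 addr0 scaleN1r addNr.
  by apply/seteqP; split=> [_ [_ -> <-]//|_ ->]; exists 0.
move=> /(rdim_trans rdim_hardy)/(rdim_uniq subspace_hardy r); lia.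
Qed.

Lemma translate_proj_dom k : T k D = D.
Proof.
have T1 : T 1 D `<=` D.
  move=> _ [_ [p hp [q Nq <-]] <-]; have [c Nc _] := perp_mulz_const Nq.
  exists (mulz 1 p + L2cst c); first apply: subspaceD subspace_hardy (hardy_mulz hp) (const_hardy c).
  exists (mulz 1 q - L2cst c) => //.
  by rewrite (t_add mulz_lin) addrACA subrr addr0.
have T1' : T (-1) D `<=` D.
  move=> _ [_ [p /hardy_decomp[v hv ->] [q Nq <-]] <-].
  exists v => //; exists (mulz (-1) (L2cst (fourier p 0)) + mulz (-1) q).
    by apply: subspaceD subspace_N (mulz_const_perp _) (perp_mulz Nq).
  have e1 := t_add mulz_lin (-1) (L2cst (fourier p 0) + mulz 1 v) q.
  have e2 := t_add mulz_lin (-1) (L2cst (fourier p 0)) (mulz 1 v).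
  have e3 : mulz (-1) (mulz 1 v) = v := mulzK 1 v.
  have sumE (x y z s r : H) : s = r + z -> r = x + y -> y + (x + z) = s.
    by move=> -> ->; rewrite addrA (addrC y).
  by apply: sumE e1 _; apply: etrans e2 _; exact: congr1 e3.
have nat (m : nat) : T m%:Z D `<=` D /\ T (- m%:Z) D `<=` D.
  elim: m => [|m [h1 h2]]; first by rewrite oppr0 translate0; split; exact: subset_refl.
  rewrite intS opprD !translateD; split.
    by apply: subset_trans T1; exact: translateS.
  by apply: subset_trans T1'; exact: translateS.
have le j : T j D `<=` D.
  case: j => m; first exact: (nat m).1.
  by rewrite NegzE; exact: (nat m.+1).2.
apply/seteqP; split; first exact: le.
by rewrite -[X in X `<=` _](translateKN k); apply: translateS; exact: le.
Qed.

(** The Fredholm property of the projection of W to the Hardy space, in terms of its kernel N. *)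
Definition fredholm_pair W : Prop := [/\ W `<=` D,
  exists k : nat, rdim (W `&` N) [set 0] k & exists d : nat, rdim D (sumset W N) d].

Local Notation P := (orth_proj hardy).

Lemma proj_eq0 u : D u -> (P u = 0 <-> N u).
Proof.
move=> Du; have [hPu NPu] := orth_proj_spec subspace_hardy Du.
split=> [P0|Nu]; first by rewrite P0 subr0 in NPu.
apply: (@perp_disjoint _ _ hardy) => //.
by rewrite -[P u](subKr u); apply: subspaceB subspace_N Nu NPu.
Qed.

Lemma proj_image W : is_subspace W -> W `<=` D -> P @` W = hardy `&` sumset W N.
Proof.
move=> sW WD; apply/seteqP; split.
  move=> _ [w Ww <-]; have [hPw NPw] := orth_proj_spec subspace_hardy (WD _ Ww).
  split=> //; exists w => //; exists (P w - w); last by rewrite addrC subrK.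
  by rewrite -opprB; exact: subspaceN subspace_N NPw.
move=> h [hh [w Ww [q Nq e1]]]; exists w => //.
have [hPw NPw] := orth_proj_spec subspace_hardy (WD _ Ww).
apply/esym/eqP; rewrite -subr_eq0; apply/eqP/(@perp_disjoint _ _ hardy).
  exact: subspaceB subspace_hardy hh hPw.
by rewrite -e1 addrAC; exact: subspaceD subspace_N NPw Nq.
Qed.

(** The projection is 0 outside its domain, so the Fredholm property forces W into the domain:
otherwise the kernel would contain the complement of a proper subspace of W, hence all of W, and
the Hardy space would be finite-dimensional. *)
Lemma fredholm_pairP W : is_subspace W ->
  (fredholm_on P W hardy <-> fredholm_pair W).
Proof.
move=> sW; have sh := subspace_hardy; have sN := subspace_N; have sD := subspace_D.
have sWN := subspace_sum sW sN.
split=> [[fdim fcod]|[WD [k rk] [d rd]]].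
  have sK := finite_dim_subspace fdim.
  have WD : W `<=` D.
    move=> w Ww; apply: contrapT => nDw.
    (* For x in W and in D, w + x is outside D; so w, w + x and their difference x have
       projection 0. *)
    have Kw : [set w | W w /\ P w = 0] w by split=> //; exact: orth_proj_out.
    have P0 x : W x -> P x = 0.
      move=> Wx; have [Dx|nDx] := pselect (D x); last exact: orth_proj_out.
      have Kwx : [set w | W w /\ P w = 0] (w + x).
        split; first exact: subspaceD.
        apply: orth_proj_out => // Dwx; apply: nDw.
        by rewrite -(addrK x w); exact: subspaceB.
      have := subspaceB sK Kwx Kw; rewrite addrAC subrr add0r.
      by case.
    have e1 : P @` W = [set 0].
      apply/seteqP; split=> [_ [x Wx <-]|_ ->]; first exact: P0.
      by exists 0; [case: sW|apply: P0; case: sW].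
    rewrite e1 in fcod.
    have [|m /hardy_infinite//] := finite_codim_rdim (@subspace0 _ _) sh _ fcod.
    by move=> _ ->; case: sh.
  split=> //.
    have e1 : [set w | W w /\ P w = 0] = W `&` N.
      by apply/seteqP; split=> w [Ww /(proj_eq0 (WD _ Ww))].
    rewrite e1 in fdim sK; exact: finite_dim_rdim.
  have [||d rd] := finite_codim_rdim _ sh _ fcod.
  - by rewrite proj_image//; exact: subspaceI.
  - by rewrite proj_image// => x [].
  rewrite proj_image// in rd; exists d.
  have -> : D = sumset hardy (sumset W N).
    apply/seteqP; split; first by apply: sumsetS => //; exact: sumset_subr.
    apply: sumset_min => //; first exact: sumset_subl.
    by apply: sumset_min => //; exact: sumset_subr.
  have {2}-> : sumset W N = sumset (hardy `&` sumset W N) (sumset W N).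
    apply/seteqP; split; first by apply: sumset_subr; exact: subspaceI.
    by apply: sumset_min => // x [].
  exact: (rdim_add sh sWN rd (@subset_refl _ _)).
split.
  have -> : [set w | W w /\ P w = 0] = W `&` N.
    by apply/seteqP; split=> w [Ww /(proj_eq0 (WD _ Ww))].
  by apply: rdim_finite_dim rk; exact: subspaceI.
rewrite proj_image//; apply: (@rdim_finite_codim _ _ _ _ d) => //.
have {1}-> : hardy = hardy `&` D.
  by apply/seteqP; split=> [x hx|x []//]; split=> //; exact: sumset_subl.
apply: rdim_cap rd _ => //.
move=> _ [p hp [q Nq <-]]; exists q; first exact: sumset_subr.
by exists p; rewrite // addrC.
Qed.

Lemma translate_cap k A B : T k (A `&` B) = T k A `&` T k B.
Proof. by apply/seteqP; split=> u; rewrite /setI /= !translateE. Qed.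

Lemma translate_sum k A B : T k (sumset A B) = sumset (T k A) (T k B).
Proof.
apply/seteqP; split.
  move=> _ [_ [u Au [v Bv <-]] <-]; exists (mulz k u); first by exists u.
  by exists (mulz k v); [exists v|rewrite (t_add mulz_lin)].
move=> _ [_ [u Au <-] [_ [v Bv <-] <-]]; exists (u + v); last exact: (t_add mulz_lin).
by exists u => //; exists v.
Qed.

Lemma translate_set0 k : T k [set 0] = [set 0].
Proof.
have m0 : mulz k 0 = 0.
  by have := mulz_lin k (-1) 0 0; rewrite scaler0 addr0 scaleN1r addNr.
by apply/seteqP; split=> [_ [_ -> <-]//|_ ->]; exists 0.
Qed.

(** With X the translate of W, the four dimensions in W + N, X + N, W and N, X and N are compared
twice: through X + z N and X and z N, which have the same codimension and dimension as W + N and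
W and N, and directly. *)
Lemma fredholm_pair_rdim W : is_subspace W -> fredholm_pair W -> T 1 W `<=` W ->
  rdim W (T 1 W) n.
Proof.
move=> sW [WD [k rk] [d rd]] W1; set X := T 1 W in W1 *.
have sN := subspace_N; have sD := subspace_D.
have sX : is_subspace X by exact: translate_subspace.
have sTN : is_subspace (T 1 N) by exact: translate_subspace.
have sub0 A : is_subspace A -> [set 0] `<=` A by move=> [A0 _] _ ->.
have rk1 : rdim (T 1 N `&` X) [set 0] k.
  by have := rdim_translate mulz_lin mulzD mulz0 1 rk; rewrite translate_cap translate_set0 setIC.
have rd1 : rdim D (sumset (T 1 N) X) d.
  by have := rdim_translate mulz_lin mulzD mulz0 1 rd; rewrite translate_proj_dom translate_sum sumsetC.
have [d1 [d2 [r1 r2 d12]]] := rdim_modular_inv sN sTN sX rdim_translate_perp.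
have rD := rdim_trans rd1 r1.
have NTN : N `<=` T 1 N by exact: rdim_sub rdim_translate_perp.
have [e1 [e2 [s1 s2 e12]]] := rdim_split (subspaceI sTN sX) (subspaceI sN sX) rk1
  (sub0 _ (subspaceI sN sX)) (setSI NTN).
have ed2 : e1 = d2 by exact: rdim_uniq (subspaceI sTN sX) s1 r2.
have XN : sumset N X `<=` sumset W N by rewrite sumsetC; apply: sumsetS.
have [a1 [a2 [t1 t2 a12]]] := rdim_split sD (subspace_sum sW sN) rD XN (rdim_sub rd).
have ed : a1 = d by exact: rdim_uniq sD t1 rd.
have XNI : N `&` X `<=` W `&` N by move=> x [Nx Xx]; split=> //; exact: W1.
have [b1 [b2 [u1 u2 b12]]] := rdim_split (subspaceI sW sN) (subspaceI sN sX) rk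
  (sub0 _ (subspaceI sN sX)) XNI.
have eb2 : b2 = e2 by exact: rdim_uniq (subspaceI sN sX) u2 s2.
(* a2 = d1, as d + a2 = d + d1; b1 = d2, as both are k minus the dimension of X and N. *)
have nE : (a2 + b1)%N = n by lia.
have := rdim_modular sX sW sN W1; rewrite [sumset X N]sumsetC [X `&` N]setIC.
by move=> /(_ _ _ t2 u1); rewrite nE.
Qed.

Lemma fredholm_pair_sub W A d : is_subspace W -> is_subspace A -> fredholm_pair W ->
  rdim W A d -> fredholm_pair A.
Proof.
move=> sW sA [WD [k rk] [c rc]] r; have AW := rdim_sub r; have sN := subspace_N.
split; first exact: subset_trans AW WD.
  have sAN := subspaceI sA sN.
  have [||_ [k2 [_ r2 _]]] := rdim_split (subspaceI sW sN) sAN rk.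
  - by move=> _ ->; case: sAN.
  - exact: setSI.
  by exists k2.
have [d1 [d2 [r1 _ _]]] := rdim_modular_inv sA sW sN r.
by exists (c + d1)%N; exact: rdim_trans rc r1.
Qed.

Lemma fredholm_pair_sup A B d : is_subspace A -> is_subspace B -> fredholm_pair A ->
  rdim B A d -> B `<=` D -> fredholm_pair B.
Proof.
move=> sA sB [AD [k rk] [c rc]] r BD; have sN := subspace_N; have AB := rdim_sub r.
have [d1 [d2 [r1 r2 _]]] := rdim_modular_inv sA sB sN r.
split=> //; first by exists (d2 + k)%N; exact: rdim_trans r2 rk.
have [||d3 [_ [r3 _ _]]] := rdim_split subspace_D (subspace_sum sB sN) rc.
- exact: sumsetS.
- by apply: sumset_min => //; [exact: subspace_D|apply: sumset_subr subspace_hardy].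
by exists d3.
Qed.

Lemma translate_closed k W : closed W -> closed (T k W).
Proof.
move=> cW u /closure_normP cu; rewrite translateE; apply/cW/closure_normP => r r0.
have [v Wv uv] := cu r r0; exists (mulz (- k) v).
  exact: (eq_ind _ id Wv _ (translateE k W v)).
by rewrite -mulzB norm_zmul.
Qed.

Lemma rdim_translates W j (m : nat) : rdim W (T 1 W) n -> is_subspace W ->
  exists d, rdim (T j W) (T (j + m%:Z) W) d.
Proof.
move=> r sW; elim: m => [|m [d rd]]; first by exists 0%N; rewrite addr0; exact: rdim0.
exists (d + n)%N; apply: rdim_trans rd _.
have := rdim_translate mulz_lin mulzD mulz0 (j + m%:Z) r.
by rewrite -translateD -addrA intS [m%:Z + 1]addrC.
Qed.

Section Grassmannian.
Context (V : set H) (sV : is_subspace V).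

(** Relative to the projections onto the Hardy space and onto V, the latter being H^-- or H^++. *)
Definition grass : set (set H) := [set W | [/\ is_subspace W, closed W,
  fredholm_on P W hardy & compact_on (orth_proj V) W] /\ T 1 W `<=` W].

Lemma grass_sub W : grass W -> is_subspace W.
Proof. by move=> [[]]. Qed.

Lemma grass_rdim W : grass W -> rdim W (T 1 W) n.
Proof.
move=> [[sW _ /(fredholm_pairP sW) fW _] W1]; exact: fredholm_pair_rdim.
Qed.

(** M is a finite extension of a translate A of W that is deep enough to lie in W. *)
Lemma grass_between W M (a b : int) : grass W -> is_subspace M -> T 1 M `<=` M ->
  T a W `<=` M -> M `<=` T b W -> grass M.
Proof.
move=> gW sM M1 aM Mb; have rW := grass_rdim gW.
have [[sW cW fW kW] W1] := gW; move/(fredholm_pairP sW) in fW.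
pose m := absz (`|a| + `|b|)%R; pose A := T (b + m%:Z) W.
have sA : is_subspace A by exact: translate_subspace.
have AM : A `<=` M.
  by apply: subset_trans aM; apply: (translate_stableS mulzD mulz0) => //; rewrite /m; lia.
have AW : A `<=` W by apply: (translate_stable mulzD mulz0) => //; rewrite /m; lia.
have [dA rA] : exists d, rdim W A d.
  have [d] := rdim_translates 0 (absz (b + m%:Z)) rW sW.
  rewrite translate0 add0r gez0_abs; last by rewrite /m; lia.
  by move=> r; exists d.
have fA := fredholm_pair_sub sW sA fW rA.
have [d rd] := rdim_translates b m rW sW.
have sTb : is_subspace (T b W) by exact: translate_subspace.
have [d1 [d2 [_ r2 _]]] := rdim_split sTb sM rd AM Mb.
have MD : M `<=` D.
  apply: subset_trans Mb _; rewrite -(translate_proj_dom b); apply: translateS.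
  by case: fW.
have [cM kM] := rdim_closed_compact (@complex_bounded_compact R) (subspace_proj_dom sV)
  (fun a u v => @orth_proj_lin _ _ _ a u v sV) (fun u => orth_proj_out sV)
  sM r2 (translate_closed cW) (compact_onS AW kW).
split=> //; split=> //.
by apply/(fredholm_pairP sM); exact: fredholm_pair_sup sA sM fA r2 MD.
Qed.

(** Multiplication by z^k and by z^(e k) have the same orbits. *)
Lemma flag_complex_city (n_ge2 : (2 <= n)%N) (F : realType) :
  affine_city F (flag_complex grass e).
Proof.
have eek k : e * (e * k) = k by rewrite mulrA ee mul1r.
have mz k u : mulz (e * k) u = zmul k u by exact: (congr1 (fun j => zmul j u) (eek k)).
have Tz k W : T (e * k) W = zshift k W by apply: eq_imagel => u _; exact: mz.
have orbE W : range (fun k => zshift k W) = orb mulz W.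
  apply/seteqP; split=> _ [k _ <-]; first by exists (e * k) => //; exact: Tz.
  by exists (e * k) => //; rewrite -Tz eek.
have TE1 W : T 1 W = zshift e W by rewrite -[1]eek mulr1 Tz.
have e1 : elementary_flags grass = [set orb mulz W | W in grass].
  apply/seteqP; split=> _ [W GW <-]; exists W; [exact: GW|exact/esym/orbE
    |exact: GW|exact: orbE].
have e2 : periodic_flags grass e = [set range U | U in periodic_flag n mulz grass].
  apply/seteqP; split=> _ [U [GU US UT] <-]; exists U; [split|exact: erefl|split|exact: erefl].
  - exact: GU.
  - exact: US.
  - by move=> k; rewrite -(UT k); exact (TE1 (U k)).
  - exact: GU.
  - exact: US.
  - by move=> k; rewrite -(UT k); exact (esym (TE1 (U k))).
suff -> : flag_complex grass e = full_complex n mulz grass.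
  exact: (full_complex_city n_ge2 mulz_lin mulzD mulz0 grass_sub grass_rdim grass_between).
apply: etrans (periodic_complexE n_ge2 mulz_lin mulzD mulz0 grass_sub grass_rdim grass_between).
by rewrite /flag_complex e1 e2.
Qed.

End Grassmannian.
End OneSided.

Section HardySpaces.
Context (R : realType) (n : nat).
Local Notation H := (L2 R n).

Lemma fourierD (u v : H) k : fourier (u + v) k = fourier u k + fourier v k.
Proof. by have := fourier_lin 1 u v k; rewrite !scale1r. Qed.

Lemma HpE : @Hp R n = hardy 1.
Proof.
apply/seteqP; split=> [_ [u hu [_ [c _ <-] <-]] k k0|u hu].
  rewrite mul1r fourierD hu ?ltW// add0r fourier_cst.
  by case: eqP => // k_0; rewrite k_0 ltxx in k0.
exists (-1 *: L2cst (fourier u 0) + u); last first.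
  by exists (L2cst (fourier u 0)); [exists (fourier u 0)|rewrite scaleN1r addrAC addNr add0r].
move=> k; rewrite le_eqVlt fourier_lin fourier_cst => /predU1P[->|k0].
  by rewrite eqxx scaleN1r addNr.
by rewrite lt_eqF// scaler0 add0r -[k]mul1r; exact: hu.
Qed.

Lemma HmE : @Hm R n = hardy (-1).
Proof.
apply/seteqP; split=> [_ [_ [c _ <-] [u hu <-]] k k0|u hu].
  rewrite mulN1r fourierD hu ?oppr_ge0 ?ltW// addr0 fourier_cst oppr_eq0.
  by case: eqP => // k_0; rewrite k_0 ltxx in k0.
exists (L2cst (fourier u 0)); first by exists (fourier u 0).
exists (-1 *: L2cst (fourier u 0) + u); last by rewrite scaleN1r addrA subrr add0r.
move=> k; rewrite le_eqVlt fourier_lin fourier_cst eq_sym => /predU1P[->|k0].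
  by rewrite eqxx scaleN1r addNr.
rewrite gt_eqF// scaler0 add0r -[k]opprK -mulN1r; apply: hu.
by rewrite oppr_lt0.
Qed.

Lemma subspace_fourier0 (S : int -> bool) :
  is_subspace [set h : H | forall k, S k -> fourier h k = 0].
Proof.
split=> [k _|a u v hu hv k Sk]; first exact: fourier0.
by rewrite fourier_lin hu// hv// scaler0 addr0.
Qed.

End HardySpaces.

Theorem theorem3p1 (R : realType) (n : nat) (n_ge2 : (2 <= n)%N) :
  affine_city R (positive_flag_complex R n) /\
  affine_city R (negative_flag_complex R n).
Proof.
have n0 : (0 < n)%N by exact: ltnW.
split.
  have sV : is_subspace (@Hmm R n) by exact: (@subspace_fourier0 R n (fun k => 0 <= k)).
  have := @flag_complex_city R n n0 1 (mulr1 1) (@Hmm R n) sV n_ge2 R.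
  suff -> : grass 1 (@Hmm R n) = @Grn_pos R n by [].
  rewrite /grass -HpE; apply/seteqP; split=> W [GW W1]; split=> //.
have sV : is_subspace (@Hpp R n) by exact: (@subspace_fourier0 R n (fun k => k <= 0)).
have := @flag_complex_city R n n0 (-1) (mulrNN 1 1) (@Hpp R n) sV n_ge2 R.
suff -> : grass (-1) (@Hpp R n) = @Grn_neg R n by [].
rewrite /grass -HmE; apply/seteqP; split=> W [GW W1]; split=> //.
Qed.
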